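(* Let $(A,\mathfrak{m})$ be a Cohen-Macaulay local ring with infinite residue field and $\dim A=2$. Let $\mathfrak{a}$ be an $\mathfrak{m}$-primary ideal. The following conditions are equivalent: (i) $a(G_{\mathfrak{a}}(A))\le-1$. (ii) $\operatorname{red}_{\mathfrak{a}^n}(A)=1$ for all $n\gg0$. (iii) $e_2^{\mathfrak{a}}(A)=0$.
   Context: $G_{\mathfrak{a}}(A)=\bigoplus_{n\ge0}\mathfrak{a}^n/\mathfrak{a}^{n+1}$. The $a$-invariant is $a(G_{\mathfrak{a}}(A))=\max\{n: H^2_{G_{\mathfrak{a}}(A)_+}(G_{\mathfrak{a}}(A))_n\ne0\}$, where $G_{\mathfrak{a}}(A)_+=\bigoplus_{n\geq 1}\mathfrak{a}^n/\mathfrak{a}^{n+1}$. For an $\mathfrak{m}$-primary ideal $\mathfrak{q}$ and a minimal reduction $\mathfrak{c}$ of $\mathfrak{q}$, $\operatorname{red}_{\mathfrak{c}}(\mathfrak{q},A)=\min\{n:\mathfrak{c}\mathfrak{q}^n=\mathfrak{q}^{n+1}\}$, and $\operatorname{red}_{\mathfrak{q}}(A)$ is the minimum of these over all minimal reductions $\mathfrak{c}$ of $\mathfrak{q}$. Writing $\sum_{n\ge0}\ell(\mathfrak{a}^n/\mathfrak{a}^{n+1})z^n=h(z)/(1-z)^{2}$ with $h(z)\in\mathbb{Z}[z]$, one sets $e_i^{\mathfrak{a}}(A)=h^{(i)}(1)/i!$. *)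

(* Defs.v *)
From HB Require Import structures.
From mathcomp Require Import all_boot all_order all_algebra.
From mathcomp Require Import boolp classical_sets cardinality.

Set Implicit Arguments.
Unset Strict Implicit.
Unset Printing Implicit Defensive.

Import Order.TTheory GRing.Theory Num.Theory.
Local Open Scope classical_set_scope.
Local Open Scope ring_scope.

Section Ideals.
Variable R : comNzRingType.
Implicit Types (I J K : set R) (S : set R).

(* The unit ideal is allowed. *)
Definition is_ideal I : Prop :=
  I 0 /\ forall r x y, I x -> I y -> I (r * x + y).

Definition ideal_gen S : set R := smallest is_ideal S.

Definition ideal_mul I J : set R := ideal_gen [set x * y | x in I & y in J].

Definition ideal_exp I (n : nat) : set R := iter n (ideal_mul I) setT.

Lemma ideal_gen_ideal S : is_ideal (ideal_gen S).
Proof.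
split=> [I [[I0 _] _] //|r x y Sx Sy I [II SI]].
by apply: II.2; [apply: Sx | apply: Sy].
Qed.

Lemma sub_ideal_gen S : S `<=` ideal_gen S.
Proof. by move=> x Sx I [_]; apply. Qed.

Lemma ideal_gen_min S I : is_ideal I -> S `<=` I -> ideal_gen S `<=` I.
Proof. by move=> II SI x; apply. Qed.

Lemma ideal_exp_ideal I n : is_ideal (ideal_exp I n).
Proof. by case: n => [|n]; [split | apply: ideal_gen_ideal]. Qed.

Lemma idealD I x y : is_ideal I -> I x -> I y -> I (x + y).
Proof. by move=> [_ II] Ix Iy; rewrite -[x]mul1r; apply: II. Qed.

Lemma idealMl I r x : is_ideal I -> I x -> I (r * x).
Proof. by move=> [I0 II] Ix; rewrite -[_ * _]addr0; apply: II. Qed.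

Lemma ideal_sum I (T : Type) (s : seq T) (P : pred T) (F : T -> R) :
  is_ideal I -> (forall i, P i -> I (F i)) -> I (\sum_(i <- s | P i) F i).
Proof.
move=> II IF; apply: big_ind => //; first exact: II.1.
by move=> x y; apply: idealD.
Qed.

Lemma ideal_expM I i j x y :
  ideal_exp I i x -> ideal_exp I j y -> ideal_exp I (i + j)%N (x * y).
Proof.
elim: i x => [|i IHi] x Ix Iy; first exact: idealMl (ideal_exp_ideal _ _) Iy.
pose K := [set u | ideal_exp I (i.+1 + j) (u * y)].
suff: K x by [].
have E := ideal_exp_ideal I (i.+1 + j).
apply: (ideal_gen_min _ _ Ix).
  split=> [|r u v Ku Kv]; first by rewrite /K /= mul0r; apply: E.1.
  by rewrite /K /= mulrDl -mulrA; apply: E.2.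
move=> _ [u Iu [v Iv <-]]; rewrite /K /= -mulrA.
by apply: sub_ideal_gen; exists u => //; exists (v * y) => //; apply: IHi.
Qed.

Lemma ideal_expS I n : ideal_exp I n.+1 `<=` ideal_exp I n.
Proof.
apply: ideal_gen_min (ideal_exp_ideal _ _) _ => _ [u _ [v Iv <-]].
exact: idealMl (ideal_exp_ideal _ _) Iv.
Qed.

Definition noetherian : Prop :=
  forall I, is_ideal I -> exists s : seq R, I = ideal_gen [set` s].

Definition is_proper I : Prop := is_ideal I /\ ~ I 1.

Definition is_prime I : Prop :=
  is_proper I /\ forall x y, I (x * y) -> I x \/ I y.

Definition is_maximal I : Prop :=
  is_proper I /\ forall J, is_proper J -> I `<=` J -> J = I.

Definition is_primary I : Prop :=
  is_proper I /\ forall x y, I (x * y) -> I x \/ exists n, I (y ^+ n).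

Definition radical I : set R := [set x | exists n, I (x ^+ n)].

(* [max_chain P n]: n is the largest length of a strictly increasing chain
   K 0 < ... < K n of ideals satisfying P. *)
Definition is_chain (P : set R -> Prop) (n : nat) (K : nat -> set R) : Prop :=
  (forall i, (i <= n)%N -> P (K i)) /\
  (forall i, (i < n)%N -> K i `<` K i.+1).

Definition max_chain (P : set R -> Prop) (n : nat) : Prop :=
  (exists K : nat -> set R, is_chain P n K) /\
  (forall l (K : nat -> set R), is_chain P l K -> (l <= n)%N).

Definition krull_dim (d : nat) : Prop := max_chain is_prime d.

(* The length of the module I / J: its submodules are the K / J with K an
   ideal between J and I. *)
Definition length_quot I J (l : nat) : Prop :=
  max_chain (fun K => [/\ is_ideal K, J `<=` K & K `<=` I]) l.

Definition regular_seq (s : seq R) : Prop :=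
  ~ ideal_gen [set` s] 1 /\
  forall i, (i < size s)%N -> forall x,
    ideal_gen [set` take i s] (s`_i * x) -> ideal_gen [set` take i s] x.

Definition depth_at I (d : nat) : Prop :=
  (exists s : seq R, [/\ [set` s] `<=` I, regular_seq s & size s = d]) /\
  (forall s : seq R, [set` s] `<=` I -> regular_seq s -> (size s <= d)%N).

Definition local_ring (m : set R) : Prop :=
  is_maximal m /\ forall J, is_maximal J -> J = m.

Definition cohen_macaulay_local (m : set R) : Prop :=
  [/\ noetherian, local_ring m & exists2 d, krull_dim d & depth_at m d].

Definition primary_to (m I : set R) : Prop := is_primary I /\ radical I = m.

End Ideals.

Definition is_min (S : set nat) (n : nat) : Prop :=
  S n /\ forall k, S k -> (n <= k)%N.

Definition is_max (S : set int) (n : int) : Prop :=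
  S n /\ forall k, S k -> k <= n.

Section Reductions.
Variable R : comNzRingType.
Implicit Types q c : set R.

Definition is_reduction q c : Prop :=
  [/\ is_ideal c, c `<=` q &
      exists n, ideal_mul c (ideal_exp q n) = ideal_exp q n.+1].

Definition is_minimal_reduction q c : Prop :=
  is_reduction q c /\ forall c', is_reduction q c' -> c' `<=` c -> c' = c.

Definition red_wrt c q (r : nat) : Prop :=
  is_min [set n | ideal_mul c (ideal_exp q n) = ideal_exp q n.+1] r.

Definition reduction_number q (r : nat) : Prop :=
  is_min [set k | exists2 c, is_minimal_reduction q c & red_wrt c q k] r.

End Reductions.

Section HilbertCoefficients.
Variable R : comNzRingType.

(* \sum_n l(I^n / I^(n+1)) z^n = h / (1 - z)^d, read off coefficientwise from
   (1 - z)^d * \sum_n l(I^n / I^(n+1)) z^n = h. *)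
Definition hilbert_numerator (I : set R) (d : nat) (h : {poly int}) : Prop :=
  exists2 l : nat -> nat,
    forall n, length_quot (ideal_exp I n) (ideal_exp I n.+1) (l n) &
    forall n, \sum_(i < n.+1) ((1 - 'X) ^+ d)`_i * (l (n - i)%N)%:Z = h`_n.

(* [h^`N(i)] is the i-th derivative of h divided by i!. *)
Definition hilbert_coef (I : set R) (d i : nat) (e : int) : Prop :=
  exists2 h, hilbert_numerator I d h & e = (h^`N(i)).[1].

End HilbertCoefficients.

(* The associated graded ring is the quotient of the Rees algebra A[at] by its
   ideal a A[at]; the class of \sum_i x_i t^i, with x_i in a^i, has the class of
   x_i in a^i / a^(i+1) as its component of degree i. *)
Section AssociatedGraded.
Variables (A : comNzRingType) (a : idealr A).
Local Notation pow := (ideal_exp [set` a]).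

Definition rees_pred : {pred {poly A}} := fun p => `[< forall i, pow i p`_i >].

Lemma rees_subring_closed : subring_closed rees_pred.
Proof.
have powN i x : pow i x -> pow i (- x).
  by rewrite -mulN1r; apply: idealMl; apply: ideal_exp_ideal.
split=> [|p q /asboolP Pp /asboolP Pq|p q /asboolP Pp /asboolP Pq].
- apply/asboolP=> -[|i] //; rewrite coef1 /=.
  exact: (ideal_exp_ideal [set` a] i.+1).1.
- apply/asboolP=> i; rewrite coefB.
  by apply: idealD (Pp i) _; [apply: ideal_exp_ideal | apply: powN].
- apply/asboolP=> i; rewrite coefM; apply: ideal_sum => [|j _].
    exact: ideal_exp_ideal.
  by rewrite -{1}(subnKC (ltn_ord j : (j <= i)%N)); apply: ideal_expM.
Qed.

HB.instance Definition _ :=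
  GRing.isSubringClosed.Build {poly A} rees_pred rees_subring_closed.

Record rees := Rees { rees_val :> {poly A}; _ : rees_val \in rees_pred }.

HB.instance Definition _ := [isSub for rees_val].
HB.instance Definition _ := [Choice of rees by <:].
HB.instance Definition _ := [SubChoice_isSubComNzRing of rees by <:].

Lemma rees_val_is_zmod_morphism : zmod_morphism rees_val.
Proof. by []. Qed.

Lemma rees_val_is_monoid_morphism : monoid_morphism rees_val.
Proof. by split. Qed.

HB.instance Definition _ := GRing.isZmodMorphism.Build rees {poly A} rees_val
  rees_val_is_zmod_morphism.
HB.instance Definition _ := GRing.isMonoidMorphism.Build rees {poly A} rees_val
  rees_val_is_monoid_morphism.

Definition gr_ideal : {pred rees} :=
  fun p => `[< forall i, pow i.+1 (rees_val p)`_i >].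

Lemma gr_ideal_closed : idealr_closed gr_ideal.
Proof.
split=> [||u p q /asboolP Pp /asboolP Pq].
- by apply/asboolP=> i; rewrite raddf0 coef0; apply: (ideal_exp_ideal _ _).1.
- apply/asboolP=> /(_ 0%N); rewrite rmorph1 coef1 /= => a1.
  have aid : is_ideal [set` a].
    split=> [|r x y /= ax ay]; first exact: rpred0.
    by rewrite rpredD // idealMr.
  have : [set` a] 1.
    apply: (ideal_gen_min aid _ a1) => _ [x ax [y _ <-]].
    by rewrite mulrC; apply: idealMl aid ax.
  by rewrite /= idealr1.
- apply/asboolP=> i; rewrite rmorphD rmorphM /= coefD.
  apply: idealD (Pq i); first exact: ideal_exp_ideal.
  rewrite coefM; apply: ideal_sum => [|j _]; first exact: ideal_exp_ideal.
  have /asboolP Pu := valP u.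
  rewrite -{1}(subnKC (ltn_ord j : (j <= i)%N)) -addnS.
  exact: ideal_expM.
Qed.

HB.instance Definition _ := isIdealr.Build rees gr_ideal gr_ideal_closed.

Definition gr : comNzRingType := {ideal_quot gr_ideal}.

Definition gr_class (p : rees) : gr := \pi_({ideal_quot gr_ideal})%qT p.

Definition gr_homog (n : int) : set gr :=
  gr_class @` [set p : rees | forall i : nat, i%:Z != n -> (rees_val p)`_i = 0].

Definition gr_plus : set gr :=
  gr_class @` [set p : rees | (rees_val p)`_0 = 0].

End AssociatedGraded.

(* Local cohomology of a graded ring R (H n is the component of degree n) is
   computed by the Cech complex on a finite family f of homogeneous elements of
   degree 1 generating the ideal I:
     C^p = \bigoplus_(#|S| = p) R_(f_S),   f_S = \prod_(i in S) f_i.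
   Finitely many fractions have a common exponent in their denominators, so a
   p-cochain is given by k : nat and z : {set 'I_s} -> R, standing for
   (z S / f_S ^+ k)_S; only the z S with #|S| = p matter. *)
Section Cech.
Variables (R : comNzRingType) (H : int -> set R).
Variables (s : nat) (f : 'I_s -> R).
Implicit Types (S : {set 'I_s}) (k p : nat) (z w : {set 'I_s} -> R).

Definition cech_den S : R := \prod_(i in S) f i.

(* x / f_S ^+ k = y / f_S ^+ l in the localization R_(f_S). *)
Definition frac_eq S (x : R) k (y : R) (l : nat) : Prop :=
  exists e, cech_den S ^+ e * (cech_den S ^+ l * x - cech_den S ^+ k * y) = 0.

(* The cochain is homogeneous of degree n; f_S ^+ k has degree k * p. *)
Definition cech_homog p (n : int) k z : Prop :=
  forall S, #|S| = p -> H (n + (k * p)%:Z) (z S).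

(* The numerator over f_S ^+ k of the differential of (k, z), where
   z (S :\ i) / f_(S :\ i) ^+ k = f i ^+ k * z (S :\ i) / f_S ^+ k. *)
Definition cech_diff k z S : R :=
  \sum_(i in S)
    (-1) ^+ #|[set j in S | (j < i)%N]| * (f i ^+ k * z (S :\ i)%SET).

Definition cech_cocycle p k z : Prop :=
  forall S, #|S| = p.+1 -> frac_eq S (cech_diff k z S) k 0 0.

Definition cech_coboundary p (n : int) k z : Prop :=
  exists l w, cech_homog p.-1 n l w /\
    forall S, #|S| = p -> frac_eq S (z S) k (cech_diff l w S) l.

Definition cech_cohomology_neq0 p (n : int) : Prop :=
  exists k z, [/\ cech_homog p n k z, cech_cocycle p k z &
                  ~ cech_coboundary p n k z].

End Cech.

(* H^p_I(R)_n <> 0 for p > 0; it does not depend on the choice of f. *)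
Definition local_cohomology_neq0 (R : comNzRingType) (H : int -> set R)
    (I : set R) (p : nat) (n : int) : Prop :=
  exists s (f : 'I_s -> R),
    [/\ forall i, H 1 (f i), I = ideal_gen (range f) &
        cech_cohomology_neq0 H f p n].

Definition a_invariant (A : comNzRingType) (a : idealr A) (n : int) : Prop :=
  is_max [set k | local_cohomology_neq0 (@gr_homog A a) (@gr_plus A a) 2 k] n.

(* Main.v *)
Require Import Defs.
From HB Require Import structures.
From mathcomp Require Import all_boot all_order all_algebra.
From mathcomp Require Import boolp classical_sets functions cardinality.
From mathcomp Require Import zify ring.

Set Implicit Arguments.
Unset Strict Implicit.
Unset Printing Implicit Defensive.

Import Order.TTheory GRing.Theory Num.Theory.
Local Open Scope classical_set_scope.
Local Open Scope ring_scope.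

(* Write c = (x, y) for a two-generated reduction of a, which exists because the
   residue field is infinite and the colength H(n) of a^n is O(n^2). Every
   m-primary ideal (x, y) is generated by a regular sequence, so that
   l(A/cI) = l(A/c) + 2 l(A/I) - l(A/(I : c)) for every m-primary I. As a^(n+1) : c = a^n
   for large n (the Rees algebra is Noetherian), H has constant second difference
   L = l(A/c) for large n, and 2 H(n) = L n^2 + b n + 2 e_2.

   Any two-generated reduction d of a^k has l(A/d) = k^2 L, hence
   l(a^(2k)/d a^k) = k^2 L + 2 H(k) - H(2k) = e_2 for large k. So e_2 = 0 if and only
   if d a^k = a^(2k); this gives (ii) <-> (iii), since the minimal reductions are
   exactly the two-generated ones and a^k is not one of them for large k.

   For (i), the Cech cohomology of G on any f generating G_+ is compared with the
   one on the initial forms of x and y. In degree n the latter is the limit of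
   G_(n+2k) / (x^k, y^k) G_(n+k) along multiplication by x y. Its vanishing for all
   n >= 0 lifts to A, degree by degree, and says that every z in a^(2k) satisfies
   (x y)^e z in (x^(k+e), y^(k+e)) a^(k+e) for some e; for large k these quotients
   of A have the same length e_2 and surjective transition maps, so it means
   a^(2k) = (x^k, y^k) a^k. It cannot vanish for all n >= -2, because then
   (x y)^e would lie in (x^(e+1), y^(e+1)) for some e. *)

(** * Ideals and Noetherian rings *)

(** Lengths are handled through ideals of [A] alone, since [length_quot] counts chains of ideals:
    exact sequences become equalities of colengths deduced from [colen_scale], and regular sequences
    become the syzygy condition [koszul_exact], which passes from one regular pair to every pair
    generating an open ideal, hence to all powers [x ^+ i, y ^+ j] at once. The existence of a
    two-generated reduction usually goes through Noether normalization of the fiber cone. In (i) the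
    obstacle is that [x] and [y] generate [G_+] only up to radical, whereas [f] ranges over
    generating families. The two are compared by explicit gluing, with numerators and exponents in
    place of localizations; each correction costs a power of [x y], and [lin2_pow_saturated] cancels
    the accumulated exponent [e]. *)

Section IdealTheory.
Variable R : comNzRingType.
Implicit Types (I J K : set R) (x y z : R).

Lemma idealN I x : is_ideal I -> I x -> I (- x).
Proof. by move=> II Ix; rewrite -mulN1r; apply: idealMl. Qed.

Lemma idealB I x y : is_ideal I -> I x -> I y -> I (x - y).
Proof. by move=> II Ix Iy; apply: idealD => //; apply: idealN. Qed.

Lemma ideal_mulr I r x : is_ideal I -> I x -> I (x * r).
Proof. by move=> II Ix; rewrite mulrC; apply: idealMl. Qed.

Lemma ideal_addr I x y : is_ideal I -> I y -> I (x + y) -> I x.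
Proof. by move=> II Iy Ixy; rewrite -(addrK y x); apply: idealB. Qed.

Lemma ideal_setT : is_ideal [set: R]. Proof. by split. Qed.

Lemma ideal_setI I J : is_ideal I -> is_ideal J -> is_ideal (I `&` J).
Proof.
move=> II JJ; split=> [|r x y [Ix Jx] [Iy Jy]]; first by split; [apply: II.1|apply: JJ.1].
by split; [apply: II.2|apply: JJ.2].
Qed.

Definition ideal_add I J : set R :=
  [set z | exists x y, [/\ I x, J y & z = x + y]].

Lemma ideal_add_ideal I J : is_ideal I -> is_ideal J -> is_ideal (ideal_add I J).
Proof.
move=> II JJ; split=> [|r _ _ [x [y [Ix Jy ->]]] [z [t [Iz Jt ->]]]].
  by exists 0, 0; rewrite addr0; split; [apply: II.1|apply: JJ.1|].
exists (r * x + z), (r * y + t); split; [exact: II.2|exact: JJ.2|ring].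
Qed.

Lemma sub_ideal_addl I J : is_ideal J -> I `<=` ideal_add I J.
Proof. by move=> JJ x Ix; exists x, 0; rewrite addr0; split=> //; apply: JJ.1. Qed.

Lemma sub_ideal_addr I J : is_ideal I -> J `<=` ideal_add I J.
Proof. by move=> II x Jx; exists 0, x; rewrite add0r; split=> //; apply: II.1. Qed.

Lemma ideal_add_min I J K : is_ideal K -> I `<=` K -> J `<=` K -> ideal_add I J `<=` K.
Proof. by move=> KK IK JK _ [x [y [/IK ? /JK ? ->]]]; apply: idealD. Qed.

Definition ideal_scale x I : set R := [set x * r | r in I].

Lemma ideal_scale_ideal x I : is_ideal I -> is_ideal (ideal_scale x I).
Proof.
move=> II; split=> [|r _ _ [y Iy <-] [z Iz <-]]; first by exists 0; rewrite ?mulr0 //; apply: II.1.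
by exists (r * y + z); [apply: II.2 | ring].
Qed.

Definition lin2 x y I : set R :=
  [set z | exists r s, [/\ I r, I s & z = x * r + y * s]].

Lemma lin2_ideal x y I : is_ideal I -> is_ideal (lin2 x y I).
Proof.
move=> II; split=> [|r _ _ [p [q [Ip Iq ->]]] [p' [q' [Ip' Iq' ->]]]].
  by exists 0, 0; split; rewrite ?mulr0 ?addr0 //; apply: II.1.
by exists (r * p + p'), (r * q + q'); split; [apply: II.2|apply: II.2|ring].
Qed.

Lemma lin2_min x y I K : is_ideal K -> (forall r, I r -> K (x * r)) ->
  (forall r, I r -> K (y * r)) -> lin2 x y I `<=` K.
Proof. by move=> KK Kx Ky _ [r [s [Ir Is ->]]]; apply: idealD; auto. Qed.

Lemma lin2l x y I r : is_ideal I -> I r -> lin2 x y I (x * r).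
Proof. by move=> II Ir; exists r, 0; rewrite mulr0 addr0; split=> //; apply: II.1. Qed.

Lemma lin2r x y I r : is_ideal I -> I r -> lin2 x y I (y * r).
Proof. by move=> II Ir; exists 0, r; rewrite mulr0 add0r; split=> //; apply: II.1. Qed.

Lemma lin2S x y I J : I `<=` J -> lin2 x y I `<=` lin2 x y J.
Proof. by move=> IJ _ [r [s [/IJ Jr /IJ Js ->]]]; exists r, s. Qed.

Lemma lin2C x y I : lin2 x y I = lin2 y x I.
Proof. by apply/seteqP; split=> _ [r [s [Ir Is ->]]]; exists s, r; rewrite addrC. Qed.

Lemma lin2xT x y : lin2 x y setT x.
Proof. by rewrite -{2}(mulr1 x); apply: lin2l ideal_setT _. Qed.

Lemma lin2yT x y : lin2 x y setT y.
Proof. by rewrite lin2C; apply: lin2xT. Qed.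

Lemma lin2T_min x y K : is_ideal K -> K x -> K y -> lin2 x y setT `<=` K.
Proof. by move=> KK Kx Ky; apply: lin2_min => // r _; apply: ideal_mulr. Qed.

Lemma ideal_mul_ideal I J : is_ideal (ideal_mul I J).
Proof. exact: ideal_gen_ideal. Qed.

Lemma ideal_mulP I J x y : I x -> J y -> ideal_mul I J (x * y).
Proof. by move=> Ix Jy; apply: sub_ideal_gen; exists x => //; exists y. Qed.

Lemma ideal_mul_min I J K : is_ideal K ->
  (forall x y, I x -> J y -> K (x * y)) -> ideal_mul I J `<=` K.
Proof. by move=> KK IJK; apply: ideal_gen_min => // _ [x Ix [y Jy <-]]; apply: IJK. Qed.

Lemma ideal_mul_elim I J K x w : is_ideal K ->
  (forall y z, I y -> J z -> K (x * (y * z))) -> ideal_mul I J w -> K (x * w).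
Proof.
move=> KK IJK; apply: (@ideal_mul_min I J [set w | K (x * w)] _ IJK).
split=> [|r y z Ky Kz] /=; first by rewrite mulr0; apply: KK.1.
by rewrite mulrDr mulrCA; apply: KK.2.
Qed.

Lemma ideal_mul_elimr I J K x w : is_ideal K ->
  (forall y z, I y -> J z -> K (y * z * x)) -> ideal_mul I J w -> K (w * x).
Proof.
move=> KK IJK; rewrite mulrC; apply: ideal_mul_elim => // y z Iy Jz.
by rewrite mulrC; apply: IJK.
Qed.

Lemma ideal_mulS I I' J J' : I `<=` I' -> J `<=` J' -> ideal_mul I J `<=` ideal_mul I' J'.
Proof.
move=> II JJ; apply: ideal_mul_min => [|x y /II ? /JJ ?]; first exact: ideal_mul_ideal.
exact: ideal_mulP.
Qed.

Lemma ideal_mulSr I J : is_ideal J -> ideal_mul I J `<=` J.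
Proof. by move=> JJ; apply: ideal_mul_min => // x y _; apply: idealMl. Qed.

Lemma ideal_mul_lin2 x y J : is_ideal J -> ideal_mul (lin2 x y setT) J = lin2 x y J.
Proof.
move=> JJ; apply/seteqP; split.
  apply: ideal_mul_min => [|_ z [r [s [_ _ ->]]] Jz]; first exact: lin2_ideal.
  exists (r * z), (s * z); split; [exact: idealMl|exact: idealMl|ring].
apply: lin2_min => [|r Jr|r Jr]; first exact: ideal_mul_ideal.
  by apply: ideal_mulP => //; apply: lin2xT.
by apply: ideal_mulP => //; apply: lin2yT.
Qed.

Lemma ideal_exp1 I : is_ideal I -> ideal_exp I 1 = I.
Proof.
move=> II; apply/seteqP; split=> [|x Ix].
  by apply: ideal_mul_min => // x y Ix _; apply: ideal_mulr.
by rewrite -(mulr1 x); apply: ideal_mulP.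
Qed.

Lemma ideal_exp_le I i j : (i <= j)%N -> ideal_exp I j `<=` ideal_exp I i.
Proof.
move=> /subnKC <-; elim: (j - i)%N => [|k IHk]; first by rewrite addn0.
by rewrite addnS => x /ideal_expS /IHk.
Qed.

Lemma ideal_expD I i j : ideal_exp I (i + j) = ideal_mul (ideal_exp I i) (ideal_exp I j).
Proof.
apply/seteqP; split; last first.
  by apply: ideal_mul_min => [|x y]; [apply: ideal_exp_ideal | apply: ideal_expM].
elim: i => [|i IHi] x /=; first by rewrite -{2}(mul1r x); apply: ideal_mulP.
move: x; apply: ideal_mul_min => [|x y Ix /IHi]; first exact: ideal_mul_ideal.
apply: (ideal_mul_elim (ideal_mul_ideal _ _)) => u v Iu Iv.
by rewrite mulrA; apply: ideal_mulP => //; apply: ideal_mulP.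
Qed.

Lemma ideal_expSr I n x y : I x -> ideal_exp I n y -> ideal_exp I n.+1 (x * y).
Proof. exact: ideal_mulP. Qed.

Lemma ideal_exp_exp I n k : ideal_exp (ideal_exp I n) k = ideal_exp I (n * k).
Proof.
elim: k => [|k IHk]; first by rewrite muln0.
by rewrite mulnS ideal_expD -IHk.
Qed.

Lemma ideal_exp_pow I n x : I x -> ideal_exp I n (x ^+ n).
Proof. by move=> Ix; elim: n => // n IHn; rewrite exprS; apply: ideal_expSr. Qed.

Lemma ideal_exp_mono I J n : I `<=` J -> ideal_exp I n `<=` ideal_exp J n.
Proof. by move=> IJ; elim: n => // n IHn; apply: ideal_mulS. Qed.

Lemma ideal_gen_nil : ideal_gen [set` [::]] = [set (0 : R)].
Proof.
apply/seteqP; split=> [|_ ->]; last exact: (ideal_gen_ideal _).1.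
apply: ideal_gen_min => [|x]; last by rewrite /= in_nil.
by split=> // r _ _ -> ->; rewrite mulr0 addr0.
Qed.

Lemma ideal_gen_cons (g : R) (s : seq R) x : ideal_gen [set` g :: s] x <->
  exists r y, ideal_gen [set` s] y /\ x = g * r + y.
Proof.
have GI := ideal_gen_ideal [set` s]; have GI' := ideal_gen_ideal [set` g :: s].
split=> [|[r [y [gy ->]]]].
  move: x; apply: ideal_gen_min => [|x /=].
    split=> [|r _ _ [p [q [gq ->]]] [p' [q' [gq' ->]]]].
      by exists 0, 0; rewrite mulr0 addr0; split=> //; apply: GI.1.
    by exists (r * p + p'), (r * q + q'); split; [apply: GI.2|ring].
  rewrite inE => /orP[/eqP->|sx].
    by exists 1, 0; rewrite mulr1 addr0; split=> //; apply: GI.1.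
  by exists 0, x; rewrite mulr0 add0r; split=> //; apply: sub_ideal_gen.
apply: (idealD GI').
  by apply: (ideal_mulr _ GI'); apply: sub_ideal_gen; rewrite /= mem_head.
move: y gy; apply: ideal_gen_min => // y sy; apply: sub_ideal_gen => /=.
by rewrite inE [_ \in _]sy orbT.
Qed.

Lemma ideal_gen2 x y : ideal_gen [set` [:: x; y]] = lin2 x y setT.
Proof.
apply/seteqP; split=> [z /ideal_gen_cons[r [t [/ideal_gen_cons[s [o []]]]]]|].
  by rewrite ideal_gen_nil => -> -> ->; exists r, s; rewrite addr0.
apply: lin2T_min; first exact: ideal_gen_ideal.
  by apply: sub_ideal_gen; rewrite /= !inE eqxx.
by apply: sub_ideal_gen; rewrite /= !inE eqxx orbT.
Qed.

(* If the ideals in [P] had no maximal element, the union of a strictly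
   increasing sequence of them would not be finitely generated. *)
Lemma noetherian_max (P : set R -> Prop) I0 : noetherian R ->
  (forall I, P I -> is_ideal I) -> P I0 ->
  exists J, [/\ P J, I0 `<=` J & forall K, P K -> J `<=` K -> K = J].
Proof.
move=> noeth PI P0; apply: contrapT => nomax.
pose Q J := P J /\ I0 `<=` J.
have next (J : {J | Q J}) : exists K : {J | Q J}, sval J `<` sval K.
  case: J => J [PJ IJ] /=; apply: contrapT => nK; apply: nomax; exists J; split=> // K PK JK.
  apply/seteqP; split=> //; apply: contrapT => nKJ; apply: nK.
  by exists (exist _ K (conj PK (subset_trans IJ JK))).
have [f fP] := choice next.
have Q0 : Q I0 by split.
pose J n := sval (iter n f (exist _ _ Q0)).
have JS n : J n `<` J n.+1 by rewrite /J iterS; apply: fP.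
have Jle n k : (n <= k)%N -> J n `<=` J k.
  move=> /subnKC <-; elim: (k - n)%N => [|i IHi]; first by rewrite addn0.
  by rewrite addnS; apply: subset_trans IHi (JS _).1.
have JI n : is_ideal (J n) by apply: PI; exact: (svalP (iter n f _)).1.
have [|s sE] := noeth (\bigcup_n J n).
  split=> [|r x y [i _ Ji] [j _ Jj]]; first by exists 0%N => //; apply: (JI _).1.
  exists (maxn i j) => //; apply: (JI _).2; [apply: Jle Ji|apply: Jle Jj].
    exact: leq_maxl.
  exact: leq_maxr.
have [n Jn] : exists n, [set` s] `<=` J n.
  have : [set` s] `<=` \bigcup_n J n by rewrite sE; apply: sub_ideal_gen.
  elim: (s) => [|g s' IHs] sJ; first by exists 0%N => x; rewrite /= in_nil.
  have [|n Jn] := IHs; first by move=> x sx; apply: sJ; rewrite /= inE [_ \in _]sx orbT.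
  have [|k _ Jk] := sJ g; first by rewrite /= mem_head.
  exists (maxn n k) => x; rewrite /= inE => /orP[/eqP->|/Jn].
    exact: (Jle _ _ (leq_maxr n k)).
  exact: (Jle _ _ (leq_maxl n k)).
apply: (JS n).2 => x Jx; apply: (ideal_gen_min (JI n) Jn).
by rewrite -sE; exists n.+1.
Qed.

(** Let [P] be maximal among the ideals over [I] that miss [S]. If [x] and [y] are outside [P], both
    [P + (x)] and [P + (y)] meet [S], and the product of the two elements found would lie in [P]
    together with [x * y]. *)
Lemma noetherian_prime I (S : set R) : noetherian R -> is_ideal I ->
  S 1 -> (forall x y, S x -> S y -> S (x * y)) -> (forall x, S x -> ~ I x) ->
  exists P, [/\ is_prime P, I `<=` P & forall x, S x -> ~ P x].
Proof.
move=> noeth II S1 SM SI.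
have [|//|P [[PI SP] IP Pmax]] :=
  @noetherian_max (fun J => is_ideal J /\ forall x, S x -> ~ J x) I noeth.
  by move=> J [].
exists P; split=> //; split; first by split=> //; apply: SP.
move=> x y Pxy; apply: contrapT => /not_orP[nPx nPy].
have meet z : ~ P z -> exists r p, P p /\ S (z * r + p).
  move=> nPz; apply: contrapT => nS; apply: nPz.
  pose K : set R := [set t | exists r p, P p /\ t = z * r + p].
  have KI : is_ideal K.
    split=> [|r _ _ [p [q [Pq ->]]] [p' [q' [Pq' ->]]]].
      by exists 0, 0; rewrite mulr0 addr0; split=> //; apply: PI.1.
    by exists (r * p + p'), (r * q + q'); split; [apply: PI.2|ring].
  have PK : P `<=` K by move=> t Pt; exists 0, t; rewrite mulr0 add0r; split.
  suff <- : K = P by exists 1, 0; rewrite mulr1 addr0; split=> //; apply: PI.1.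
  apply: Pmax => //.
  split=> // t St [r [p [Pp tE]]]; apply: nS; exists r, p; split=> //.
  by rewrite -tE.
have [r [p [Pp Sp]]] := meet _ nPx; have [t [q [Pq Sq]]] := meet _ nPy.
apply: SP (SM _ _ Sp Sq) _.
have -> : (x * r + p) * (y * t + q) = (r * t) * (x * y) + ((x * r + p) * q + y * t * p).
  by ring.
apply: idealD => //; first exact: idealMl.
by apply: idealD => //; apply: idealMl.
Qed.

End IdealTheory.

(** * Noetherian local rings *)

Section LocalRing.
Variables (R : comNzRingType) (m : set R).
Hypotheses (noeth : noetherian R) (loc : local_ring m).
Implicit Types (I J K : set R) (x y z : R).

Lemma local_ideal : is_ideal m. Proof. by case: loc => -[[]]. Qed.

Lemma local_not1 : ~ m 1. Proof. by case: loc => -[[]]. Qed.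

Lemma proper_sub_local I : is_proper I -> I `<=` m.
Proof.
move=> II; have [J []] := noetherian_max noeth (fun I => @proj1 _ _) II.
by move=> JJ IJ Jmax; rewrite -(loc.2 J).
Qed.

Lemma local_unit x : ~ m x -> exists y, x * y = 1.
Proof.
move=> nmx; apply: contrapT => nux; apply: nmx.
have S : is_ideal (ideal_scale x setT) by apply: (ideal_scale_ideal _ (@ideal_setT R)).
apply: (@proper_sub_local (ideal_scale x setT)); last by exists 1; rewrite ?mulr1.
by split=> // -[y _ xy]; apply: nux; exists y.
Qed.

Lemma local_unit_sub1 x : m x -> exists y, (1 - x) * y = 1.
Proof.
move=> mx; apply: local_unit => m1x; apply: local_not1.
by apply: (ideal_addr local_ideal (idealN local_ideal mx)).
Qed.

Lemma local_prime : is_prime m.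
Proof.
split=> [|x y mxy]; first by case: loc => -[].
apply: contrapT => /not_orP[/local_unit[z xz] /local_unit[t yt]].
apply: local_not1; have -> : 1 = z * t * (x * y) by rewrite -[LHS]mul1r -{1}xz -yt; ring.
exact: idealMl local_ideal mxy.
Qed.

(** Induction on the generators instead of a determinant: modulo [J + m N] the head satisfies
    [g = g * p] with [p] in [m], and [1 - p] is a unit. So [g] lies in [J + m N], and the tail [N]
    satisfies the same hypothesis. *)
Lemma nakayama_gen (s : seq R) J : is_ideal J ->
  ideal_gen [set` s] `<=` ideal_add J (ideal_mul m (ideal_gen [set` s])) ->
  ideal_gen [set` s] `<=` J.
Proof.
move=> JJ; elim: s => [|g s IHs] sub.
  by rewrite ideal_gen_nil => _ ->; apply: JJ.1.
set N := ideal_gen [set` s] in IHs *; set N' := ideal_gen [set` g :: s] in sub *.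
have NI : is_ideal N by apply: ideal_gen_ideal.
have mN := ideal_mul_ideal m N.
have KI := ideal_add_ideal JJ mN.
have split_mN' z : ideal_mul m N' z -> exists p q, [/\ m p, ideal_mul m N q & z = g * p + q].
  move: z; apply: ideal_mul_min => [|x y mx /ideal_gen_cons[r [t [Nt ->]]]].
    split=> [|r _ _ [p [q [mp mq ->]]] [p' [q' [mp' mq' ->]]]].
      by exists 0, 0; rewrite mulr0 addr0; split=> //; [apply: local_ideal.1|apply: mN.1].
    exists (r * p + p'), (r * q + q').
    by split; [apply: local_ideal.2|apply: mN.2|ring].
  exists (x * r), (x * t); split; [exact: ideal_mulr _ local_ideal mx|exact: ideal_mulP|ring].
have Kg : ideal_add J (ideal_mul m N) g.
  have [|x [_ [Jx /split_mN'[p [q [mp mq ->]]] gE]]] := sub g.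
    by apply: sub_ideal_gen; rewrite /= mem_head.
  have [w pw] := local_unit_sub1 mp.
  have -> : g = w * (x + q).
    rewrite -[LHS]mul1r -pw -[RHS]addr0 -(subrr (w * g)) {3}gE; ring.
  by apply: (idealMl _ KI); exists x, q.
have NJ : N `<=` J.
  apply: IHs => z Nz; have [|x [_ [Jx /split_mN'[p [q [mp mq ->]]] ->]]] := sub z.
    by apply/ideal_gen_cons; exists 0, z; rewrite mulr0 add0r.
  apply: (idealD KI); first exact: sub_ideal_addl mN _ Jx.
  apply: (idealD KI); last exact: sub_ideal_addr JJ _ mq.
  exact: ideal_mulr.
have Jg : J g.
  by apply: (ideal_add_min JJ _ _ Kg) => // x /(ideal_mulSr NI)/NJ.
by move=> z /ideal_gen_cons[r [t [/NJ Jt ->]]]; apply: idealD => //; apply: ideal_mulr.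
Qed.

Lemma nakayama N J : is_ideal N -> is_ideal J ->
  N `<=` ideal_add J (ideal_mul m N) -> N `<=` J.
Proof. by move=> NI JJ; have [s ->] := noeth NI; apply: nakayama_gen. Qed.

Lemma ideal_exp_gen_nilpotent I (s : seq R) : is_ideal I ->
  (forall x, x \in s -> exists n, I (x ^+ n)) ->
  exists c, ideal_exp (ideal_gen [set` s]) c `<=` I.
Proof.
move=> II; elim: s => [|g s IHs] nil.
  exists 1%N; rewrite ideal_exp1; last exact: ideal_gen_ideal.
  by rewrite ideal_gen_nil => _ ->; apply: II.1.
have [|c sc] := IHs; first by move=> x sx; apply: nil; rewrite inE sx orbT.
have [|n gn] := nil g; first exact: mem_head.
exists (n + c)%N; set K := ideal_gen [set` g :: s]; set J := ideal_gen [set` s] in sc.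
(* Pigeonhole: each term of a product of [i + j] elements of [(g) + J] has [i] factors from [(g)] or
   [j] from [J]. With [i = n] and [j = c] both parts lie in [I]. *)
pose T i j := ideal_add (ideal_scale (g ^+ i) setT) (ideal_exp J j).
have TI i j : is_ideal (T i j).
  apply: ideal_add_ideal; last exact: ideal_exp_ideal.
  exact: (ideal_scale_ideal _ (@ideal_setT R)).
suff KT : forall i j, ideal_exp K (i + j) `<=` T i j.
  move=> x /KT; apply: ideal_add_min => // _ [r _ <-]; exact: ideal_mulr.
have TS i j z : T i j z -> T i.+1 j (g * z).
  move=> [_ [t [[r _ <-] Jt ->]]]; exists (g ^+ i.+1 * r), (g * t).
  split; first by exists r.
    exact: idealMl (ideal_exp_ideal _ _) Jt.
  by rewrite mulrDr exprS mulrA.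
have TJ i j y z : J y -> T i j z -> T i j.+1 (y * z).
  move=> Jy [_ [t [[r _ <-] Jt ->]]]; exists (g ^+ i * (y * r)), (y * t).
  split; [by exists (y * r)|exact: ideal_expSr|ring].
elim=> [|i IHi] j.
  move=> x _; apply: sub_ideal_addl; first exact: ideal_exp_ideal.
  by exists x; rewrite ?mul1r.
elim: j => [|j IHj].
  by move=> x _; apply: sub_ideal_addr => //; apply: (ideal_scale_ideal _ (@ideal_setT R)).
rewrite addSn /=; apply: ideal_mul_min => // _ z /ideal_gen_cons[r [t [Jt ->]]] Kz.
rewrite mulrDl; apply: (idealD (TI _ _)); last by apply: TJ => //; apply: IHj; rewrite addSnnS.
by rewrite mulrAC; apply: (ideal_mulr _ (TI _ _)); apply: TS; apply: IHi.
Qed.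

Lemma local_exp_sub I : is_ideal I -> (forall x, m x -> exists n, I (x ^+ n)) ->
  exists c, ideal_exp m c `<=` I.
Proof.
move=> II nil; have [s mE] := noeth local_ideal.
by rewrite mE; apply: ideal_exp_gen_nilpotent => // x sx; apply: nil; rewrite mE; apply: sub_ideal_gen.
Qed.

(** An element of a prime [Q] that is regular modulo an ideal inside [Q] leads to a strictly smaller
    prime. Used for [v] modulo [(u)], then for [u] modulo 0, this gives [P0 < P1 < P], and [P < m]
    would make a chain of length 3. *)
Lemma prime_over_regular u v P : krull_dim R 2 -> m u -> m v ->
  (forall w, u * w = 0 -> w = 0) ->
  (forall w s, v * w = u * s -> exists t, w = u * t) ->
  is_prime P -> P u -> P v -> P = m.
Proof.
move=> [_ dim2] mu mv ureg vreg primeP Pu Pv.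
have PI : is_ideal P := primeP.1.1.
have Pm : P `<=` m := proper_sub_local primeP.1.
have expn_reg (g : R) (I : set R) : (forall w, I (g * w) -> I w) -> forall n w, I (g ^+ n * w) -> I w.
  by move=> greg; elim=> [|n IHn] w; [rewrite mul1r|rewrite exprS -mulrA => /greg/IHn].
have below Q g I : is_prime Q -> is_ideal I -> I `<=` Q -> Q g ->
    (forall w, I (g * w) -> I w) -> exists P', [/\ is_prime P', I `<=` P' & P' `<` Q].
  move=> primeQ II IQ Qg greg.
  (* Missing all products [g ^+ n * t] with [t] outside [Q] puts [P'] inside [Q] and keeps [g] out
     of it. *)
  have [||||P' [primeP' IP' SP']] := @noetherian_prime _ I
    [set z | exists n t, ~ Q t /\ z = g ^+ n * t] noeth => //.
  - by exists 0%N, 1; split; [exact: primeQ.1.2|rewrite mulr1].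
  - move=> _ _ [n [t [nQt ->]]] [k [w [nQw ->]]]; exists (n + k)%N, (t * w).
    by split; [case/primeQ.2|rewrite exprD; ring].
  - by move=> _ [n [t [nQt ->]]] /(expn_reg _ _ greg)/IQ.
  exists P'; split=> //; split.
    move=> t P't; apply: contrapT => nQt; apply: SP' P't.
    by exists 0%N, t; rewrite mul1r.
  move=> /(_ g Qg); apply: SP'; exists 1%N, 1; split; first exact: primeQ.1.2.
  by rewrite mulr1.
have uI : is_ideal (ideal_scale u setT) := ideal_scale_ideal u (@ideal_setT R).
have [||P1 [primeP1 uP1 P1P]] := below P v (ideal_scale u setT) primeP uI _ Pv.
- by move=> _ [r _ <-]; apply: ideal_mulr.
- by move=> w [s _ /esym/vreg[t ->]]; exists t.
have P1u : P1 u by apply: uP1; exists 1; rewrite ?mulr1.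
have [|||P0 [primeP0 _ P0P1]] := below P1 u [set 0] primeP1 _ _ P1u.
- by split=> // r _ _ -> ->; rewrite mulr0 addr0.
- by move=> _ ->; apply: primeP1.1.1.1.
- exact: ureg.
apply/seteqP; split=> //; apply: contrapT => nmP.
pose K i := nth m [:: P0; P1; P] i.
have : (3 <= 2)%N; last by [].
apply: (dim2 3 K); split=> [[|[|[|[|i]]]]|[|[|[|i]]]] //= _.
  exact: local_prime.
Qed.

Lemma regular_pair_primary u v : krull_dim R 2 -> m u -> m v ->
  (forall w, u * w = 0 -> w = 0) ->
  (forall w s, v * w = u * s -> exists t, w = u * t) ->
  exists c, ideal_exp m c `<=` lin2 u v setT.
Proof.
move=> dim2 mu mv ureg vreg; have uvI := lin2_ideal u v (@ideal_setT R).
apply: local_exp_sub => // x mx; apply: contrapT => nil.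
have [|||P [primeP uvP SP]] := @noetherian_prime _ (lin2 u v setT) (range (GRing.exp x)) noeth uvI => //.
- by exists 0%N.
- by move=> _ _ [i _ <-] [j _ <-]; exists (i + j)%N; rewrite ?exprD.
- by move=> _ [i _ <-] ?; apply: nil; exists i.
apply: (SP x); first by exists 1%N.
by rewrite (@prime_over_regular u v P) //; apply: uvP; [apply: lin2xT|apply: lin2yT].
Qed.

End LocalRing.

(** * Length *)

Lemma max_chain_inj (R : comNzRingType) (P : set R -> Prop) (k l : nat) :
  max_chain P k -> max_chain P l -> k = l.
Proof.
by move=> [[K Kk] maxk] [[L Ll] maxl]; apply/eqP; rewrite eqn_leq (maxk _ L) // (maxl _ K).
Qed.

Section Length.
Variable R : comNzRingType.
Implicit Types (I J K M : set R) (x y z : R).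

Definition between J I K := [/\ is_ideal K, J `<=` K & K `<=` I].

(** The upper half of [max_chain]; by [length_quot_ex] such a bound is enough for a length to
    exist. *)
Definition length_le I J b :=
  forall l (K : nat -> set R), is_chain (between J I) l K -> (l <= b)%N.

Lemma chain_rcons (P : set R -> Prop) n (K : nat -> set R) L :
  is_chain P n K -> P L -> K n `<` L ->
  is_chain P n.+1 (fun i => if (i <= n)%N then K i else L).
Proof.
move=> [PK SK] PL KL; split=> i; first by case: ifP => // ? _; apply: PK.
rewrite ltnS => ilen; rewrite ilen; case: ltnP => [/SK //|nlei].
by have -> : i = n by apply/eqP; rewrite eqn_leq ilen.
Qed.

Lemma length_leS I J J' b : length_le I J b -> J `<=` J' -> length_le I J' b.
Proof.
move=> bIJ JJ' l K [KP KS]; apply: (bIJ l K); split=> // i /KP[KI J'K KI'].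
by split=> //; apply: subset_trans J'K.
Qed.

Lemma length_quot_ex I J b : is_ideal J -> J `<=` I -> length_le I J b ->
  exists l, length_quot I J l.
Proof.
move=> JJ JI bIJ.
pose P l := `[< exists A : nat -> set R, is_chain (between J I) l A >].
have exP : exists l, P l.
  by exists 0%N; apply/asboolP; exists (fun=> J); split=> // i _; split.
have ubP l : P l -> (l <= b)%N by move=> /asboolP[A /bIJ].
have [l /asboolP Pl lmax] := ex_maxnP exP ubP.
by exists l; split=> // k A Ak; apply: lmax; apply/asboolP; exists A.
Qed.


(** By the modular law, nested ideals with the same intersection with [J] and the same sum with [J]
    coincide. So each strict step of [M] stays strict among the intersections or among the sums, and
    repetitions are dropped; the last terms are tracked for the induction. *)
Lemma chain_split I J K l (M : nat -> set R) : is_ideal I -> is_ideal J ->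
  J `<=` I -> K `<=` J -> is_chain (between K I) l M ->
  exists p q (A B : nat -> set R), [/\ is_chain (between K J) p A, is_chain (between J I) q B,
    A p = M l `&` J, B q = ideal_add (M l) J & (l <= p + q)%N].
Proof.
move=> II JJ JI KJ; elim: l => [|l IHl] [PM SM].
  have [M0 KM0 M0I] := PM 0%N isT.
  exists 0%N, 0%N, (fun=> M 0%N `&` J), (fun=> ideal_add (M 0%N) J); split=> //.
    split=> // _ _; split; first exact: ideal_setI.
      by move=> x Kx; split; [apply: KM0|apply: KJ].
    by move=> x [].
  split=> // _ _; split; first exact: ideal_add_ideal.
    exact: sub_ideal_addr.
  exact: ideal_add_min.
have [|p [q [A [B [CA CB Ap Bq lpq]]]]] := IHl.
  by split=> i il; [apply: PM; apply: leqW|apply: SM; apply: ltnW].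
have [Ml KMl MlI] := PM l (leqnSn l); have [Ml' KMl' MlI'] := PM l.+1 (leqnn _).
have MS : M l `<` M l.+1 := SM l (ltnSn l).
have PA : between K J (M l.+1 `&` J).
  split; [exact: ideal_setI|by move=> x Kx; split; [exact: KMl'|exact: KJ]|by move=> x []].
have PB : between J I (ideal_add (M l.+1) J).
  split; [exact: ideal_add_ideal|exact: sub_ideal_addr|exact: ideal_add_min].
have subA : A p `<=` M l.+1 `&` J by rewrite Ap => x [/MS.1].
have subB : B q `<=` ideal_add (M l.+1) J.
  by rewrite Bq => _ [x [y [/MS.1 Mx Jy ->]]]; exists x, y.
have [eqA|neqA] := pselect (M l.+1 `&` J `<=` A p); last first.
  have ltA : A p `<` M l.+1 `&` J by split.
  exists p.+1; have [eqB|neqB] := pselect (ideal_add (M l.+1) J `<=` B q).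
    exists q, (fun i => if (i <= p)%N then A i else M l.+1 `&` J), B; split=> //.
    - exact: chain_rcons.
    - by rewrite ltnn.
    - by apply/seteqP; split.
  exists q.+1, (fun i => if (i <= p)%N then A i else M l.+1 `&` J),
    (fun i => if (i <= q)%N then B i else ideal_add (M l.+1) J); split=> //.
  - exact: chain_rcons.
  - by apply: chain_rcons.
  - by rewrite ltnn.
  - by rewrite ltnn.
  - by rewrite addSn ltnS (leq_trans lpq) // leq_add2l.
exists p, q.+1, A, (fun i => if (i <= q)%N then B i else ideal_add (M l.+1) J); split=> //.
- apply: chain_rcons => //; split=> // eqB; apply: MS.2 => x Mx.
  have : B q x by apply: eqB; exists x, 0; rewrite addr0; split=> //; apply: JJ.1.
  rewrite Bq => -[y [z [My Jz xE]]].
  have : A p z.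
    apply: eqA; split=> //; have -> : z = x - y by rewrite xE; ring.
    by apply: idealB => //; apply: MS.1.
  by rewrite Ap xE => -[Mz _]; apply: idealD.
- by apply/seteqP; split.
- by rewrite ltnn.
- by rewrite addnS ltnS.
Qed.

Lemma length_leD I J K a b : is_ideal I -> is_ideal J -> J `<=` I -> K `<=` J ->
  length_le I J a -> length_le J K b -> length_le I K (a + b).
Proof.
move=> II JJ JI KJ bIJ bJK l M CM.
have [p [q [A [B [CA CB _ _ lpq]]]]] := chain_split II JJ JI KJ CM.
by rewrite (leq_trans lpq) // addnC leq_add //; [apply: bIJ CB|apply: bJK CA].
Qed.

Lemma length_quotD I J K a b : is_ideal I -> is_ideal J -> J `<=` I -> K `<=` J ->
  length_quot I J a -> length_quot J K b -> length_quot I K (a + b).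
Proof.
move=> II JJ JI KJ [[A [PA SA]] maxa] [[B [PB SB]] maxb]; split; last exact: (length_leD II JJ JI KJ maxa maxb).
exists (fun i => if (i <= b)%N then B i else A (i - b)%N); split=> i.
  move=> iab; case: (leqP i b) => [ib|bi].
    by have [BI KB BJ] := PB i ib; split=> //; apply: subset_trans JI.
  have [|AI JA AI'] := PA (i - b)%N; first by rewrite leq_subLR addnC.
  by split=> //; apply: subset_trans JA.
case: (ltngtP i b) => [ib _|bi iab|-> ab].
- exact: SB.
- by rewrite subSn ?(ltnW bi) //; apply: SA; rewrite ltn_subLR ?(ltnW bi) // addnC.
- have a0 : (0 < a)%N by rewrite -(ltn_add2r b).
  rewrite subSn // subnn; have [_ _ BJ] := PB b (leqnn b).
  have [_ JA _] := PA 0%N isT; have [A01 A10] := SA 0%N a0; split.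
    by move=> x /BJ/JA/A01.
  by move=> AB; apply: A10 => x /AB/BJ/JA.
Qed.

Lemma length_quot0 I J : is_ideal I -> is_ideal J -> J `<=` I -> length_quot I J 0 -> I = J.
Proof.
move=> II JJ JI [_ max0]; apply/seteqP; split=> //; apply: contrapT => nIJ.
have : (1 <= 0)%N; last by [].
apply: (max0 1%N (fun i => if i is 0%N then J else I)).
by split=> [[|[|i]]|[|i]] // _; split=> //.
Qed.

Lemma length_quot_refl I : is_ideal I -> length_quot I I 0.
Proof.
move=> II; split=> [|[|l] K [KP KS] //]; first by exists (fun=> I); split=> // i _; split.
have [_ IK0 _] := KP 0%N isT; have [_ _ K1I] := KP 1%N isT.
by case: (KS 0%N isT) => _ []; apply: subset_trans IK0.
Qed.

(* Multiplication by [x] induces an isomorphism from [I / K] onto [(xI + J) / J]. *)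
Lemma length_quot_scale x I J K l : is_ideal I -> is_ideal J -> K `<=` I ->
  (forall r, I r -> J (x * r) <-> K r) ->
  length_quot I K l -> length_quot (ideal_add (ideal_scale x I) J) J l.
Proof.
move=> II JJ KI JK [[A [PA SA]] maxl]; split=> [|k B [PB SB]].
  exists (fun i => ideal_add (ideal_scale x (A i)) J); split=> i il.
    have [AI KA AI'] := PA i il; split.
    - by apply: ideal_add_ideal => //; apply: ideal_scale_ideal.
    - by apply: sub_ideal_addr; apply: ideal_scale_ideal.
    - by move=> _ [_ [y [[r /AI' Ir <-] Jy ->]]]; exists (x * r), y; split=> //; exists r.
  have [AI KA AI'] := PA i (ltnW il); have [AJ KA1 AI1] := PA i.+1 il.
  have [Ai nAi] := SA i il; split.
    by move=> _ [_ [y [[r /Ai Ar <-] Jy ->]]]; exists (x * r), y; split=> //; exists r.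
  move=> sub; apply: nAi => r Ar.
  have [|_ [y [[r' Ar' <-] Jy xr]]] := sub (x * r).
    by apply: sub_ideal_addl => //; exists r.
  have Arr : K (r - r').
    apply/JK; first by apply: idealB => //; [apply: AI1|apply: AI'].
    by rewrite mulrBr xr addrC addKr.
  by rewrite -(subrK r' r); apply: idealD => //; apply: KA.
apply: (maxl k (fun i => [set r | I r /\ B i (x * r)])); split=> i ik.
  have [BI JB BI'] := PB i ik; split.
  - split=> [|r y z [Iy By] [Iz Bz]]; first by split; [apply: II.1|rewrite mulr0; apply: BI.1].
    by split; [apply: II.2|rewrite mulrDr mulrCA; apply: BI.2].
  - by move=> r Kr; split; [apply: KI|apply: JB; apply/JK => //; apply: KI].
  - by move=> r [].
have [BI JB BI'] := PB i (ltnW ik); have [BJ JB1 BI1] := PB i.+1 ik.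
have [Bi nBi] := SB i ik; split; first by move=> r [Ir /Bi Br].
move=> sub; apply: nBi => z Bz.
have [_ [y [[r Ir <-] Jy zE]]] := BI1 _ Bz.
have [|_ Br] := sub r.
  by split=> //; apply: (ideal_addr BJ (JB1 _ Jy)); rewrite -zE.
by rewrite zE; apply: idealD => //; apply: JB.
Qed.

End Length.

(** * Colength of open ideals *)

Section Colength.
Variables (R : comNzRingType) (m : set R).
Hypotheses (noeth : noetherian R) (loc : local_ring m).
Implicit Types (I J K : set R) (x y z : R).

(** The quotient is generated by the class of [g] and killed by [m]: in an intermediate ideal
    without [g] all coefficients of [g] are non-units, so that ideal is [I]. *)
Lemma length_le_simple I g : is_ideal I -> (forall z, m z -> I (g * z)) ->
  length_le (ideal_add I (ideal_scale g setT)) I 1.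
Proof.
move=> II gm [|[|l]] // K [KP KS].
have [K0I IK0 _] := KP 0%N isT; have [K1I IK1 K1M] := KP 1%N isT.
have [_ _ K2M] := KP 2%N isT.
have [_ nK01] := KS 0%N isT; have [_ nK12] := KS 1%N isT.
suff K1g : K 1%N g.
  case: nK12 => z /K2M; apply: ideal_add_min => // _ [r _ <-]; exact: ideal_mulr.
apply: contrapT => nK1g; apply: nK01 => z K1z.
have [i [_ [Ii [r _ <-] zE]]] := K1M _ K1z.
have mr : m r.
  apply: contrapT => /(local_unit noeth loc)[t rt]; apply: nK1g.
  have -> : g = (z - i) * t by rewrite zE addrAC subrr add0r -mulrA rt mulr1.
  by apply: ideal_mulr => //; apply: idealB => //; apply: IK1.
by rewrite zE; apply: idealD => //; apply: IK0 => //; apply: gm.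
Qed.

Lemma length_le_gen J (s : seq R) : is_ideal J ->
  (forall g z, g \in s -> m z -> J (g * z)) ->
  length_le (ideal_add J (ideal_gen [set` s])) J (size s).
Proof.
move=> JJ; elim: s => [|g s IHs] sm.
  have -> : ideal_add J (ideal_gen [set` [::]]) = J.
    apply/seteqP; split; last by apply: sub_ideal_addl; apply: ideal_gen_ideal.
    by apply: ideal_add_min => //; rewrite ideal_gen_nil => _ ->; apply: JJ.1.
  exact: (length_quot_refl JJ).2.
set N := ideal_gen [set` s].
have NN : is_ideal N by apply: ideal_gen_ideal.
have gI := ideal_scale_ideal g (@ideal_setT R).
have JNI := ideal_add_ideal JJ NN.
have -> : ideal_add J (ideal_gen [set` g :: s]) = ideal_add (ideal_add J N) (ideal_scale g setT).
  apply/seteqP; split.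
    move=> _ [x [_ [Jx /ideal_gen_cons[r [y [Ny ->]]] ->]]].
    exists (x + y), (g * r); split; [by exists x, y|by exists r|ring].
  move=> _ [_ [_ [[x [y [Jx Ny ->]]] [r _ <-] ->]]].
  exists x, (g * r + y); split=> //; last by ring.
  by apply/ideal_gen_cons; exists r, y.
have JN : J `<=` ideal_add J N by apply: sub_ideal_addl.
rewrite -[size _]/(1 + size s)%N.
apply: (length_leD (J := ideal_add J N)) => //.
- exact: ideal_add_ideal.
- exact: sub_ideal_addl.
- apply: length_le_simple => // z mz; apply: JN; apply: sm => //; exact: mem_head.
- by apply: IHs => t z ts; apply: sm; rewrite inE ts orbT.
Qed.

Lemma length_le_exp c : exists b, length_le setT (ideal_exp m c) b.
Proof.
elim: c => [|c [b bP]]; first by exists 0%N; apply: (length_quot_refl (@ideal_setT R)).2.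
have [s sE] := noeth (ideal_exp_ideal m c).
exists (b + size s)%N.
apply: (length_leD (J := ideal_exp m c)) => //; [exact: ideal_exp_ideal|exact: ideal_expS|].
have EI := ideal_exp_ideal m c.+1.
have sub : ideal_exp m c `<=` ideal_add (ideal_exp m c.+1) (ideal_gen [set` s]).
  by rewrite -sE; apply: sub_ideal_addr.
have bd := @length_le_gen (ideal_exp m c.+1) s EI.
move=> l K [KP KS]; apply: (bd _ l K).
  move=> g z gs mz; rewrite mulrC; apply: ideal_expSr => //.
  by rewrite sE; apply: sub_ideal_gen.
by split=> // i /KP[KI mK Km]; split=> //; apply: subset_trans sub.
Qed.

(** Open for the [m]-adic topology: [m]-primary or the unit ideal. Admitting the latter spares case
    distinctions for [a ^ 0] and for colon ideals. *)
Definition open_ideal I := is_ideal I /\ exists c, ideal_exp m c `<=` I.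

Lemma open_idealS I J : open_ideal I -> is_ideal J -> I `<=` J -> open_ideal J.
Proof. by move=> [II [c cI]] JJ IJ; split=> //; exists c; apply: subset_trans IJ. Qed.

Lemma open_setT : open_ideal setT.
Proof. by split; [apply: ideal_setT|exists 0%N]. Qed.

Lemma open_ideal_exp I n : open_ideal I -> open_ideal (ideal_exp I n).
Proof.
move=> [II [c cI]]; split; first exact: ideal_exp_ideal.
by exists (c * n)%N; rewrite -ideal_exp_exp; apply: ideal_exp_mono.
Qed.

Lemma open_ideal_mul I J : open_ideal I -> open_ideal J -> open_ideal (ideal_mul I J).
Proof.
move=> [II [c cI]] [JJ [d dJ]]; split; first exact: ideal_mul_ideal.
by exists (c + d)%N; rewrite ideal_expD; apply: ideal_mulS.
Qed.

Lemma open_lin2 x y I : open_ideal (lin2 x y setT) -> open_ideal I -> open_ideal (lin2 x y I).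
Proof. by move=> oxy oI; rewrite -ideal_mul_lin2; [apply: open_ideal_mul|apply: oI.1]. Qed.

Lemma open_lin2_pow x y i j : open_ideal (lin2 x y setT) ->
  open_ideal (lin2 (x ^+ i) (y ^+ j) setT).
Proof.
move=> oxy; have I' := lin2_ideal (x ^+ i) (y ^+ j) (@ideal_setT R).
have [z|c cE] := @ideal_exp_gen_nilpotent R _ [:: x; y] I'.
  rewrite !inE => /orP[]/eqP->; first by exists i; apply: lin2xT.
  by exists j; apply: lin2yT.
by apply: open_idealS (open_ideal_exp c oxy) I' _; rewrite -ideal_gen2.
Qed.

(** The length of [R / I] for open [I], by [colenP]; the default 0 only makes the function total. *)
Definition colen I : nat := xget 0%N (length_quot setT I).

Lemma colenP I : open_ideal I -> length_quot setT I (colen I).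
Proof.
move=> [II [c cI]]; have [b bc] := length_le_exp c.
have [|l lP] := length_quot_ex II _ (length_leS bc cI); first by [].
exact: (@xgetI _ 0%N (length_quot setT I) l).
Qed.

Lemma length_quot_colen I J : is_ideal I -> open_ideal J -> J `<=` I ->
  exists2 l, length_quot I J l & colen J = (colen I + l)%N.
Proof.
move=> II oJ JI; have oI := open_idealS oJ II JI.
have [c cJ] := oJ.2; have [b bc] := length_le_exp c.
have bJ : length_le I J b.
  by move=> l K [KP KS]; apply: (length_leS bc cJ (K := K)); split=> // i /KP[].
have [l lP] := length_quot_ex oJ.1 JI bJ; exists l => //.
apply: max_chain_inj (colenP oJ) _.
exact: (length_quotD (@ideal_setT R) II _ JI (colenP oI) lP).
Qed.

Lemma colen_le I J : is_ideal I -> open_ideal J -> J `<=` I -> (colen I <= colen J)%N.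
Proof. by move=> II oJ /(length_quot_colen II oJ)[l _ ->]; apply: leq_addr. Qed.

Lemma colen_inj I J : is_ideal I -> open_ideal J -> J `<=` I -> colen I = colen J -> I = J.
Proof.
move=> II oJ JI; have [l lP ->] := length_quot_colen II oJ JI.
rewrite -{1}(addn0 (colen I)) => /addnI l0; rewrite -l0 in lP.
exact: length_quot0 II oJ.1 JI lP.
Qed.

Lemma colenT : colen setT = 0%N.
Proof. exact: max_chain_inj (colenP open_setT) (length_quot_refl (@ideal_setT R)). Qed.

Lemma colen_eq0 I : open_ideal I -> colen I = 0%N -> I 1.
Proof.
by move=> oI I0; rewrite -(colen_inj (@ideal_setT R) oI) // colenT.
Qed.

(** Multiplication by [x] identifies [I / K] with [(x I + J) / J]; the equality of their lengths is
    written with sums to avoid truncated subtraction. *)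
Lemma colen_scale x I J K : is_ideal I -> open_ideal J -> open_ideal K -> K `<=` I ->
  (forall r, I r -> J (x * r) <-> K r) ->
  (colen K + colen (ideal_add (ideal_scale x I) J) = colen J + colen I)%N.
Proof.
move=> II oJ oK KI xK; have [l lP ->] := length_quot_colen II oK KI.
have lS := length_quot_scale II oJ.1 KI xK lP.
have xI := ideal_scale_ideal x II.
have sI := ideal_add_ideal xI oJ.1.
have [k kP ->] := length_quot_colen sI oJ (sub_ideal_addr xI).
by rewrite (max_chain_inj kP lS); lia.
Qed.

(** Vanishing of the first Koszul homology of [x, y]; unlike a regular sequence it is symmetric by
    form. *)
Definition koszul_exact x y :=
  forall r s, x * r = y * s -> exists w, r = y * w /\ s = x * w.

Lemma koszul_exactC x y : koszul_exact x y -> koszul_exact y x.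
Proof. by move=> kxy r s /esym/kxy[w [-> ->]]; exists w. Qed.

Definition ideal_quo I x : set R := [set r | I (x * r)].

Lemma ideal_quo_ideal I x : is_ideal I -> is_ideal (ideal_quo I x).
Proof.
move=> II; split=> [|r y z Iy Iz]; rewrite /ideal_quo /= ?mulr0; first exact: II.1.
by rewrite mulrDr mulrCA; apply: II.2.
Qed.

Lemma sub_ideal_quo I x : is_ideal I -> I `<=` ideal_quo I x.
Proof. by move=> II r Ir; apply: idealMl. Qed.

(* Lengths in 0 -> A / (I : (x, y)) -> (A / I)^2 -> (x, y) / (x, y) I -> 0. *)
Lemma colen_lin2 x y I : koszul_exact x y -> open_ideal (lin2 x y setT) -> open_ideal I ->
  (colen (lin2 x y I) + colen (ideal_quo I x `&` ideal_quo I y) =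
   colen (lin2 x y setT) + 2 * colen I)%N.
Proof.
move=> kxy oxy oI; have [II _] := oI.
have oquo z : open_ideal (ideal_quo I z).
  by apply: open_idealS oI _ (sub_ideal_quo z II); apply: ideal_quo_ideal.
have oadd J : is_ideal J -> open_ideal (ideal_add J I).
  by move=> JJ; apply: open_idealS oI _ (sub_ideal_addr JJ); apply: ideal_add_ideal.
have TT := @ideal_setT R.
have xTI := ideal_scale_ideal x TT.
have xqI := ideal_scale_ideal y (oquo x).1.
have oL := open_lin2 oxy oI.
pose J := ideal_add (ideal_scale x setT) (ideal_scale y I).
have JI : is_ideal J by apply: ideal_add_ideal => //; apply: ideal_scale_ideal.
have LJ : lin2 x y I `<=` J.
  by move=> _ [r [s [Ir Is ->]]]; exists (x * r), (y * s); split=> //; [exists r|exists s].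
have oJ := open_idealS oL JI LJ.
(* Four isomorphisms: [R / (x R + I)] with [(x, y) / J], [R / (y (I : x) + I)] with [J / (x, y) I],
   [R / (I : x)] with [(x R + I) / I], and [(I : x) / ((I : x) & (I : y))] with
   [(y (I : x) + I) / I]. Eliminating the intermediate colengths gives the formula. *)
have E1 := @colen_scale y setT J (ideal_add (ideal_scale x setT) I) TT oJ (oadd _ xTI).
have E2 := @colen_scale x setT (lin2 x y I) (ideal_add (ideal_scale y (ideal_quo I x)) I) TT oL (oadd _ xqI).
have E3 := @colen_scale x setT I (ideal_quo I x) TT oI (oquo x).
have oqq : open_ideal (ideal_quo I x `&` ideal_quo I y).
  apply: (open_idealS oI); first by apply: ideal_setI; apply: ideal_quo_ideal.
  by move=> r Ir; split; apply: sub_ideal_quo.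
have E4 := @colen_scale y (ideal_quo I x) I (ideal_quo I x `&` ideal_quo I y) (oquo x).1 oI oqq.
rewrite (_ : ideal_add (ideal_scale y setT) J = lin2 x y setT) in E1; last first.
  apply/seteqP; split.
    move=> _ [_ [_ [[r _ <-] [_ [_ [[s _ <-] [t _ <-] ->]]] ->]]].
    by exists s, (r + t); split=> //; ring.
  move=> _ [r [s [_ _ ->]]]; exists (y * s), (x * r); split; first by exists s.
    by exists (x * r), 0; rewrite addr0; split=> //; [exists r|exists 0; rewrite ?mulr0 //; apply: II.1].
  by rewrite addrC.
rewrite (_ : ideal_add (ideal_scale x setT) (lin2 x y I) = J) in E2; last first.
  apply/seteqP; split.
    apply: ideal_add_min => //; apply: sub_ideal_addl; exact: ideal_scale_ideal.
  move=> _ [_ [_ [[r _ <-] [s Is <-] ->]]]; exists (x * r), (y * s); split=> //; first by exists r.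
  exact: lin2r.
rewrite colenT in E1 E2 E3.
have {}E1 := E1 (@subsetT _ _); have {}E2 := E2 (@subsetT _ _).
have {}E3 := E3 (@subsetT _ _); have {}E4 := E4 (@subIsetl _ _ _).
have {}E1 : (colen (ideal_add (ideal_scale x setT) I) + colen (lin2 x y setT) = colen J + 0)%N.
  apply: E1 => r _; split.
    move=> [_ [_ [[t _ <-] [b Ib <-] yr]]].
    have [|w [rE _]] := koszul_exactC kxy (r := r - b) (s := t).
      by rewrite mulrBr yr; ring.
    by exists (x * w), b; split=> //; [exists w|rewrite -rE subrK].
  move=> [_ [b [[t _ <-] Ib ->]]]; exists (x * (y * t)), (y * b).
  by split; [exists (y * t)|exists b|ring].
have {}E2 : (colen (ideal_add (ideal_scale y (ideal_quo I x)) I) + colen J =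
    colen (lin2 x y I) + 0)%N.
  apply: E2 => r _; split.
    move=> [b [a [Ib Ia xr]]].
    have [|w [rE aE]] := kxy (r - b) a; first by rewrite mulrBr xr; ring.
    exists (y * w), b; split=> //; last by rewrite -rE subrK.
    by exists w => //; rewrite /ideal_quo /= -aE.
  move=> [_ [b [[w xw <-] Ib ->]]]; exists b, (x * w); split=> //; ring.
have {}E3 := E3 (fun r _ => conj id id).
have {}E4 : (colen (ideal_quo I x `&` ideal_quo I y) +
    colen (ideal_add (ideal_scale y (ideal_quo I x)) I) = colen I + colen (ideal_quo I x))%N.
  by apply: E4 => r xr; split=> [yr|[]].
lia.
Qed.

(** Multiplication by [a ^+ k] identifies [R / (a, b)] with [(a ^+ k, b) / (a ^+ k.+1, b)]. *)
Lemma colen_lin2_pow x y i j : (forall k l, koszul_exact (x ^+ k) (y ^+ l)) ->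
  open_ideal (lin2 x y setT) ->
  colen (lin2 (x ^+ i) (y ^+ j) setT) = (i * j * colen (lin2 x y setT))%N.
Proof.
move=> kxy oxy; have TT := @ideal_setT R.
have step (a b : R) k : (forall k l, koszul_exact (a ^+ k) (b ^+ l)) ->
    open_ideal (lin2 a b setT) ->
    colen (lin2 (a ^+ k) b setT) = (k * colen (lin2 a b setT))%N.
  move=> kab oab; have oabk k' : open_ideal (lin2 (a ^+ k') b setT).
    by rewrite -(expr1 b); apply: open_lin2_pow.
  elim: k => [|k IHk].
    suff -> : lin2 (a ^+ 0) b setT = setT by rewrite colenT.
    by apply/seteqP; split=> // r _; exists r, 0; rewrite mul1r mulr0 addr0.
  have := @colen_scale (a ^+ k) setT (lin2 (a ^+ k.+1) b setT) (lin2 a b setT) TT (oabk _) oab.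
  rewrite colenT addn0 (_ : ideal_add _ _ = lin2 (a ^+ k) b setT); last first.
    have I' := lin2_ideal (a ^+ k) b TT.
    apply/seteqP; split.
      apply: ideal_add_min => //; first by move=> _ [r _ <-]; apply: lin2l.
      apply: lin2T_min => //; last exact: lin2yT.
      by rewrite exprSr; apply: lin2l.
    move=> _ [r [s [_ _ ->]]]; exists (a ^+ k * r), (b * s); split=> //; first by exists r.
    exact: lin2r.
  rewrite mulSn -IHk => ->//.
  move=> r _; split.
    move=> [s [t [_ _ E]]]; have [|w [rE _]] := kab k 1%N (r - a * s) t.
      by rewrite mulrBr E expr1 exprSr; ring.
    by exists s, w; split=> //; rewrite -{1}(subrK (a * s) r) rE expr1 addrC.
  by move=> [s [t [_ _ ->]]]; exists s, (a ^+ k * t); split=> //; rewrite exprSr; ring.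
rewrite step; last 2 first.
- by move=> k l; rewrite -exprM.
- by rewrite -{1}(expr1 x); apply: open_lin2_pow.
rewrite lin2C step; first by rewrite lin2C mulnA.
  by move=> k l; apply: koszul_exactC.
by rewrite lin2C.
Qed.

End Colength.

(** * Rees algebras *)

Lemma ideal_genS (R : comNzRingType) (S T : set R) : S `<=` T -> ideal_gen S `<=` ideal_gen T.
Proof.
move=> ST; apply: ideal_gen_min (ideal_gen_ideal _) _.
exact: subset_trans ST (@sub_ideal_gen _ _).
Qed.

Section HilbertBasis.
Variable B : comNzRingType.
Implicit Types (I J : set {poly B}) (p q : {poly B}).

(** Polynomials of lower degree are allowed and contribute 0, so that for an ideal [I] this is an
    ideal, increasing with [n]. *)
Definition lead_ideal I n : set B := [set b | exists p, [/\ I p, (size p <= n.+1)%N & p`_n = b]].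

Lemma lead_ideal_ideal I n : is_ideal I -> is_ideal (lead_ideal I n).
Proof.
move=> II; split=> [|r _ _ [p [Ip sp <-]] [q [Iq sq <-]]].
  by exists 0; rewrite size_poly0 coef0; split=> //; apply: II.1.
exists (r%:P * p + q); split; first exact: II.2.
  rewrite (leq_trans (size_polyD _ _)) // geq_max sq andbT mul_polyC.
  exact: leq_trans (size_scale_leq _ _) sp.
by rewrite coefD coefCM.
Qed.

Lemma lead_ideal_leq I n k : is_ideal I -> (n <= k)%N -> lead_ideal I n `<=` lead_ideal I k.
Proof.
move=> II /subnKC <-; elim: (k - n)%N => [|i IHi]; first by rewrite addn0.
move=> b /IHi[p [Ip sp <-]]; exists ('X * p); split; first exact: idealMl.
  by rewrite addnS (leq_trans (size_polyMleq _ _)) // size_polyX.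
by rewrite addnS coefXM.
Qed.

Lemma lead_ideal_sub I J : is_ideal I -> is_ideal J -> J `<=` I ->
  (forall n, lead_ideal I n `<=` lead_ideal J n) -> I `<=` J.
Proof.
move=> II JJ JI leadIJ p; move: {2}(size p) (leqnn (size p)) => n.
elim: n p => [|n IHn] p; first by rewrite leqn0 size_poly_eq0 => /eqP-> _; apply: JJ.1.
move=> sp Ip; have [|q [Jq sq qn]] := leadIJ n p`_n; first by exists p.
rewrite -(subrK q p); apply: idealD => //; apply: IHn; last by apply: idealB => //; apply: JI.
apply/leq_sizeP => j; rewrite leq_eqVlt coefB => /orP[/eqP<-|nj].
  by rewrite qn subrr.
by rewrite !nth_default ?subrr // (leq_trans _ nj).
Qed.

(** The ideals of leading coefficients reach a maximal one at some [N]; lifts of their generators in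
    degrees up to [N] account for all leading coefficients of [I]. *)
Lemma noetherian_poly : noetherian B -> noetherian {poly B}.
Proof.
move=> noeth I II.
have lift n : exists S : seq {poly B},
    [set` S] `<=` I /\ lead_ideal I n `<=` lead_ideal (ideal_gen [set` S]) n.
  have [s sE] := noeth _ (lead_ideal_ideal n II).
  have sub : [set` s] `<=` lead_ideal I n by rewrite sE; apply: sub_ideal_gen.
  rewrite {}sE; elim: s sub => [|b s IHs] sI.
    exists [::]; split=> [x|]; first by rewrite /= in_nil.
    by rewrite ideal_gen_nil => _ ->; apply: (lead_ideal_ideal _ (ideal_gen_ideal _)).1.
  have [|S [SI sS]] := IHs; first by move=> x sx; apply: sI; rewrite /= inE [_ \in _]sx orbT.
  have [|p [Ip sp pb]] := sI b; first by rewrite /= mem_head.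
  exists (p :: S); split; first by move=> q /=; rewrite inE => /orP[/eqP->|/SI].
  have LI := lead_ideal_ideal n (ideal_gen_ideal [set` p :: S]).
  move=> _ /ideal_gen_cons[r [y [/sS[q [Sq sq <-]] ->]]]; apply: (idealD LI).
    apply: (ideal_mulr _ LI); exists p; split=> //.
    by apply: sub_ideal_gen; rewrite /= mem_head.
  exists q; split=> //; apply: ideal_genS Sq => t St; rewrite /= inE.
  by rewrite [_ \in _]St orbT.
have [S SP] := choice lift.
have [|_ [[N ->] _ maxN]] := @noetherian_max _ (fun K => exists n, K = lead_ideal I n)
    (lead_ideal I 0) noeth _ (ex_intro _ _ erefl).
  by move=> _ [n ->]; apply: lead_ideal_ideal.
exists (flatten [seq S n | n <- iota 0 N.+1]).
set T := flatten _; have TI : ideal_gen [set` T] `<=` I.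
  apply: ideal_gen_min => // p /flattenP[_ /mapP[n _ ->]].
  exact: (SP n).1.
apply/seteqP; split=> //; apply: lead_ideal_sub => //; first exact: ideal_gen_ideal.
have leN n : (n <= N)%N -> lead_ideal I n `<=` lead_ideal (ideal_gen [set` T]) n.
  move=> nN b /(SP n).2[p [Sp sp pb]]; exists p; split=> //.
  apply: ideal_genS Sp => q Sq; apply/flattenP; exists (S n) => //.
  by apply/mapP; exists n; rewrite // mem_iota.
move=> n; have [/leN //|/ltnW Nn] := leqP n N.
have -> : lead_ideal I n = lead_ideal I N.
  by apply: maxN; [exists n|apply: lead_ideal_leq].
by apply: subset_trans (leN _ (leqnn N)) _; apply: lead_ideal_leq => //; apply: ideal_gen_ideal.
Qed.

End HilbertBasis.

(** Generation is phrased as an induction principle for [C] over the image of [phi] and [s]. Moving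
    a generator [g] from [s] into the base, by evaluation of polynomials at [g], preserves it; with
    [s] empty [phi] is onto. *)
Lemma noetherian_fin_gen (C : comNzRingType) (s : seq C) (B : comNzRingType)
    (phi : {rmorphism B -> C}) : noetherian B ->
  (forall P : set C, (forall b, P (phi b)) -> (forall g, g \in s -> P g) ->
     (forall x y, P x -> P y -> P (x + y)) ->
     (forall x y, P x -> P y -> P (x * y)) -> forall c, P c) ->
  noetherian C.
Proof.
elim: s B phi => [|g s IHs] B phi noeth gen.
  have surj c : range phi c.
    apply: gen => //=.
    - by move=> b; exists b.
    - by move=> _ _ [x _ <-] [y _ <-]; exists (x + y); rewrite ?rmorphD.
    - by move=> _ _ [x _ <-] [y _ <-]; exists (x * y); rewrite ?rmorphM.
  move=> I II; have [|s sE] := noeth (phi @^-1` I).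
    split=> [|r x y Ix Iy] /=; first by rewrite rmorph0; apply: II.1.
    by rewrite rmorphD rmorphM; apply: II.2.
  exists (map phi s); apply/seteqP; split.
    move=> c; have [b _ <-] := surj c => Ib.
    have : ideal_gen [set` s] b by rewrite -sE.
    have GI := ideal_gen_ideal [set` map phi s].
    have PI : is_ideal (phi @^-1` ideal_gen [set` map phi s]).
      split=> [|r x y Ix Iy] /=; first by rewrite rmorph0; apply: GI.1.
      by rewrite rmorphD rmorphM; apply: GI.2.
    apply: (ideal_gen_min PI) => x sx; apply: sub_ideal_gen; exact: map_f.
  apply: ideal_gen_min => // _ /mapP[x sx ->].
  have : (phi @^-1` I) x by rewrite sE; apply: sub_ideal_gen.
  by [].
have cg : commr_rmorph phi g by move=> x; apply: mulrC.
apply: (IHs _ (horner_morph cg : {rmorphism {poly B} -> C})).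
  exact: noetherian_poly.
move=> P Pphi Ps PD PM c; apply: gen c => // [b|h].
  by rewrite -(horner_morphC cg); apply: Pphi.
by rewrite inE => /orP[/eqP->|/Ps //]; rewrite -(horner_morphX cg); apply: Pphi.
Qed.

Section ReesNoetherian.
Variables (A : comNzRingType) (a : idealr A).
Local Notation pow := (ideal_exp [set` a]).

Lemma idealr_is_ideal : is_ideal [set` a].
Proof.
split=> [|r x y /= ax ay]; first exact: rpred0.
by rewrite rpredD // idealMr.
Qed.

Lemma rees_monom_subproof n x : pow n x -> x *: 'X^n \in rees_pred a.
Proof.
move=> ax; apply/asboolP => i; rewrite coefZ coefXn.
have [->|_] := eqVneq; first by rewrite mulr1.
by rewrite mulr0; apply: (ideal_exp_ideal _ _).1.
Qed.

Definition rees_monom n x (ax : pow n x) : rees a := Rees (rees_monom_subproof ax).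

Lemma reesP (p : rees a) i : pow i (rees_val p)`_i.
Proof. by have /asboolP := valP p. Qed.

Definition rees_const (x : A) : rees a := @rees_monom 0 x Logic.I.

Lemma rees_const_is_zmod_morphism : zmod_morphism rees_const.
Proof. by move=> x y; apply: val_inj; rewrite /= scalerBl. Qed.

Lemma rees_const_is_monoid_morphism : monoid_morphism rees_const.
Proof.
split=> [|x y]; apply: val_inj; rewrite /= expr0 ?scale1r //.
by rewrite -scalerAl -scalerAr mul1r scalerA.
Qed.

HB.instance Definition _ := GRing.isZmodMorphism.Build A (rees a) rees_const
  rees_const_is_zmod_morphism.
HB.instance Definition _ := GRing.isMonoidMorphism.Build A (rees a) rees_const
  rees_const_is_monoid_morphism.

Lemma noetherian_rees : noetherian A -> noetherian (rees a).
Proof.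
move=> noeth; have [s sE] := noeth _ idealr_is_ideal.
have s1 g : g \in s -> pow 1 g.
  by move=> gs; rewrite (ideal_exp1 idealr_is_ideal) sE; apply: sub_ideal_gen.
(* [rees_monom] carries a membership proof, hence the case analysis; [s1] ensures that no generator
   is lost. *)
pose gs := pmap (fun g => if pselect (pow 1 g) is left ag then Some (rees_monom ag) else None) s.
apply: (@noetherian_fin_gen _ gs A rees_const noeth) => P Pc Pg PD PM p.
have P0 : P 0 by rewrite -(rmorph0 rees_const).
have Pmon n x (ax : pow n x) : P (rees_monom ax).
  elim: n x ax => [|n IHn] x ax.
    by rewrite (_ : rees_monom ax = rees_const x) //; apply: val_inj.
  suff [q Pq qE] : exists2 q, P q & rees_val q = x *: 'X^(n.+1) :> {poly A}.
    by rewrite (_ : rees_monom ax = q) //; apply: val_inj; rewrite /= qE.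
  move: x {ax} (ax); apply: ideal_mul_min => [|y z].
    split=> [|r x y [p' Pp pE] [q Pq qE]]; first by exists 0; rewrite //= scale0r.
    exists (rees_const r * p' + q); first by apply: PD => //; apply: PM.
    by rewrite /= pE qE expr0 scalerDl -scalerA -scalerAl mul1r.
  move=> ay az; rewrite sE in ay.
  have KI : is_ideal [set y | exists2 q, P q & rees_val q = (y * z) *: 'X^(n.+1) :> {poly A}].
    split=> [|r x t [p' Pp pE] [q Pq qE]]; first by exists 0; rewrite //= mul0r scale0r.
    exists (rees_const r * p' + q); first by apply: PD => //; apply: PM.
    by rewrite /= pE qE expr0 mulrDl scalerDl -mulrA -!scalerA -scalerAl mul1r.
  move: y ay; apply: (ideal_gen_min KI) => g gsg; have ag := s1 g gsg.
  exists (rees_monom ag * rees_monom az); last first.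
    by rewrite /= -scalerAl -scalerAr scalerA -exprD.
  apply: PM => //; apply: Pg; rewrite mem_pmap; apply/mapP; exists g => //.
  by case: pselect => // ag'; congr Some; apply: val_inj.
have -> : p = \sum_(i < size (rees_val p)) rees_monom (reesP p i).
  by apply: val_inj; rewrite /= raddf_sum /= -[LHS]coefK poly_def.
by elim/big_ind: _.
Qed.

(** The [W n] are the pieces of a homogeneous ideal of the Noetherian Rees algebra. Beyond the
    degrees of finitely many generators, their multipliers have positive degree and yield a factor
    in [a]. *)
Lemma rees_stable (W : nat -> set A) : noetherian A ->
  (forall n, is_ideal (W n)) -> (forall n, W n `<=` pow n) ->
  (forall n x y, a x -> W n y -> W n.+1 (x * y)) ->
  exists n0, forall n, (n0 <= n)%N -> W n.+1 `<=` ideal_mul [set` a] (W n).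
Proof.
move=> noeth WI Wa aW.
have powW i j x y : pow i x -> W j y -> W (i + j)%N (x * y).
  elim: i x => [|i IHi] x ax Wy; first exact: idealMl.
  move: ax; apply: (ideal_mul_elimr (WI _)) => u v au av.
  by rewrite -mulrA addSn; apply: aW => //; apply: IHi.
pose I : set (rees a) := [set p | forall i, W i (rees_val p)`_i].
have [|s sE] := noetherian_rees noeth (I := I).
  split=> [i|r p q Ip Iq i]; first by rewrite /= coef0; apply: (WI _).1.
  rewrite rmorphD rmorphM /= coefD; apply: idealD => //.
  rewrite coefM; apply: ideal_sum => // j _.
  by rewrite -{1}(subnKC (ltn_ord j : (j <= i)%N)); apply: powW (reesP _ _) (Ip _).
have sI g : g \in s -> I g by rewrite sE => gs; apply: sub_ideal_gen.
pose n0 := \max_(g <- s) size (rees_val g).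
have sn0 g : g \in s -> (size (rees_val g) <= n0)%N.
  rewrite /n0; elim: (s) => [|h t IHt] //; rewrite inE big_cons leq_max => /orP[/eqP->|/IHt->].
    by rewrite leqnn.
  by rewrite orbT.
exists n0 => n n0n x Wx.
have wxa := Wa _ _ Wx.
have MI := ideal_mul_ideal [set` a] (W n).
suff : ideal_gen [set` s] `<=` [set p | ideal_mul [set` a] (W n) (rees_val p)`_n.+1].
  move=> /(_ (rees_monom wxa)) /=; rewrite coefZ coefXn eqxx mulr1; apply.
  rewrite -sE => i /=; rewrite coefZ coefXn.
  by have [->|_] := eqVneq; rewrite ?mulr1 // mulr0; apply: (WI _).1.
have MW i j y z : (j <= n)%N -> (i + j = n.+1)%N -> pow i y -> W j z ->
    ideal_mul [set` a] (W n) (y * z).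
  case: i => [|i]; first by lia.
  rewrite addSn => jn [ijn] ay Wz.
  move: ay; apply: (ideal_mul_elimr MI) => u v au av.
  by rewrite -mulrA; apply: ideal_mulP => //; rewrite -ijn; apply: powW.
have {n0 sn0 n0n} sn g : g \in s -> (size (rees_val g) <= n)%N.
  by move=> /sn0 gn0; apply: leq_trans n0n.
elim: s sI sn {sE} => [|g s IHs] sI sn.
  by rewrite ideal_gen_nil => _ -> /=; rewrite coef0; apply: MI.1.
move=> _ /ideal_gen_cons[r [p [sp ->]]] /=.
rewrite coefD; apply: (idealD MI); last first.
  by apply: IHs sp => h hs; [apply: sI|apply: sn]; rewrite inE hs orbT.
rewrite coefM; apply: ideal_sum => // j _.
have [jn|nj] := leqP j n.
  rewrite mulrC; apply: (MW (n.+1 - j)%N j) => //; first by rewrite subnK // leqW.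
    exact: reesP.
  by apply: sI; apply: mem_head.
rewrite nth_default ?mul0r; first exact: MI.1.
by apply: leq_trans (sn g (mem_head _ _)) (ltnW nj).
Qed.

End ReesNoetherian.

(** * Two-generated reductions *)

Section IdealrOfSet.
Variables (R : comNzRingType) (q : set R).
Hypothesis properq : is_proper q.

(** The Rees algebra is built from a bundled ideal; properness is an argument so that the instance
    can recover it. *)
Definition ideal_pred of is_proper q : {pred R} := fun x => `[< q x >].

Lemma ideal_pred_closed : idealr_closed (ideal_pred properq).
Proof.
have [qI q1] := properq; split=> [||r x y /asboolP qx /asboolP qy].
- by apply/asboolP; apply: qI.1.
- by apply/asboolP.
- by apply/asboolP; apply: qI.2.
Qed.

HB.instance Definition _ := isIdealr.Build R (ideal_pred properq) ideal_pred_closed.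

Lemma ex_idealr : exists a : idealr R, [set` a] = q.
Proof.
exists (ideal_pred properq : idealr R).
by apply/seteqP; split=> x /asboolP.
Qed.

End IdealrOfSet.

Section RegularPair.
Variables (R : comNzRingType).
Implicit Types u v x y : R.

(** Only the two cancellation conditions are kept, so that [regular_pair_pow] covers the exponent 0
    as well. *)
Definition regular_pair u v :=
  (forall w, u * w = 0 -> w = 0) /\ (forall w s, v * w = u * s -> exists t, w = u * t).

Lemma regular_pair_pow u v i j : regular_pair u v -> regular_pair (u ^+ i) (v ^+ j).
Proof.
move=> [ureg vreg]; have uireg k w : u ^+ k * w = 0 -> w = 0.
  by elim: k w => [|k IHk] w; rewrite ?mul1r // exprS -mulrA => /ureg/IHk.
have v1reg k w s : v * w = u ^+ k * s -> exists t, w = u ^+ k * t.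
  elim: k w s => [|k IHk] w s; first by exists w; rewrite mul1r.
  rewrite exprS -mulrA => /[dup]/vreg[t ->] E.
  have [|t' ->] := IHk t s; last by exists t'; rewrite mulrA.
  by apply/subr0_eq/ureg; rewrite mulrBr mulrCA E subrr.
split=> [w|]; first exact: uireg.
elim: j => [|j IHj] w s; first by rewrite mul1r => ->; exists s.
by rewrite exprSr -mulrA => /IHj[t /v1reg].
Qed.

(* Multiplication by an element of [(x, y)] kills the first Koszul homology of
   [x, y], which therefore embeds in the second one modulo [u], and that one
   vanishes because [v] is regular modulo [u]. *)
Lemma koszul_exact_regular x y u v : regular_pair u v ->
  lin2 x y setT u -> lin2 x y setT v -> koszul_exact x y.
Proof.
move=> [ureg vreg] [a [b [_ _ uE]]] [c [d [_ _ vE]]] r s rs.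
pose w0 := b * r + a * s.
have ur : u * r = y * w0.
  by rewrite uE mulrDl -!mulrA (mulrCA x) rs /w0; ring.
have us : u * s = x * w0.
  by rewrite uE mulrDl -!mulrA (mulrCA y) -rs /w0; ring.
have [|w w0E] := vreg w0 (c * s + d * r).
  by rewrite vE mulrDl -!mulrA (mulrCA x) -us (mulrCA y) -ur; ring.
by exists w; split; apply/subr0_eq/ureg; rewrite mulrBr ?ur ?us w0E; ring.
Qed.

End RegularPair.

Section TwoGenerated.
Variables (R : comNzRingType) (m : set R).
Hypotheses (noeth : noetherian R) (loc : local_ring m).
Variables u v : R.
Hypotheses (mu : m u) (mv : m v) (uvreg : regular_pair u v).
Implicit Types (x y z : R) (q : set R).

(** An open [(x, y)] contains powers of [u] and [v], which again form a regular pair. *)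
Lemma koszul_open x y : open_ideal m (lin2 x y setT) -> koszul_exact x y.
Proof.
move=> [_ [c cxy]]; apply: (koszul_exact_regular (regular_pair_pow c c uvreg)).
  by apply: cxy; apply: ideal_exp_pow.
by apply: cxy; apply: ideal_exp_pow.
Qed.

Lemma koszul_open_pow x y i j : open_ideal m (lin2 x y setT) ->
  koszul_exact (x ^+ i) (y ^+ j).
Proof. by move=> oxy; apply/koszul_open/open_lin2_pow. Qed.

Definition two_reduction q x y r :=
  [/\ q x, q y & forall n, (r <= n)%N -> ideal_exp q n.+1 = lin2 x y (ideal_exp q n)].

Lemma two_reduction_lin2 q x y r : is_ideal q -> q x -> q y ->
  ideal_exp q r.+1 `<=` lin2 x y (ideal_exp q r) -> two_reduction q x y r.
Proof.
move=> qI qx qy sub; split=> // n rn; have E k := ideal_exp_ideal q k.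
apply/seteqP; split; last by apply: lin2_min => // z; apply: ideal_expSr.
elim: n rn => [|n IHn]; first by rewrite leqn0 => /eqP r0; rewrite -r0.
rewrite leq_eqVlt => /orP[/eqP<- //|rn].
have L := lin2_ideal x y (E n.+1).
apply: (ideal_mul_min L) => z t qz /(IHn rn)[a [b [qa qb ->]]].
exists (z * a), (z * b); split; [exact: ideal_expSr|exact: ideal_expSr|ring].
Qed.

Lemma two_reduction_open q x y r : open_ideal m q -> two_reduction q x y r ->
  open_ideal m (lin2 x y setT).
Proof.
move=> oq [qx qy qE]; apply: (open_idealS (open_ideal_exp r.+1 oq)).
  exact: lin2_ideal (@ideal_setT R).
by rewrite (qE r (leqnn r)); apply: lin2S.
Qed.

(* For [U n = q ^ n.+1 : (x, y)] and a regular element [w] of [(x, y)], the ideals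
   [w U n] are the graded pieces of an ideal of the Rees algebra of [q], whence
   [U n.+1 = q U n] for large [n]. *)
Lemma two_reduction_quo q x y r : is_proper q -> open_ideal m q -> two_reduction q x y r ->
  exists n0, forall n, (n0 <= n)%N ->
    ideal_quo (ideal_exp q n.+1) x `&` ideal_quo (ideal_exp q n.+1) y = ideal_exp q n.
Proof.
move=> properq oq redq; have [c cxy] := (two_reduction_open oq redq).2.
have [qx qy qE] := redq; have E k := ideal_exp_ideal q k.
pose w := u ^+ c; have wreg := (regular_pair_pow c c uvreg).1; rewrite -/w in wreg.
have [w1 [w2 [_ _ wE]]] : lin2 x y setT w by apply/cxy/ideal_exp_pow.
pose U n := ideal_quo (ideal_exp q n.+1) x `&` ideal_quo (ideal_exp q n.+1) y.
have UI n : is_ideal (U n) by apply: ideal_setI; apply: ideal_quo_ideal.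
(* [U n] need not lie in [q ^ n], but [w U n] lies in [q ^ n.+1] because [w] is in [(x, y)]: hence
   the shift by one and the piece 0 in degree 0. *)
pose W n := if n is k.+1 then ideal_scale w (U k) else [set 0].
have [n1 n1P] : exists n0, forall n, (n0 <= n)%N -> W n.+1 `<=` ideal_mul q (W n).
  have [a aq] := ex_idealr properq; rewrite -aq; apply: rees_stable => //.
  - case=> [|n]; last exact: ideal_scale_ideal.
    by split=> // k _ _ -> ->; rewrite mulr0 addr0.
  - case=> [|n] z //= [t [xt yt] <-].
    have -> : w * t = w1 * (x * t) + w2 * (y * t) by rewrite wE; ring.
    by rewrite aq; apply: (idealD (E n.+1)); apply: (idealMl _ (E n.+1)).
  - case=> [|n] z t az /=; have qz : q z by rewrite -aq.
      by move=> ->; exists 0; [exact: (UI 0%N).1|rewrite !mulr0].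
    move=> [s [xs ys] <-]; exists (z * s); last by ring.
    by split; rewrite /ideal_quo /= mulrCA; [exact: (ideal_expSr qz xs)|exact: (ideal_expSr qz ys)].
have US n : (n1 <= n)%N -> U n.+1 `<=` ideal_mul q (U n).
  move=> n1n z Uz.
  have : ideal_scale w (ideal_mul q (U n)) (w * z).
    have sI := ideal_scale_ideal w (ideal_mul_ideal q (U n)).
    have Wz : W n.+2 (w * z) by exists z.
    move: (n1P n.+1 (leqW n1n) _ Wz); apply: (ideal_mul_min sI) => s _ qs [t Ut <-].
    by exists (s * t); [apply: ideal_mulP|ring].
  move=> [t Ut wt]; rewrite -[z]subr0 -(subrr t) opprB addrCA.
  suff -> : z - t = 0 by rewrite addr0.
  by apply: wreg; rewrite mulrBr wt subrr.
have Uq i : U (n1 + i)%N `<=` ideal_mul (ideal_exp q i) (U n1).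
  elim: i => [|i IHi] z; first by rewrite addn0 -{2}(mul1r z); apply: ideal_mulP.
  rewrite addnS => /(US _ (leq_addr _ _)).
  have MI := ideal_mul_ideal (ideal_exp q i.+1) (U n1).
  move: z; apply: (ideal_mul_min MI) => s t qs /IHi.
  apply: (ideal_mul_elim MI) => a b qa Ub.
  by rewrite mulrA; apply: ideal_mulP => //; apply: ideal_expSr.
(* For [k >= r], [U (n1 + k.+1)] lies in [q ^ k.+1 U n1 = q ^ k (x, y) U n1], and [(x, y) U n1] is
   inside [q ^ n1.+1]. *)
exists (n1 + r.+1)%N => n n1r; apply/seteqP; split; last first.
  by move=> z qz; split; apply: ideal_expSr.
have [k kr ->] : exists2 k, (r <= k)%N & n = (n1 + k.+1)%N.
  by exists (n - n1).-1; lia.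
apply: subset_trans (Uq _) _; apply: ideal_mul_min => // z t.
rewrite (qE k kr) => -[a [b [qa qb ->]]] [xt yt].
have -> : (x * a + y * b) * t = a * (x * t) + b * (y * t) by ring.
by rewrite addnS -addSn addnC; apply: idealD => //; apply: ideal_expM.
Qed.

Lemma two_reduction_hilbert q x y r : is_proper q -> open_ideal m q ->
  two_reduction q x y r -> exists n0, forall n, (n0 <= n)%N ->
  (colen (ideal_exp q n.+2) + colen (ideal_exp q n) =
   colen (lin2 x y setT) + 2 * colen (ideal_exp q n.+1))%N.
Proof.
move=> properq oq redq; have [n0 n0P] := two_reduction_quo properq oq redq.
exists (maxn n0 r) => n; rewrite geq_max => /andP[n0n rn].
have oxy := two_reduction_open oq redq.
rewrite -(colen_lin2 noeth loc (koszul_open oxy) oxy (open_ideal_exp n.+1 oq)).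
by have [_ _ qE] := redq; rewrite n0P // (qE n.+1 (leqW rn)).
Qed.

End TwoGenerated.

(** * Existence of two-generated reductions *)

Section ExistenceReduction.
Variables (R : comNzRingType) (m : set R).
Hypotheses (noeth : noetherian R) (loc : local_ring m).
Variables u v : R.
Hypotheses (mu : m u) (mv : m v) (uvreg : regular_pair u v).
Hypothesis uvopen : open_ideal m (lin2 u v setT).
Variable f : nat -> R.
Hypothesis fsep : forall i j, i != j -> ~ m (f i - f j).
Implicit Types (x y z : R) (c q : set R).

(** Over the residue field this says that a polynomial with infinitely many roots is zero. The root
    [g 0] is split off up to the constant [p.[g 0]], which is in [m], and the quotient vanishes on
    the shifted sequence since [g i.+1 - g 0] is not in the prime [m]. *)
Lemma poly_residue_vanish (g : nat -> R) (p : {poly R}) :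
  (forall i j, i != j -> ~ m (g i - g j)) ->
  (forall i, m p.[g i]) -> forall k, m p`_k.
Proof.
have mI := local_ideal loc.
move: {2}(size p) (leqnn (size p)) => n.
elim: n p g => [|n IHn] p g sp gsep gp k.
  by rewrite nth_default; [exact: mI.1|exact: leq_trans sp _].
have [q pE] : exists q : {poly R}, p - p.[g 0%N]%:P = q * ('X - (g 0%N)%:P).
  apply/factor_theorem; rewrite /root !hornerE subrr; exact: eqxx.
have qm : forall i, m q`_i.
  apply: (IHn _ (g \o S)).
  - apply/leq_sizeP => j nj.
    have [q0|q0] := eqVneq q 0; first by rewrite q0 coef0.
    rewrite nth_default // (leq_trans _ nj) // -ltnS.
    have <- : size (q * ('X - (g 0%N)%:P)) = (size q).+1.
      by rewrite size_Mmonic ?monicXsubC // size_XsubC addn2.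
    rewrite -pE (leq_trans (size_polyD _ _)) // geq_max sp size_polyN.
    exact: leq_trans (size_polyC_leq1 _) _.
  - by move=> i j ij; apply: gsep.
  - move=> i; have : m (q * ('X - (g 0%N)%:P)).[g i.+1].
      by rewrite -pE !hornerE; apply: idealB.
    rewrite hornerM !hornerE => /(local_prime noeth loc).2[//|].
    by move=> h; case: (gsep i.+1 0%N isT h).
have -> : p = q * 'X - (g 0%N) *: q + p.[g 0%N]%:P.
  by rewrite -mul_polyC -[LHS](subrK p.[g 0%N]%:P) pE mulrBr [_%:P * q]mulrC.
rewrite coefD coefB coefMX coefZ coefC.
apply: (idealD mI); last by case: ifP => _; [exact: gp|exact: mI.1].
apply: (idealB mI); last exact: idealMl.
by case: ifP => _; [exact: mI.1|exact: qm].
Qed.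

Lemma colen_exp_bound q : open_ideal m q ->
  exists C, forall n, (colen (ideal_exp q n) <= C * (n * n))%N.
Proof.
move=> oq; have [qI [c cq]] := oq.
have qu : q (u ^+ c) by apply/cq/ideal_exp_pow.
have qv : q (v ^+ c) by apply/cq/ideal_exp_pow.
have oc := open_lin2_pow c c uvopen.
exists (colen (lin2 (u ^+ c) (v ^+ c) setT)) => n.
have E := ideal_exp_ideal q n.
rewrite mulnC -(colen_lin2_pow noeth loc n n _ oc); last first.
  move=> k l; exact: (koszul_open_pow mu mv uvreg oc).
apply: (colen_le noeth loc E); first exact: open_lin2_pow.
by apply: lin2T_min => //; apply: ideal_exp_pow.
Qed.

Lemma small_degree q : open_ideal m q ->
  exists r i, [/\ (0 < r)%N, (2 * r <= i)%N &
    (colen (ideal_exp q i.+1) < colen (ideal_exp q i) + r * r)%N].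
Proof.
(* With [H n] the colength of [q ^ n], failure in all degrees from [2 r] on would give
   [2 r ^ 3 <= H (4 r) <= 16 C r ^ 2], that is [r <= 8 C]. Starting at [2 r] keeps [i - a - b]
   nonnegative for exponents [a, b < r]. *)
move=> /colen_exp_bound[C CP]; pose r := (8 * C).+1; exists r.
apply: contrapT => none.
have ge k : (k * (r * r) <= colen (ideal_exp q (2 * r + k)))%N.
  elim: k => [|k IHk] //; rewrite addnS mulSn addnC.
  have [small|big] := ltnP (colen (ideal_exp q (2 * r + k).+1))
                           (colen (ideal_exp q (2 * r + k)) + r * r).
    by case: none; exists (2 * r + k)%N; split=> //; apply: leq_addr.
  by apply: leq_trans big; rewrite leq_add2r.
have := leq_trans (ge (2 * r)%N) (CP _); rewrite /r; nia.
Qed.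

(** Otherwise the ideals [m q ^ i + (w 0, ..., w (j - 1))] would form a strict chain of length [N]
    between [q ^ i.+1] and [q ^ i]. The coefficient 1 of [w j] makes the polynomial in
    [drop_generator] monic. *)
Lemma dependent_mod q N i (w : nat -> R) : open_ideal m q ->
  (forall j, ideal_exp q i (w j)) -> q `<=` m ->
  (colen (ideal_exp q i.+1) < colen (ideal_exp q i) + N)%N ->
  exists j (c : nat -> R), (j < N)%N /\
    ideal_mul m (ideal_exp q i) (w j - \sum_(k < j) c k * w k).
Proof.
move=> oq wq qm lt; apply: contrapT => indep.
have EI := ideal_exp_ideal q i; have MI := ideal_mul_ideal m (ideal_exp q i).
pose K j : set R := [set z | exists c : nat -> R,
  ideal_mul m (ideal_exp q i) (z - \sum_(k < j) c k * w k)].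
have [l [_ lmax] lE] := length_quot_colen noeth loc EI (open_ideal_exp i.+1 oq) (@ideal_expS _ q i).
rewrite lE ltn_add2l in lt.
suff : (N <= l)%N by rewrite leqNgt lt.
apply: (lmax N K); split=> j jN.
  split.
  - split=> [|r x y [c cx] [d dy]].
      by exists (fun=> 0); rewrite big1 ?subrr; [exact: MI.1|move=> k _; rewrite mul0r].
    exists (fun k => r * c k + d k).
    have -> : r * x + y - \sum_(k < j) (r * c k + d k) * w k =
      r * (x - \sum_(k < j) c k * w k) + (y - \sum_(k < j) d k * w k).
      rewrite mulrBr mulr_sumr addrACA -opprD -big_split /=.
      by congr (_ - _); apply: eq_bigr => k _; rewrite mulrDl mulrA.
    exact: MI.2.
  - move=> z qz; exists (fun=> 0); rewrite big1 ?subr0; last by move=> k _; rewrite mul0r.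
    by apply: (ideal_mulS qm) qz.
  - move=> z [c cz]; rewrite -(subrK (\sum_(k < j) c k * w k) z); apply: (idealD EI).
      exact: ideal_mulSr cz.
    by apply: ideal_sum => // k _; apply: idealMl.
split=> [z [c cz]|sub].
  exists (fun k => if (k < j)%N then c k else 0).
  rewrite big_ord_recr /= ltnn mul0r addr0.
  by under eq_bigr => k _ do rewrite ltn_ord.
have [|c cw] := sub (w j).
  exists (fun k => (k == j)%:R); rewrite big_ord_recr /= eqxx mul1r big1 ?add0r ?subrr.
    exact: MI.1.
  by move=> k _; rewrite ltn_eqF ?mul0r.
by apply: indep; exists j, c.
Qed.

Definition reduces c q r := ideal_exp q r.+1 `<=` ideal_mul c (ideal_exp q r).

Lemma reduces_leq c q r n : is_ideal c -> reduces c q r -> (r <= n)%N -> reduces c q n.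
Proof.
move=> cI red; elim: n => [|n IHn]; first by rewrite leqn0 => /eqP<-.
rewrite leq_eqVlt => /orP[/eqP<- //|/IHn{}IHn].
have MI := ideal_mul_ideal c (ideal_exp q n.+1).
apply: (ideal_mul_min MI) => x y qx /IHn.
apply: (ideal_mul_elim MI) => a b ca qb.
by rewrite mulrCA; apply: ideal_mulP => //; apply: ideal_expSr.
Qed.

(* The degree [n] part of the ideal of the Rees algebra of [q] generated by [c] in
   degree 1. *)
Definition congr_deg c q n : set R := if n is k.+1 then ideal_mul c (ideal_exp q k) else [set 0].

Lemma congr_deg_ideal c q n : is_ideal (congr_deg c q n).
Proof.
case: n => [|n]; last exact: ideal_mul_ideal.
by split=> // r _ _ -> ->; rewrite mulr0 addr0.
Qed.

Lemma congr_degMl c q i n x y : ideal_exp q i x -> congr_deg c q n y ->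
  congr_deg c q (i + n) (x * y).
Proof.
case: n => [|n] qx; first by move=> ->; rewrite mulr0; apply: (congr_deg_ideal _ _ _).1.
rewrite addnS /=; have MI := ideal_mul_ideal c (ideal_exp q (i + n)).
apply: (ideal_mul_elim MI) => a b ca qb.
by rewrite mulrCA; apply: ideal_mulP => //; apply: ideal_expM.
Qed.

Lemma congr_degM c q i n x x' y y' : ideal_exp q i x -> ideal_exp q n y' ->
  congr_deg c q i (x - x') -> congr_deg c q n (y - y') ->
  congr_deg c q (i + n) (x * y - x' * y').
Proof.
move=> qx qy' xx yy; have -> : x * y - x' * y' = x * (y - y') + y' * (x - x') by ring.
apply: (idealD (congr_deg_ideal _ _ _)); first exact: congr_degMl.
by rewrite addnC; apply: congr_degMl.
Qed.

Lemma congr_degX c q n x y : is_ideal q -> q x -> q y -> c (x - y) ->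
  congr_deg c q n (x ^+ n - y ^+ n).
Proof.
move=> qI qx qy cxy; elim: n => [|n IHn]; first by rewrite subrr.
rewrite !exprS -addn1 addnC; apply: congr_degM => //.
- by rewrite ideal_exp1.
- exact: ideal_exp_pow.
- by rewrite -(mulr1 (x - y)); apply: ideal_mulP.
Qed.

(* By [small_degree] the monomials [y1 ^+ a * y2 ^+ b * y3 ^+ (i - a - b)] with
   [a, b < r] are dependent modulo [m]. Substituting [y1 = l * y3] and
   [y2 = l ^+ r * y3] turns the dependence into [p.[l] * y3 ^+ i] for a polynomial
   [p] in one variable, and [p.[l]] is a unit for some [l]. *)
Lemma drop_generator q y1 y2 y3 (s : seq R) r0 : is_proper q -> open_ideal m q ->
  q y1 -> q y2 -> q y3 -> reduces (ideal_gen [set` y1 :: y2 :: y3 :: s]) q r0 ->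
  exists l1 l2 r, reduces (ideal_gen [set` (y1 - l1 * y3) :: (y2 - l2 * y3) :: s]) q r.
Proof.
move=> properq oq q1 q2 q3 red; have qI := properq.1.
have [r [i [r_gt0 ri small]]] := small_degree oq.
(* The exponents are the digits of [j] in base [r]: putting [y1 = l * y3] and [y2 = l ^+ r * y3]
   turns [w j] into [l ^+ j * y3 ^+ i], so distinct monomials give distinct powers of [l]. *)
pose w j := y1 ^+ (j %% r) * (y2 ^+ (j %/ r) * y3 ^+ (i - j %% r - j %/ r)).
have mod_div j : (j < r * r)%N -> (j %% r + (j %/ r + (i - j %% r - j %/ r)) = i)%N.
  move=> jr; have := ltn_pmod j r_gt0; have : (j %/ r < r)%N by rewrite ltn_divLR.
  by move: (j %% r)%N (j %/ r)%N => a b; lia.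
(* Beyond [r * r] the truncated exponent of [y3] could spoil the degree; 0 keeps the whole sequence
   in [q ^ i]. *)
pose w' j := if (j < r * r)%N then w j else 0.
have w'q j : ideal_exp q i (w' j).
  rewrite /w'; case: ifP => [jr|_]; last exact: (ideal_exp_ideal _ _).1.
  by rewrite -(mod_div j jr); do 2?apply: ideal_expM; apply: ideal_exp_pow.
have [j [c [jr dep]]] := dependent_mod oq w'q (proper_sub_local noeth loc properq) small.
pose p : {poly R} := 'X^j - \poly_(k < j) c k.
have [k nmp] : exists k, ~ m p.[f k].
  apply: contrapT => none; apply: (local_not1 loc).
  have <- : p`_j = 1 by rewrite coefB coefXn eqxx coef_poly ltnn subr0.
  by apply: (poly_residue_vanish fsep) => k; apply: contrapT => nm; apply: none; exists k.
pose l := f k; exists l, (l ^+ r), (r0 + i.-1)%N.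
set c' := ideal_gen _; set C := ideal_gen _ in red.
have c'I : is_ideal c' by apply: ideal_gen_ideal.
have i_gt0 : (0 < i)%N by lia.
have c1 : c' (y1 - l * y3) by apply: sub_ideal_gen; rewrite /= mem_head.
have c2 : c' (y2 - l ^+ r * y3) by apply: sub_ideal_gen; rewrite /= !inE eqxx orbT.
have cs t : t \in s -> c' t by move=> ts; apply: sub_ideal_gen; rewrite /= !inE ts !orbT.
have ql x : q (x * y3) by apply: idealMl.
have wl n : (n < r * r)%N -> congr_deg c' q i (w n - l ^+ n * y3 ^+ i).
  move=> nr; have E := mod_div n nr.
  have -> : l ^+ n * y3 ^+ i = (l * y3) ^+ (n %% r) *
      ((l ^+ r * y3) ^+ (n %/ r) * y3 ^+ (i - n %% r - n %/ r)).
    rewrite !exprMn -exprM {1}(divn_eq n r) exprD (mulnC _ r) -{1}E !exprD; ring.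
  rewrite -{1}E; apply: congr_degM; first exact: ideal_exp_pow.
  - by apply: ideal_expM; apply: ideal_exp_pow.
  - exact: congr_degX.
  apply: congr_degM; [exact: ideal_exp_pow|exact: ideal_exp_pow|exact: congr_degX|].
  by rewrite subrr; apply: (congr_deg_ideal _ _ _).1.
have KI : is_ideal (ideal_add (congr_deg c' q i) (ideal_mul m (ideal_exp q i))).
  by apply: ideal_add_ideal; [apply: congr_deg_ideal|apply: ideal_mul_ideal].
have DI := congr_deg_ideal c' q i.
have Ky3 : ideal_add (congr_deg c' q i) (ideal_mul m (ideal_exp q i)) (y3 ^+ i).
  have [t pt] := local_unit noeth loc nmp.
  have -> : y3 ^+ i = t * (p.[l] * y3 ^+ i) by rewrite mulrA (mulrC t) pt mul1r.
  apply: (idealMl _ KI).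
  exists (p.[l] * y3 ^+ i - (w' j - \sum_(n < j) c n * w' n)), (w' j - \sum_(n < j) c n * w' n).
  split=> //; last by rewrite subrK.
  have -> : p.[l] * y3 ^+ i - (w' j - \sum_(n < j) c n * w' n) =
     \sum_(n < j) c n * (w n - l ^+ n * y3 ^+ i) - (w j - l ^+ j * y3 ^+ i).
    rewrite /p !hornerE horner_poly /w' jr.
    under [X in _ - (_ - X)]eq_bigr => n _ do rewrite (ltn_trans (ltn_ord n) jr).
    under [X in _ = X - _]eq_bigr => n _ do rewrite mulrBr [c _ * (_ * y3 ^+ i)]mulrA.
    rewrite sumrB -mulr_suml; ring.
  apply: (idealB DI); last exact: wl.
  apply: ideal_sum => // n _; apply: (idealMl _ DI); apply: wl.
  exact: ltn_trans (ltn_ord n) jr.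
(* Modulo [c'] every element of [C] is a multiple of [y3], so each factor from [C] is absorbed by
   [c'] or adds one [y3]. *)
have step n : ideal_exp q (r0 + n).+1 `<=`
    ideal_add (ideal_mul c' (ideal_exp q (r0 + n))) (ideal_scale (y3 ^+ n.+1) (ideal_exp q r0)).
  have TI k' : is_ideal (ideal_add (ideal_mul c' (ideal_exp q (r0 + k')))
     (ideal_scale (y3 ^+ k'.+1) (ideal_exp q r0))).
    apply: ideal_add_ideal; first exact: ideal_mul_ideal.
    by apply: ideal_scale_ideal; apply: ideal_exp_ideal.
  have CE x : C x -> exists2 b, c' b & exists d, x = b + y3 * d.
    move=> /ideal_gen_cons[d1 [_ [/ideal_gen_cons[d2 [_ [/ideal_gen_cons[d3 [t [ts ->]]] ->]]] ->]]].
    exists ((y1 - l * y3) * d1 + (y2 - l ^+ r * y3) * d2 + t).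
      apply: (idealD c'I); last by apply: (ideal_gen_min c'I _ ts) => ? /cs.
      by apply: (idealD c'I); apply: (ideal_mulr _ c'I).
    by exists (l * d1 + l ^+ r * d2 + d3); ring.
  elim: n => [|n IHn].
    rewrite addn0 in TI *; apply: subset_trans red _.
    have := TI 0%N; rewrite addn0 => TI0; apply: (ideal_mul_min TI0).
    move=> x y /CE[b cb [d ->]] qy; exists (b * y), (y3 * (d * y)).
    split; [exact: ideal_mulP|by exists (d * y) => //; apply: idealMl (ideal_exp_ideal _ _) qy|ring].
  have redn : reduces C q (r0 + n).+1.
    by apply: reduces_leq red _; [exact: ideal_gen_ideal|lia].
  rewrite addnS; apply: subset_trans redn _; have := TI n.+1; rewrite addnS => TIn.
  apply: (ideal_mul_min TIn) => x y /CE[b cb [d ->]] qy; rewrite mulrDl.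
  apply: (idealD TIn).
    apply: sub_ideal_addl; first by apply: ideal_scale_ideal; apply: ideal_exp_ideal.
    exact: ideal_mulP.
  have -> : y3 * d * y = d * (y3 * y) by ring.
  apply: (idealMl _ TIn); have [a [_ [ca [e qe <-] ->]]] := IHn _ qy.
  exists (y3 * a), (y3 ^+ n.+2 * e); split; last by rewrite [y3 ^+ n.+2]exprS mulrDr mulrA.
    have MI := ideal_mul_ideal c' (ideal_exp q (r0 + n).+1).
    move: ca; apply: (ideal_mul_elim MI) => a1 b1 ca1 qb1.
    by rewrite mulrCA; apply: ideal_mulP => //; apply: ideal_expSr.
  by exists e.
(* In degree [r0 + i] the remaining term [y3 ^+ i q ^ r0] lies in
   [c' q ^ (r0 + i - 1) + m q ^ (r0 + i)], and Nakayama's lemma removes the second summand. *)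
have EI := ideal_exp_ideal q (r0 + i.-1).+1.
rewrite /reduces; apply: (nakayama noeth loc EI); first exact: ideal_mul_ideal.
apply: subset_trans (step _) _; rewrite prednK //.
set T := ideal_add _ (ideal_mul m _).
have TI : is_ideal T by apply: ideal_add_ideal; apply: ideal_mul_ideal.
have mT := sub_ideal_addl (ideal_mul_ideal m (ideal_exp q (r0 + i.-1).+1)).
apply: (ideal_add_min TI); first exact: mT.
move=> _ [e qe <-].
have [a [b [ca mb ->]]] := Ky3; rewrite mulrDl; apply: (idealD TI).
  apply: mT; rewrite mulrC; have := congr_degMl qe ca.
  by rewrite -{1}(prednK i_gt0) addnS.
apply: sub_ideal_addr; first exact: ideal_mul_ideal.
have MI := ideal_mul_ideal m (ideal_exp q (r0 + i.-1).+1).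
move: mb; apply: (ideal_mul_elimr MI) => a1 b1 ca1 qb1.
rewrite -mulrA; apply: ideal_mulP => //.
have iE : (i + r0)%N = (r0 + i.-1).+1 by lia.
by have := ideal_expM qb1 qe; rewrite iE.
Qed.

(** As long as three generators remain, [drop_generator] trades them for two others inside [c];
    shorter lists are padded with 0. Having [x] and [y] in [c] is what identifies a minimal
    reduction with [(x, y)]. *)
Lemma ex_two_reduction c q r : is_proper q -> open_ideal m q -> is_ideal c -> c `<=` q ->
  reduces c q r -> exists x y r', [/\ c x, c y & two_reduction q x y r'].
Proof.
move=> properq oq cI cq red; have [s sE] := noeth cI.
have sc : [set` s] `<=` c by rewrite sE; apply: sub_ideal_gen.
rewrite {}sE in red.
have qI := properq.1.
have final x y k (t : seq R) : c x -> c y -> ideal_gen [set` t] `<=` lin2 x y setT ->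
    reduces (ideal_gen [set` t]) q k -> exists x y r', [/\ c x, c y & two_reduction q x y r'].
  move=> cx cy txy redt; exists x, y, k; split=> //.
  apply: two_reduction_lin2 => //; [exact: cq|exact: cq|].
  apply: subset_trans redt _; rewrite -ideal_mul_lin2; last exact: ideal_exp_ideal.
  exact: ideal_mulS.
move: {2}(size s) (leqnn (size s)) => n.
elim: n s sc r red => [|n IHn] [|x [|y [|z s]]] // sc r red sn.
- apply: (final 0 0 r [::]) => //; try exact: cI.1.
  by rewrite ideal_gen_nil => _ ->; apply: (lin2_ideal _ _ (@ideal_setT R)).1.
- apply: (final 0 0 r [::]) => //; try exact: cI.1.
  by rewrite ideal_gen_nil => _ ->; apply: (lin2_ideal _ _ (@ideal_setT R)).1.
- apply: (final x 0 r [:: x]) => //; [by apply: sc; rewrite /= mem_head|exact: cI.1|].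
  move=> _ /ideal_gen_cons[a [b [+ ->]]]; rewrite ideal_gen_nil => ->.
  by exists a, 0; rewrite mul0r.
- apply: (final x y r [:: x; y]) => //; [by apply: sc; rewrite /= mem_head| |].
    by apply: sc; rewrite /= !inE eqxx orbT.
  by rewrite ideal_gen2.
have cx : c x by apply: sc; rewrite /= mem_head.
have cy : c y by apply: sc; rewrite /= !inE eqxx orbT.
have cz : c z by apply: sc; rewrite /= !inE eqxx !orbT.
have [l1 [l2 [r' red']]] := drop_generator properq oq (cq _ cx) (cq _ cy) (cq _ cz) red.
apply: (IHn _ _ r' red') => //.
move=> t; rewrite /= !inE => /or3P[/eqP->|/eqP->|ts].
- by apply: idealB => //; apply: idealMl.
- by apply: idealB => //; apply: idealMl.
- by apply: sc; rewrite /= !inE ts !orbT.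
Qed.

End ExistenceReduction.

(** * Hilbert functions *)

(** [D] removes the quadratic part and has constant first difference [b]; doubling [H] keeps the
    coefficients integral. *)
Lemma quadratic_of_second_difference (H : nat -> int) (L : int) n0 :
  (forall n, (n0 <= n)%N -> H n.+2 + H n = L + H n.+1 *+ 2) ->
  exists b c : int, forall n, (n0 <= n)%N -> H n *+ 2 = L * n%:Z ^+ 2 + b * n%:Z + c.
Proof.
move=> HL; pose D n := H n *+ 2 - L * n%:Z ^+ 2.
pose b := D n0.+1 - D n0; exists b, (D n0 - b * n0%:Z).
suff DE k : D (n0 + k)%N = D n0 + b * k%:Z /\ D (n0 + k).+1 = D n0 + b * k.+1%:Z.
  move=> n n0n; have [+ _] := DE (n - n0)%N; rewrite subnKC // -subzn // => DnE.
  have -> : H n *+ 2 = D n + L * n%:Z ^+ 2 by rewrite /D subrK.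
  by rewrite DnE; ring.
elim: k => [|k [IH1 IH2]].
  by rewrite addn0; split; rewrite /b; ring.
rewrite addnS; split=> //.
have := HL (n0 + k)%N (leq_addr _ _); move: IH1 IH2; rewrite /D => IH1 IH2 E.
have -> : H (n0 + k).+2 *+ 2 = (L + H (n0 + k).+1 *+ 2) *+ 2 - H (n0 + k)%N *+ 2.
  by rewrite -E; ring.
have {IH1}-> : H (n0 + k)%N *+ 2 = (D n0 + b * k%:Z) + L * (n0 + k)%N%:Z ^+ 2.
  by rewrite -IH1; ring.
have {IH2}-> : H (n0 + k).+1 *+ 2 = (D n0 + b * k.+1%:Z) + L * (n0 + k).+1%:Z ^+ 2.
  by rewrite -IH2; ring.
rewrite /D /b /D !intS; ring.
Qed.

Lemma quadratic_const_inj (L b c L' b' c' : int) n0 :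
  (forall n, (n0 <= n)%N -> L * n%:Z ^+ 2 + b * n%:Z + c = L' * n%:Z ^+ 2 + b' * n%:Z + c') ->
  c = c'.
Proof.
move=> E; have := E n0 (leqnn _); have := E n0.+1 (leqnSn _).
have := E n0.+2 (leqW (leqnSn _)); rewrite !intS.
move: (n0%:Z) => n E2 E1 E0.
have LE : L = L' by lia.
have bE : b = b' by move: E1 E0; rewrite LE; lia.
by move: E0; rewrite LE bE; lia.
Qed.

Section HilbertSeries.
Implicit Types (l : nat -> int) (h : {poly int}).

Lemma coef_sqr_1subX i : ((1 - 'X) ^+ 2 : {poly int})`_i = (i == 0%N)%:R - (i == 1%N)%:R *+ 2 + (i == 2)%:R.
Proof.
have -> : (1 - 'X) ^+ 2 = 1 - 'X *+ 2 + 'X^2 :> {poly int} by ring.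
by rewrite coefD coefB coefMn coef1 coefX coefXn.
Qed.

Lemma hilbert_conv l n : \sum_(i < n.+3) ((1 - 'X) ^+ 2 : {poly int})`_i * l (n.+2 - i)%N =
  l n.+2 - l n.+1 *+ 2 + l n.
Proof.
rewrite !big_ord_recl /= big1; last first.
  by move=> i _; rewrite coef_sqr_1subX /= mul0rn subr0 addr0 mul0r.
have -> : bump 0 (bump 0 0) = 2%N by [].
have -> : bump 0 0 = 1%N by [].
rewrite !coef_sqr_1subX /= subn0 !subSS !subn0; ring.
Qed.

(** The generating series of [H] is [z h(z) / (1 - z) ^ 3], so [H n] is the sum of [h_j] times the
    binomial coefficient of [n + 1 - j] over 2. *)
Lemma hilbert_series_sum l h (H : nat -> int) :
  (forall n, \sum_(i < n.+1) ((1 - 'X) ^+ 2)`_i * l (n - i)%N = h`_n) ->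
  H 0%N = 0 -> (forall n, H n.+1 = H n + l n) ->
  forall n, H n *+ 2 = \sum_(j < n) h`_j * ((n%:Z + 1 - j%:Z) * (n%:Z - j%:Z)).
Proof.
move=> hE H0 HS.
have h0 : h`_0 = l 0%N by rewrite -hE big_ord1 coef_sqr_1subX /= subn0; ring.
have h1 : h`_1 = l 1%N - l 0%N *+ 2.
  by rewrite -hE !big_ord_recl big_ord0 !coef_sqr_1subX /= subn0 subnn; ring.
have sum0 n : \sum_(j < n.+2) h`_j = l n.+1 - l n.
  elim: n => [|n IHn]; first by rewrite !big_ord_recr big_ord0 /= h0 h1; ring.
  by rewrite big_ord_recr /= IHn -hE hilbert_conv; ring.
have sum1 n : \sum_(j < n.+1) h`_j * (n%:Z + 1 - j%:Z) = l n.
  elim: n => [|n IHn]; first by rewrite big_ord1 h0 /= subr0 add0r mulr1.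
  have -> : \sum_(j < n.+2) h`_j * (n.+1%:Z + 1 - j%:Z) =
     \sum_(j < n.+2) h`_j * (n%:Z + 1 - j%:Z) + \sum_(j < n.+2) h`_j.
    by rewrite -big_split; apply: eq_bigr => j _; rewrite intS /=; ring.
  by rewrite sum0 big_ord_recr /= IHn intS; ring.
elim=> [|n IHn]; first by rewrite H0 big_ord0 mul0rn.
have -> : \sum_(j < n.+1) h`_j * ((n.+1%:Z + 1 - j%:Z) * (n.+1%:Z - j%:Z)) =
   \sum_(j < n.+1) h`_j * ((n%:Z + 1 - j%:Z) * (n%:Z - j%:Z)) +
   (\sum_(j < n.+1) h`_j * (n%:Z + 1 - j%:Z)) *+ 2.
  by rewrite -sumrMnl -big_split; apply: eq_bigr => j _; rewrite intS /=; ring.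
by rewrite sum1 big_ord_recr /= -IHn HS; ring.
Qed.

Lemma nderivn2_at1 h : (h^`N(2)).[1] *+ 2 = \sum_(j < size h) h`_j * (j%:Z * (j%:Z - 1)).
Proof.
rewrite (@horner_coef_wide _ (size h)); last first.
  by apply/leq_sizeP => j hj; rewrite coef_nderivn nth_default ?mul0rn // (leq_trans hj) // leq_addl.
have wide (F : nat -> int) : \sum_(j < (size h).+2) h`_j * F j = \sum_(j < size h) h`_j * F j.
  by rewrite !big_ord_recr /= !nth_default ?mul0r ?addr0.
rewrite -(wide (fun j => j%:Z * (j%:Z - 1))) !big_ord_recl /= -sumrMnl.
rewrite mul0r mulr0 add0r subrr !mulr0 add0r; apply: eq_bigr => j _.
have -> : bump 0 (bump 0 j) = j.+2 by [].
rewrite coef_nderivn expr1n mulr1 add2n -mulrnA -mulr_natr; congr (_ * _).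
have := mul_bin_diag j.+2 1; rewrite bin1 /= => E.
rewrite (mulnC _ 2) -E; lia.
Qed.

(** From [(n + 1 - j) (n - j) = n ^ 2 + (1 - 2 j) n + j (j - 1)], whose constant terms sum to the
    second derivative of [h] at 1. *)
Lemma hilbert_numerator_poly l h (H : nat -> int) :
  (forall n, \sum_(i < n.+1) ((1 - 'X) ^+ 2)`_i * l (n - i)%N = h`_n) ->
  H 0%N = 0 -> (forall n, H n.+1 = H n + l n) ->
  exists L b : int, forall n, (size h <= n)%N ->
    H n *+ 2 = L * n%:Z ^+ 2 + b * n%:Z + (h^`N(2)).[1] *+ 2.
Proof.
move=> hE H0 HS; exists (\sum_(j < size h) h`_j), (\sum_(j < size h) h`_j * (1 - j%:Z *+ 2)) => n hn.
rewrite (hilbert_series_sum hE H0 HS) nderivn2_at1 !mulr_suml -!big_split /=.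
rewrite -(subnKC hn) big_split_ord /= [X in _ + X]big1 ?addr0 => [|j _]; last first.
  by rewrite nth_default ?mul0r ?leq_addr.
by apply: eq_bigr => j _; ring.
Qed.

Lemma hilbert_numerator_ex l n0 :
  (forall n, (n0 <= n)%N -> l n.+2 - l n.+1 *+ 2 + l n = 0) ->
  exists h : {poly int}, forall n, \sum_(i < n.+1) ((1 - 'X) ^+ 2)`_i * l (n - i)%N = h`_n.
Proof.
move=> l0; exists (\poly_(n < n0.+2) \sum_(i < n.+1) ((1 - 'X) ^+ 2 : {poly int})`_i * l (n - i)%N) => n.
rewrite coef_poly; case: ltnP => // n0n.
have [k kn ->] : exists2 k, (n0 <= k)%N & n = k.+2 by exists n.-2; lia.
by rewrite hilbert_conv l0.
Qed.

End HilbertSeries.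

(** * Minimality and powers of two-generated reductions *)

Section Reduction.
Variables (R : comNzRingType) (m : set R).
Hypotheses (noeth : noetherian R) (loc : local_ring m).
Variables u v : R.
Hypotheses (mu : m u) (mv : m v) (uvreg : regular_pair u v).
Hypothesis uvopen : open_ideal m (lin2 u v setT).
Variable f : nat -> R.
Hypothesis fsep : forall i j, i != j -> ~ m (f i - f j).
Implicit Types (x y z : R) (c q : set R).

Lemma lin2_local_not1 x y : m x -> m y -> ~ lin2 x y setT 1.
Proof.
move=> mx my xy1; apply: (local_not1 loc).
exact: (lin2T_min (local_ideal loc) mx my xy1).
Qed.

(** Nakayama's lemma would give [q ^ n.+1] inside [w q ^ n], making [(w, 0)] open and so Koszul
    exact; its syzygy [(0, 1)] then makes [w] a unit. *)
Lemma reduction_not_principal q c w n : open_ideal m q -> m w -> reduces c q n ->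
  ~ c `<=` ideal_add (ideal_scale w setT) (ideal_mul m q).
Proof.
move=> oq mw red cw; have EI := ideal_exp_ideal q.
have SI := ideal_scale_ideal w (EI n).
have sub : ideal_exp q n.+1 `<=` ideal_scale w (ideal_exp q n).
  apply: (nakayama noeth loc (EI _) SI).
  have mI := ideal_mul_ideal m (ideal_exp q n.+1).
  have TI := ideal_add_ideal SI mI.
  apply: subset_trans red _; apply: (ideal_mul_min TI) => x y /cw[_ [b [[r _ <-] cb ->]]] qy.
  rewrite mulrDl; apply: (idealD TI).
    apply: (sub_ideal_addl mI); exists (r * y); last by rewrite mulrA.
    exact: idealMl (EI n) qy.
  apply: (sub_ideal_addr SI).
  move: cb; apply: (ideal_mul_elimr mI) => s t ms qt.
  by rewrite -mulrA; apply: ideal_mulP => //; apply: ideal_expSr.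
have ow : open_ideal m (lin2 w 0 setT).
  apply: (open_idealS (open_ideal_exp n.+1 oq)); first exact: lin2_ideal (@ideal_setT R).
  by move=> z /sub[r _ <-]; apply: lin2l (@ideal_setT R) _.
have [|w' [_ w1]] := koszul_open mu mv uvreg ow (r := 0) (s := 1); first by rewrite mulr0 mul0r.
by apply: (local_not1 loc); rewrite w1; apply: (ideal_mulr _ (local_ideal loc)).
Qed.

Lemma is_reduction_reduces q c : is_reduction q c -> exists n, reduces c q n.
Proof. by move=> [_ _ [n nE]]; exists n; rewrite /reduces nE. Qed.

Lemma two_reduction_is_reduction q x y r : is_ideal q -> two_reduction q x y r ->
  is_reduction q (lin2 x y setT).
Proof.
move=> qI [qx qy qE]; split; [exact: lin2_ideal (@ideal_setT R)|exact: lin2T_min|].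
by exists r; rewrite ideal_mul_lin2 ?qE //; apply: ideal_exp_ideal.
Qed.

(* A reduction contained in [c = (x, y)] but different from [c] would be
   principal modulo [m c]. *)
Lemma two_reduction_minimal q x y r : is_proper q -> open_ideal m q ->
  two_reduction q x y r -> is_minimal_reduction q (lin2 x y setT).
Proof.
move=> properq oq redq; have qI := properq.1; split; first exact: two_reduction_is_reduction redq.
have [qx qy _] := redq.
move=> c' redc' c'c; have [n nred] := is_reduction_reduces redc'.
have [c'I c'q _] := redc'; have qm := proper_sub_local noeth loc properq.
have TT := @ideal_setT R; have mqI := ideal_mul_ideal m q.
apply/seteqP; split=> //; apply: contrapT => ncc'.
(* With [r] a unit, [c = (g, y0)] for [g = x0 * r + y0 * s], and elements of [c'] are multiples of
   [g] plus [y0 * d]. A unit [d] would put [y0], hence [x0], in [c']; so [d] is in [m] and [w = g]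
   works. *)
have key x0 y0 : q y0 -> lin2 x0 y0 setT = lin2 x y setT ->
    (exists r s, c' (x0 * r + y0 * s) /\ ~ m r) ->
    exists2 w, m w & c' `<=` ideal_add (ideal_scale w setT) (ideal_mul m q).
  move=> qy0 xyE [r' [s [c'g /(local_unit noeth loc)[t rt]]]].
  set g := x0 * r' + y0 * s in c'g; exists g; first exact/qm/c'q.
  move=> h c'h; have : lin2 x0 y0 setT h by rewrite xyE; apply: c'c.
  move=> [p [p' [_ _ hE]]]; pose d := p' - s * t * p.
  have dE : h = g * (t * p) + y0 * d.
    by rewrite hE /g /d -{1}[p]mul1r -rt; ring.
  have [md|nmd] := pselect (m d).
    exists (g * (t * p)), (y0 * d); split=> //; first by exists (t * p).
    by rewrite mulrC; apply: ideal_mulP.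
  have [t' dt'] := local_unit noeth loc nmd.
  have c'y0 : c' y0.
    have -> : y0 = (h - g * (t * p)) * t' by rewrite dE addrAC subrr add0r -mulrA dt' mulr1.
    by apply: (ideal_mulr _ c'I); apply: (idealB c'I) => //; apply: ideal_mulr.
  case: ncc'; rewrite -xyE; apply: lin2T_min => //.
  have -> : x0 = (g - y0 * s) * t by rewrite /g addrK -mulrA rt mulr1.
  by apply: (ideal_mulr _ c'I); apply: (idealB c'I) => //; apply: ideal_mulr.
suff [w mw cw] : exists2 w, m w & c' `<=` ideal_add (ideal_scale w setT) (ideal_mul m q).
  exact: (reduction_not_principal oq mw nred).
have [|nx] := pselect (exists r s, c' (x * r + y * s) /\ ~ m r); first exact: key.
have [|ny] := pselect (exists r s, c' (y * r + x * s) /\ ~ m r).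
  by apply: key => //; rewrite lin2C.
exists 0; first exact: (local_ideal loc).1.
move=> h c'h; apply: (sub_ideal_addr (ideal_scale_ideal 0 TT)).
have [a [b [_ _ hE]]] := c'c _ c'h.
have ma : m a by apply: contrapT => nma; apply: nx; exists a, b; rewrite -hE.
have mb : m b by apply: contrapT => nmb; apply: ny; exists b, a; rewrite addrC -hE.
by rewrite hE; apply: (idealD mqI); rewrite mulrC; apply: ideal_mulP.
Qed.

Lemma minimal_reduction_two q c : is_proper q -> open_ideal m q ->
  is_minimal_reduction q c -> exists x y r, two_reduction q x y r /\ c = lin2 x y setT.
Proof.
move=> properq oq [redc cmin]; have [n nred] := is_reduction_reduces redc.
have [cI cq _] := redc.
have [x [y [r [cx cy redq]]]] :=
  ex_two_reduction noeth loc mu mv uvreg uvopen fsep properq oq cI cq nred.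
exists x, y, r; split=> //; apply/esym/cmin; last exact: lin2T_min.
exact: two_reduction_is_reduction properq.1 redq.
Qed.

(** Factors [x] and [y] are split off one at a time until [x ^+ i.+1] or [y ^+ j.+1] is reached; by
    then the cofactor still has degree at least [N]. *)
Lemma two_reduction_exp q x y r N i j z : two_reduction q x y r -> (r <= N)%N ->
  ideal_exp q (N + i + j).+1 z -> exists s t, [/\ ideal_exp q (N + j) s,
    ideal_exp q (N + i) t & z = x ^+ i.+1 * s + y ^+ j.+1 * t].
Proof.
move=> [qx qy qE] rN; have E := ideal_exp_ideal q.
elim: i j z => [|i IHi]; elim=> [|j IHj] z.
- by rewrite !addn0 qE // => -[s [t [? ? ->]]]; exists s, t; rewrite !expr1.
- rewrite addnS qE => [[s [t [qs qt ->]]]|]; last by lia.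
  have [s' [t' [qs' qt' ->]]] := IHj _ qt.
  exists (s + y * s'), t'; split=> //; last by rewrite !exprS; ring.
  rewrite addn0 in qs; apply: idealD => //; first by rewrite addnS.
  by rewrite addnS; apply: ideal_expSr.
- rewrite !addnS addn0 qE => [[s [t [qs qt ->]]]|]; last by lia.
  have [|s' [t' [qs' qt' ->]]] := IHi 0%N s; first by rewrite addn0.
  exists s', (t + x * t'); split=> //; last by rewrite !exprS; ring.
  by apply: (idealD (E _)) => //; apply: ideal_expSr.
- rewrite !addnS addSn qE => [[s [t [qs qt ->]]]|]; last by lia.
  have [|s1 [t1 [qs1 qt1 ->]]] := IHi j.+1 s; first by rewrite addnS.
  have [|s2 [t2 [qs2 qt2 ->]]] := IHj t; first by rewrite addnS addSn.
  exists (s1 + y * s2), (x * t1 + t2); split; last by rewrite !exprS; ring.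
    by apply: (idealD (E _)); [rewrite -addnS|apply: ideal_expSr].
  by apply: (idealD (E _)); [apply: ideal_expSr|rewrite -addnS].
Qed.

Lemma two_reduction_pow q x y r k : is_ideal q -> two_reduction q x y r ->
  two_reduction (ideal_exp q k.+1) (x ^+ k.+1) (y ^+ k.+1) r.+1.
Proof.
move=> qI redq; have [qx qy _] := redq; apply: two_reduction_lin2.
- exact: ideal_exp_ideal.
- exact: ideal_exp_pow.
- exact: ideal_exp_pow.
rewrite !ideal_exp_exp => z qz.
(* This [N] gives [N + 2 k + 1 = k.+1 * r.+2] and [N + k = k.+1 * r.+1], both exponents of powers of
   [q ^ k.+1]. *)
have [||s [t [qs qt ->]]] := two_reduction_exp (N := (k.+1 * r.+1 - k)%N) (i := k) (j := k) redq _ (z := z).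
- by nia.
- by congr ideal_exp: qz; nia.
by exists s, t; split=> //; [congr ideal_exp: qs|congr ideal_exp: qt]; nia.
Qed.

End Reduction.

(** * The second Hilbert coefficient and powers of the ideal *)

Section SecondCoefficient.
Variables (R : comNzRingType) (m : set R).
Hypotheses (noeth : noetherian R) (loc : local_ring m).
Variables u v : R.
Hypotheses (mu : m u) (mv : m v) (uvreg : regular_pair u v).
Hypothesis uvopen : open_ideal m (lin2 u v setT).
Variable f : nat -> R.
Hypothesis fsep : forall i j, i != j -> ~ m (f i - f j).
Variable a : set R.
Hypotheses (propera : is_proper a) (oa : open_ideal m a).
Variables (x y : R) (r0 : nat).
Hypothesis xyred : two_reduction a x y r0.

Local Notation H n := (colen (ideal_exp a n)).
Local Notation L := (colen (lin2 x y setT)).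
Local Notation J k := (lin2 (x ^+ k) (y ^+ k) (ideal_exp a k)).

Let aI : is_ideal a := propera.1.
Let ax : a x. Proof. by case: xyred. Qed.
Let ay : a y. Proof. by case: xyred. Qed.
Let oxy : open_ideal m (lin2 x y setT). Proof. exact: two_reduction_open xyred. Qed.
Let oH n : open_ideal m (ideal_exp a n). Proof. exact: open_ideal_exp. Qed.
Let EI n := ideal_exp_ideal a n.
Let am := proper_sub_local noeth loc propera.

Lemma length_quot_expS n : exists2 l, length_quot (ideal_exp a n) (ideal_exp a n.+1) l &
  H n.+1 = (H n + l)%N.
Proof. exact (length_quot_colen noeth loc (EI n) (oH n.+1) (@ideal_expS _ a n)). Qed.

Lemma colen_gt0 : (0 < L)%N.
Proof.
rewrite lt0n; apply/eqP => /(colen_eq0 noeth loc oxy).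
exact: (lin2_local_not1 loc (am ax) (am ay)).
Qed.

Lemma ideal_exp_proper n : is_proper (ideal_exp a n.+1).
Proof.
split; first exact: EI.
by move=> /(@ideal_exp_le _ a 1 n.+1 isT); rewrite ideal_exp1 //; apply: propera.2.
Qed.

(* [c] is twice the second Hilbert coefficient. *)
Definition quadratic_colen (b c : int) n0 :=
  forall n, (n0 <= n)%N -> (H n)%:Z *+ 2 = L%:Z * n%:Z ^+ 2 + b * n%:Z + c.

Lemma quadratic_colen_ex : exists b c n0, quadratic_colen b c n0.
Proof.
have [n0 HP] := two_reduction_hilbert noeth loc mu mv uvreg propera oa xyred.
have [|b [c bc]] := @quadratic_of_second_difference (fun n => (H n)%:Z) L%:Z n0; last by exists b, c, n0.
by move=> n /HP; lia.
Qed.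

Variables (b c : int) (n0 : nat).
Hypothesis Hbc : quadratic_colen b c n0.

(** Two quadratic formulas for [2 H] valid for large [n] have the same constant term. The converse
    must also produce a numerator, which exists because the second difference of [l] vanishes
    eventually. *)
Lemma hilbert_coef_iff : hilbert_coef a 2 2 0 <-> c = 0.
Proof.
have H0 : H 0 = 0%N by exact: (colenT noeth loc).
split=> [[h [l lP hE] h0]|c0].
  have HS n : (H n.+1)%:Z = (H n)%:Z + (l n)%:Z.
    have [l' l'P ->] := length_quot_expS n.
    by rewrite (max_chain_inj (lP n) l'P) PoszD.
  have [L' [b' E]] := @hilbert_numerator_poly (fun n => (l n)%:Z) h (fun n => (H n)%:Z) hE (congr1 Posz H0) HS.
  rewrite -h0 mul0rn in E.
  apply: (@quadratic_const_inj L%:Z b c L' b' 0 (maxn n0 (size h))) => n.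
  by rewrite geq_max => /andP[n1 n2]; rewrite -E // Hbc.
have /choice[l lP] : forall n, exists l,
    length_quot (ideal_exp a n) (ideal_exp a n.+1) l /\ H n.+1 = (H n + l)%N.
  by move=> n; have [l lP lE] := length_quot_expS n; exists l.
have HS n : (H n.+1)%:Z = (H n)%:Z + (l n)%:Z by rewrite (lP n).2 PoszD.
have [|h hE] := @hilbert_numerator_ex (fun n => (l n)%:Z) n0.
  move=> n n0n; have E0 := Hbc n0n; have E1 := Hbc (leqW n0n).
  have E2 := Hbc (leqW (leqW n0n)); have E3 := Hbc (leqW (leqW (leqW n0n))).
  have l0 := HS n; have l1 := HS n.+1; have l2 := HS n.+2.
  move: E0 E1 E2 E3; rewrite !intS => E0 E1 E2 E3.
  have -> : (l n)%:Z = (H n.+1)%:Z - (H n)%:Z by rewrite l0; ring.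
  have -> : (l n.+1)%:Z = (H n.+2)%:Z - (H n.+1)%:Z by rewrite l1; ring.
  have -> : (l n.+2)%:Z = (H n.+3)%:Z - (H n.+2)%:Z by rewrite l2; ring.
  lia.
have [L' [b' E]] := @hilbert_numerator_poly (fun n => (l n)%:Z) h (fun n => (H n)%:Z) hE (congr1 Posz H0) HS.
exists h; first by exists l => // n; have [] := lP n.
have : c = (h^`N(2)).[1] *+ 2.
  apply: (@quadratic_const_inj L%:Z b c L' b' _ (maxn n0 (size h))) => n.
  by rewrite geq_max => /andP[n1 n2]; rewrite -E // Hbc.
by rewrite c0; lia.
Qed.

(** The second difference of [n -> H (k.+1 * n)] is the colength of [(X, Y)] by
    [two_reduction_hilbert], and [k.+1 ^ 2 * L] by the quadratic formula. *)
Lemma colen_power_reduction k X Y r : two_reduction (ideal_exp a k.+1) X Y r ->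
  colen (lin2 X Y setT) = (k.+1 * k.+1 * L)%N.
Proof.
move=> redXY.
have [n1 E] := two_reduction_hilbert noeth loc mu mv uvreg (ideal_exp_proper k) (oH k.+1) redXY.
have := E (n0 + n1)%N (leq_addl _ _); rewrite !ideal_exp_exp.
have le i : (n0 <= k.+1 * (i + (n0 + n1)))%N by nia.
have := Hbc (le 0%N); have := Hbc (le 1%N); have := Hbc (le 2); rewrite add0n !addSn add0n.
move: (n0 + n1)%N => n; move: (H (k.+1 * n)) (H (k.+1 * n.+1)) (H (k.+1 * n.+2)) => h0 h1 h2.
move: (colen (lin2 X Y setT)) => l E2 E1 E0 El.
suff : l%:Z *+ 2 = (k.+1 * k.+1 * L)%N%:Z *+ 2 by lia.
have -> : l%:Z *+ 2 = h2%:Z *+ 2 + h0%:Z *+ 2 - h1%:Z *+ 2 *+ 2 by lia.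
by rewrite E2 E1 E0 !PoszM !intS; ring.
Qed.

Lemma colen_lin2_exp k X Y r : two_reduction (ideal_exp a k.+1) X Y r -> (n0 <= k)%N ->
  (colen (lin2 X Y (ideal_exp a k.+1)))%:Z *+ 2 = (H (k.+1 * 2))%:Z *+ 2 + c.
Proof.
move=> redXY n0k; have oXY := two_reduction_open (oH k.+1) redXY.
have := colen_lin2 noeth loc (koszul_open mu mv uvreg oXY) oXY (oH k.+1).
have [qX qY _] := redXY.
have -> : ideal_quo (ideal_exp a k.+1) X `&` ideal_quo (ideal_exp a k.+1) Y = setT.
  by apply/seteqP; split=> // r' _; split; apply: (ideal_mulr _ (EI k.+1)).
rewrite (colenT noeth loc) (colen_power_reduction redXY) addn0 => ->.
have E1 := Hbc (leqW n0k); have n02 : (n0 <= k.+1 * 2)%N by nia.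
rewrite (Hbc n02) PoszD mulrnDl [(2 * _)%N]mulnC [X in _ + X *+ 2]PoszM.
have -> : (H k.+1)%:Z * 2%:Z *+ 2 = (H k.+1)%:Z *+ 2 *+ 2 by ring.
by rewrite E1 !PoszM !intS; ring.
Qed.

Lemma lin2_exp_sub k X Y r : two_reduction (ideal_exp a k.+1) X Y r ->
  lin2 X Y (ideal_exp a k.+1) `<=` ideal_exp a (k.+1 * 2).
Proof.
move=> [qX qY _]; rewrite muln2 -addnn.
by apply: lin2_min (EI _) _ _ => z; apply: ideal_expM.
Qed.

Lemma lin2_exp_eq_iff k X Y r : two_reduction (ideal_exp a k.+1) X Y r -> (n0 <= k)%N ->
  (lin2 X Y (ideal_exp a k.+1) = ideal_exp a (k.+1 * 2)) <-> c = 0.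
Proof.
move=> redXY n0k; have E := colen_lin2_exp redXY n0k; split=> [XYE|c0].
  by move: E; rewrite XYE; lia.
apply/esym/(colen_inj noeth loc (EI _)); last by move: E; rewrite c0; lia.
  exact: (open_lin2 (two_reduction_open (oH k.+1) redXY) (oH k.+1)).
exact: lin2_exp_sub redXY.
Qed.

(** Rules out reduction number 0. Otherwise [a ^ k.+1] is two-generated, so [H k.+1 = k.+1 ^ 2 * L];
    with [c = 0] this gives [L * k.+1 = b], impossible for [k >= |b|] because [L] is positive. *)
Lemma exp_not_own_reduction k : c = 0 -> (n0 + `|b| <= k)%N ->
  ~ is_minimal_reduction (ideal_exp a k.+1) (ideal_exp a k.+1).
Proof.
move=> c0 bk /(minimal_reduction_two noeth loc mu mv uvreg uvopen fsep (ideal_exp_proper k) (oH k.+1)).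
move=> [X [Y [r [redXY aXY]]]].
have := colen_power_reduction redXY; rewrite -aXY => HE.
have n0k : (n0 <= k.+1)%N by lia.
have := Hbc n0k; rewrite HE c0 addr0 !PoszM.
have := colen_gt0; move: L => l l0 E.
have {E}E : l%:Z * k.+1%:Z = b.
  have : k.+1%:Z != 0 by [].
  by move/mulfI; apply; move: E; rewrite intS => E; lia.
nia.
Qed.

Lemma reduction_number_iff :
  (exists N, forall n, (N <= n)%N -> reduction_number (ideal_exp a n) 1) <-> c = 0.
Proof.
split=> [[N /(_ (N + n0).+1)[|[C minC]]] //|c0].
- lia.
- move=> [CE _] _.
  have [X [Y [r [redXY CXY]]]] := minimal_reduction_two noeth loc mu mv uvreg uvopen fsep
    (ideal_exp_proper _) (oH _) minC.
  apply/(lin2_exp_eq_iff redXY (leq_addl _ _)).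
  have {}CE : ideal_mul C (ideal_exp (ideal_exp a (N + n0).+1) 1) =
    ideal_exp (ideal_exp a (N + n0).+1) 2 := CE.
  by rewrite ideal_exp1 // CXY ideal_mul_lin2 // ideal_exp_exp in CE.
exists (n0 + `|b|).+1 => -[//|k] bk; rewrite ltnS in bk.
have own := exp_not_own_reduction c0 bk.
have EE : is_ideal (ideal_exp a k.+1) := EI _.
have gt0 C j : is_minimal_reduction (ideal_exp a k.+1) C ->
    ideal_mul C (ideal_exp (ideal_exp a k.+1) j) = ideal_exp (ideal_exp a k.+1) j.+1 -> (1 <= j)%N.
  case: j => // minC CE; have CI : is_ideal C by case: minC => -[].
  have CaE : C = ideal_exp a k.+1 :=
    etrans (esym (ideal_exp1 CI)) (etrans CE (ideal_exp1 EE)).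
  by case: own; rewrite CaE in minC.
have redk := two_reduction_pow k aI xyred.
have mink := two_reduction_minimal noeth loc mu mv uvreg (ideal_exp_proper k) (oH _) redk.
split; last by move=> j [C minC [CE _]]; apply: gt0 CE.
exists (lin2 (x ^+ k.+1) (y ^+ k.+1) setT) => //.
split; last by move=> j; apply: gt0 mink.
suff : ideal_mul (lin2 (x ^+ k.+1) (y ^+ k.+1) setT) (ideal_exp (ideal_exp a k.+1) 1) =
  ideal_exp (ideal_exp a k.+1) 2 by [].
rewrite ideal_exp1 // ideal_mul_lin2 //.
have n0k : (n0 <= k)%N by lia.
by have [_ E] := lin2_exp_eq_iff redk n0k; rewrite E // ideal_exp_exp.
Qed.

(* For large [k], multiplication by [x * y] maps [a ^ (2 k) / J k] onto
   [a ^ (2 k + 2) / J k.+1], and both have length [c / 2]: it is injective. *)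
Lemma lin2_pow_saturated : exists N, forall k e z, (N <= k)%N -> ideal_exp a (k * 2) z ->
  J (k + e) ((x * y) ^+ e * z) -> J k z.
Proof.
pose N := (n0 + r0).+1; have JE k : (n0 < k)%N -> (colen (J k))%:Z *+ 2 = (H (k * 2))%:Z *+ 2 + c.
  by case: k => // k n0k; apply: colen_lin2_exp (two_reduction_pow k aI xyred) n0k.
have oJ k : open_ideal m (J k) by apply: open_lin2 (open_lin2_pow _ _ oxy) (oH k).
have JH k : J k `<=` ideal_exp a (k * 2).
  by apply: lin2_min => // z az; rewrite muln2 -addnn; apply: ideal_expM => //; apply: ideal_exp_pow.
have axy : ideal_exp a 2 (x * y) by apply: (@ideal_expM _ a 1 1); rewrite ideal_exp1.
have step k z : (N <= k)%N -> ideal_exp a (k * 2) z -> J k.+1 (x * y * z) -> J k z.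
  move=> Nk az Jz; pose K := [set z | ideal_exp a (k * 2) z /\ J k.+1 (x * y * z)].
  have KI : is_ideal K.
    split=> [|r s t [as_ Js] [at_ Jt]]; first by split; [apply: (EI _).1|rewrite mulr0; apply: (oJ _).1.1].
    by split; [apply: (EI _).2|rewrite mulrDr mulrCA; apply: (oJ _).1.2].
  have JK : J k `<=` K.
    move=> t Jt; split; first exact: JH.
    have [s [s' [as_ as' ->]]] := Jt; exists (y * s), (x * s').
    by split; [exact: ideal_expSr|exact: ideal_expSr|rewrite !exprS; ring].
  have oK := open_idealS (oJ k) KI JK.
  suff -> : J k = K by [].
  apply/esym/(colen_inj noeth loc KI (oJ k) JK).
  have KS : K `<=` ideal_exp a (k * 2) by move=> t [].
  have xyK t : ideal_exp a (k * 2) t -> J k.+1 (x * y * t) <-> K t.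
    by move=> at_; split=> [Jt|[]].
  have := colen_scale noeth loc (EI (k * 2)) (oJ k.+1) oK KS xyK.
  (* Surjectivity of the transition map: expanded along [x] and [y], a term of [a ^ (2 k + 2)]
     acquires [x ^+ k.+1], [y ^+ k.+1] or [x * y]. *)
  have -> : ideal_add (ideal_scale (x * y) (ideal_exp a (k * 2))) (J k.+1) = ideal_exp a (k.+1 * 2).
    apply/seteqP; split.
      apply: (ideal_add_min (EI (k.+1 * 2)) _ (JH k.+1)).
      by move=> _ [t at_ <-]; rewrite mulSn; apply: ideal_expM.
    move=> t; have [_ _ aE] := xyred.
    have -> : (k.+1 * 2 = (k * 2).+2)%N by lia.
    rewrite aE => [[s [s' [as_ as' ->]]]|]; last by rewrite /N in Nk; lia.
    have T z' := two_reduction_exp (N := k.+1) (z := z') xyred.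
    have [||p [p' [ap ap' ->]]] := T k.-1 0%N s.
    - by rewrite /N in Nk; lia.
    - by have -> : (k.+1 + k.-1 + 0).+1 = (k * 2).+1 by rewrite /N in Nk; lia.
    have [||p1 [p1' [ap1 ap1' ->]]] := T 0%N k.-1 s'.
    - by rewrite /N in Nk; lia.
    - by have -> : (k.+1 + 0 + k.-1).+1 = (k * 2).+1 by rewrite /N in Nk; lia.
    rewrite !addn0 in ap ap1'; rewrite !expr1 prednK in ap ap' ap1 ap1' *; last by rewrite /N in Nk; lia.
    have kE : (k.+1 + k.-1 = k * 2)%N by rewrite /N in Nk; lia.
    rewrite kE in ap' ap1.
    exists (x * y * (p' + p1)), (x ^+ k.+1 * p + y ^+ k.+1 * p1'); split.
    - by exists (p' + p1) => //; apply: idealD.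
    - by exists p, p1'.
    - by rewrite !exprS; ring.
  have := JE k.+1; have := JE k; rewrite /N in Nk; lia.
exists N => k e; elim: e k => [|e IHe] k z Nk az; first by rewrite addn0 mul1r.
rewrite exprSr -mulrA addnS -addSn => /IHe Jz; apply: step => //; apply: Jz; first exact: leqW.
by rewrite mulSn; apply: ideal_expM.
Qed.

End SecondCoefficient.

(** * Cech cohomology *)

Section CechPairs.
Variables (R : comNzRingType) (s : nat) (f : 'I_s -> R).
Implicit Types (S : {set 'I_s}) (i j l : 'I_s) (z w : {set 'I_s} -> R).

Lemma card2_lt S : #|S| = 2%N -> exists i j, (i < j)%N /\ S = [set i; j]%SET.
Proof.
move/eqP/cards2P => [i [j [ij ->]]]; have [lt|gt|e] := ltngtP i j.
- by exists i, j.
- by exists j, i; rewrite finset.setUC.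
- by rewrite (val_inj e) eqxx in ij.
Qed.

Lemma card3_lt S : #|S| = 3%N -> exists i j l, [/\ (i < j)%N, (j < l)%N & S = [set i; j; l]%SET].
Proof.
move=> S3; have /card_gt0P[i0 i0S] : (0 < #|S|)%N by rewrite S3.
have [i iS imin] := arg_minnP (fun i => i : nat) i0S.
have /card2_lt[j [l [jl SE]]] : #|(S :\ i)%SET| = 2%N by move: S3; rewrite (cardsD1 i) [i \in S]iS => -[].
exists i, j, l; split=> //; last by rewrite -(finset.setD1K iS) SE finset.setUA.
have : j \in (S :\ i)%SET by rewrite SE !inE eqxx.
by rewrite !inE ltn_neqAle eq_sym => /andP[-> /imin].
Qed.

Lemma cech_diff_pair k w i j : (i < j)%N ->
  cech_diff f k w [set i; j]%SET = f i ^+ k * w [set j]%SET - f j ^+ k * w [set i]%SET.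
Proof.
move=> ij; have nij : i != j by rewrite neq_ltn ij.
rewrite /cech_diff big_setU1 ?inE //= big_set1.
have -> : ([set i; j] :\ i)%SET = [set j]%SET.
  by apply/finset.setP => t; rewrite !inE; case: (eqVneq t i) => [->|] //=; rewrite (negbTE nij).
have -> : ([set i; j] :\ j)%SET = [set i]%SET.
  apply/finset.setP => t; rewrite !inE; case: (eqVneq t j) => [->|] /=; rewrite ?orbF //.
  by rewrite eq_sym (negbTE nij).
have -> : [set t in [set i; j]%SET | (t < i)%N]%SET = finset.set0.
  apply/finset.setP => t; rewrite !inE; apply/negbTE; rewrite negb_and -leqNgt.
  by case: eqP => [->|_] /=; [rewrite leqnn|case: eqP => [->|//]; rewrite ltnW].
have -> : [set t in [set i; j]%SET | (t < j)%N]%SET = [set i]%SET.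
  apply/finset.setP => t; rewrite !inE; case: eqP => [->|_] /=; first by rewrite ij.
  by case: eqP => [->|//]; rewrite ltnn.
by rewrite cards0 cards1 expr0 expr1; ring.
Qed.

Lemma cech_diff_triple k z i j l : (i < j)%N -> (j < l)%N ->
  cech_diff f k z [set i; j; l]%SET =
  f i ^+ k * z [set j; l]%SET - f j ^+ k * z [set i; l]%SET + f l ^+ k * z [set i; j]%SET.
Proof.
move=> ij jl; have il := ltn_trans ij jl.
have nij : i != j by rewrite neq_ltn ij.
have njl : j != l by rewrite neq_ltn jl.
have nil : i != l by rewrite neq_ltn il.
have SE : [set i; j; l]%SET = (i |: (j |: [set l]))%SET by rewrite finset.setUA.
rewrite /cech_diff SE big_setU1 ?inE ?negb_or ?nij //= big_setU1 ?inE //= big_set1.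
have [e1 e2 e3] : [/\ j == i = false, l == i = false & l == j = false].
  by split; rewrite eq_sym; apply/negbTE.
have [e4 e5 e6] : [/\ i == j = false, i == l = false & j == l = false].
  by split; apply/negbTE.
have D1 : ((i |: (j |: [set l])) :\ i)%SET = [set j; l]%SET.
  apply/finset.setP => t; rewrite !inE; case: (eqVneq t i) => [->|_] //=.
  by rewrite e4 e5.
have D2 : ((i |: (j |: [set l])) :\ j)%SET = [set i; l]%SET.
  apply/finset.setP => t; rewrite !inE; case: (eqVneq t j) => [->|_] //=.
  by rewrite e1 e6.
have D3 : ((i |: (j |: [set l])) :\ l)%SET = [set i; j]%SET.
  apply/finset.setP => t; rewrite !inE; case: (eqVneq t l) => [->|_] //=.
    by rewrite e2 e3.
  by rewrite orbF.
rewrite D1 D2 D3.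
have C1 : [set t in (i |: (j |: [set l]))%SET | (t < i)%N]%SET = finset.set0.
  apply/finset.setP => t; rewrite !inE; apply/negbTE/negP => /andP[/or3P[]/eqP->]; lia.
have C2 : [set t in (i |: (j |: [set l]))%SET | (t < j)%N]%SET = [set i]%SET.
  apply/finset.setP => t; rewrite !inE; case: (eqVneq t i) => [->|_] /=; first by rewrite ij.
  apply/negbTE/negP => /andP[/orP[]/eqP->]; lia.
have C3 : [set t in (i |: (j |: [set l]))%SET | (t < l)%N]%SET = [set i; j]%SET.
  apply/finset.setP => t; rewrite !inE; case: (eqVneq t i) => [->|_] /=; first by rewrite il.
  case: (eqVneq t j) => [->|_] /=; first by rewrite jl.
  apply/negbTE/negP => /andP[/eqP->]; lia.
rewrite C1 C2 C3 cards0 cards1 cards2 nij expr0 expr1.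
ring.
Qed.

Lemma cech_den_pair i j : i != j -> cech_den f [set i; j]%SET = f i * f j.
Proof. by move=> ij; rewrite /cech_den big_setU1 ?inE //= big_set1. Qed.

Lemma cech_den_triple i j l : (i < j)%N -> (j < l)%N ->
  cech_den f [set i; j; l]%SET = f i * f j * f l.
Proof.
move=> ij jl; have il := ltn_trans ij jl.
rewrite /cech_den -finset.setUA big_setU1 ?inE ?negb_or ?neq_ltn ?ij ?il //=.
by rewrite big_setU1 ?inE ?neq_ltn ?jl //= big_set1 mulrA.
Qed.

End CechPairs.

Section GradedCech.
Variables (R : comNzRingType) (H : int -> set R).
Hypothesis H0 : forall n, H n 0.
Hypothesis HD : forall n x y, H n x -> H n y -> H n (x + y).
Hypothesis HN : forall n x, H n x -> H n (- x).
Hypothesis HM : forall i j x y, H i x -> H j y -> H (i + j) (x * y).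
Hypothesis H1 : H 0 1.
Variables (s : nat) (f : 'I_s -> R) (x y : R).
Hypotheses (fH : forall i, H 1 (f i)) (xH : H 1 x) (yH : H 1 y).
(** With [fxy], a homogeneous form of equality up to radical of [(x, y)] and the ideal of the [f l],
    for all powers of the generators; one exponent serves all elements. *)
Hypothesis xyf : forall k, exists (m : nat) (p q : 'I_s -> R),
  [/\ forall l, H (m%:Z - k%:Z) (p l), forall l, H (m%:Z - k%:Z) (q l),
      x ^+ m = \sum_l p l * f l ^+ k & y ^+ m = \sum_l q l * f l ^+ k].
Hypothesis fxy : forall q, exists (M : nat) (g h : 'I_s -> R),
  [/\ forall i, H (M%:Z - q%:Z) (g i), forall i, H (M%:Z - q%:Z) (h i) &
      forall i, f i ^+ M = g i * x ^+ q + h i * y ^+ q].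

Lemma homog_mul i j d a b : H i a -> H j b -> d = i + j -> H d (a * b).
Proof. by move=> Ha Hb ->; apply: HM. Qed.

Lemma homog_pow a k : H 1 a -> H k%:Z (a ^+ k).
Proof.
move=> Ha; elim: k => [|k IHk]; first by rewrite expr0.
by rewrite exprS intS; apply: HM.
Qed.

Lemma homog_sum d (I : Type) (r : seq I) (F : I -> R) :
  (forall i, H d (F i)) -> H d (\sum_(i <- r) F i).
Proof. by move=> HF; elim/big_ind: _ => // a b; apply: HD. Qed.

(* The class of [z / (x * y) ^+ k] in the second Cech cohomology of [x, y] is zero. *)
Definition cech_pair_vanishing n := forall (k : nat) z, H (n + (k * 2)%:Z) z ->
  exists (e : nat) a b, [/\ H (n + (k + e)%:Z) a, H (n + (k + e)%:Z) b &
    (x * y) ^+ e * z = x ^+ (k + e) * a + y ^+ (k + e) * b].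

Lemma bound_exponents (T : finType) (P : T -> nat -> Prop) :
  (forall t, exists e, P t e) -> (forall t e e', (e <= e')%N -> P t e -> P t e') ->
  exists E, forall t, P t E.
Proof.
move=> /choice[e eP] Pmono; exists (\max_t e t) => t.
by apply: Pmono (eP t); apply: leq_bigmax.
Qed.

Lemma torsion_mono (d t : R) e e' : (e <= e')%N -> d ^+ e * t = 0 -> d ^+ e' * t = 0.
Proof. by move=> /subnK<-; rewrite exprD -mulrA => ->; rewrite mulr0. Qed.

(* A cocycle is glued from its restrictions to the loci where [x] and [y] are
   invertible: there it is a coboundary ([wx], [wy]) because the [f l] generate
   the unit ideal, and the difference of the two primitives is a Cech cocycle
   [u / (x y) ^+ _] for the pair [x, y]. *)
Lemma strict_cocycle_coboundary n k (Z : 'I_s -> 'I_s -> R) : cech_pair_vanishing n ->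
  (forall i j, H (n + (k * 2)%:Z) (Z i j)) ->
  (forall l i j, f i ^+ k * Z l j - f j ^+ k * Z l i = f l ^+ k * Z i j) ->
  exists (M : nat) (w : 'I_s -> R), (forall i, H (n + (k + M)%:Z) (w i)) /\
    forall i j, (f i * f j) ^+ M *
      (f i ^+ (k + M) * w j - f j ^+ (k + M) * w i - (f i * f j) ^+ M * Z i j) = 0.
Proof.
move=> van ZH Zcoc; have [m [p [p' [pH p'H xE yE]]]] := xyf k.
(* Since [x ^+ m = \sum_l p l * f l ^+ k] is a partition of unity once [x] is inverted,
   [wx / x ^+ m] is a primitive there; likewise [wy / y ^+ m]. *)
pose wx j := \sum_l p l * Z l j; pose wy j := \sum_l p' l * Z l j.
have wxE i j : f i ^+ k * wx j - f j ^+ k * wx i = x ^+ m * Z i j.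
  rewrite xE mulr_suml !mulr_sumr -sumrB; apply: eq_bigr => l _.
  by rewrite -mulrA -Zcoc; ring.
have wyE i j : f i ^+ k * wy j - f j ^+ k * wy i = y ^+ m * Z i j.
  rewrite yE mulr_suml !mulr_sumr -sumrB; apply: eq_bigr => l _.
  by rewrite -mulrA -Zcoc; ring.
have wxH j : H (n + m%:Z + k%:Z) (wx j).
  by apply: homog_sum => l; apply: homog_mul (pH l) (ZH l j) _; rewrite PoszM; ring.
have wyH j : H (n + m%:Z + k%:Z) (wy j).
  by apply: homog_sum => l; apply: homog_mul (p'H l) (ZH l j) _; rewrite PoszM; ring.
pose v i := y ^+ m * wx i - x ^+ m * wy i.
have vE i j : f i ^+ k * v j = f j ^+ k * v i.
  apply/subr0_eq; rewrite /v.
  have -> : f i ^+ k * (y ^+ m * wx j - x ^+ m * wy j) - f j ^+ k * (y ^+ m * wx i - x ^+ m * wy i) =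
    y ^+ m * (f i ^+ k * wx j - f j ^+ k * wx i) - x ^+ m * (f i ^+ k * wy j - f j ^+ k * wy i) by ring.
  by rewrite wxE wyE; ring.
(* The [v i / f i ^+ k] agree and glue to [u / x ^+ m]; the two primitives thus differ by the class
   of [u * y ^+ m / (x * y) ^+ (m * 2)]. *)
pose u := \sum_l p l * v l.
have uE i : f i ^+ k * u = x ^+ m * v i.
  rewrite xE mulr_sumr mulr_suml; apply: eq_bigr => l _.
  by rewrite mulrCA vE mulrA.
have vH i : H (n + (m * 2)%:Z + k%:Z) (v i).
  apply: HD; first by apply: homog_mul (homog_pow m yH) (wxH i) _; rewrite PoszM; ring.
  by apply/HN/(homog_mul (homog_pow m xH) (wyH i)); rewrite PoszM; ring.
have uH : H (n + (m * 3)%:Z) u.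
  by apply: homog_sum => l; apply: homog_mul (pH l) (vH l) _; rewrite !PoszM; ring.
have [|e [a [b [aH bH abE]]]] := van (m * 2)%N (u * y ^+ m).
  by apply: homog_mul uH (homog_pow m yH) _; rewrite !PoszM; ring.
pose q := (m * 2 + e)%N.
(* Corrected by [b] and [a], the primitives [X / x ^+ q] and [Y / y ^+ q] agree, and [fxy] glues
   them to [w / f ^+ M]. *)
pose X i := x ^+ (e + m) * wx i - f i ^+ k * b.
pose Y i := y ^+ (e + m) * wy i + f i ^+ k * a.
have XY i : y ^+ q * X i = x ^+ q * Y i.
  apply/subr0_eq.
  have -> : y ^+ q * X i - x ^+ q * Y i =
      (x * y) ^+ e * (y ^+ m * (x ^+ m * v i)) - f i ^+ k * (x ^+ q * a + y ^+ q * b).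
    by rewrite /X /Y /q /v exprMn !exprD !exprM; ring.
  by rewrite -abE -uE; ring.
have XH i : H (n + k%:Z + q%:Z) (X i).
  apply: HD; first by apply: homog_mul (homog_pow _ xH) (wxH i) _; rewrite /q !PoszD PoszM; ring.
  by apply/HN/(homog_mul (homog_pow k (fH i)) bH); rewrite /q !PoszD !PoszM; ring.
have YH i : H (n + k%:Z + q%:Z) (Y i).
  apply: HD; first by apply: homog_mul (homog_pow _ yH) (wyH i) _; rewrite /q !PoszD PoszM; ring.
  by apply: (homog_mul (homog_pow k (fH i)) aH); rewrite /q !PoszD !PoszM; ring.
have [M [g [h [gH hH fE]]]] := fxy q.
pose w i := g i * X i + h i * Y i.
have xw i : x ^+ q * w i = f i ^+ M * X i.
  have -> : x ^+ q * w i = g i * x ^+ q * X i + h i * (x ^+ q * Y i) by rewrite /w; ring.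
  by rewrite -XY fE; ring.
have yw i : y ^+ q * w i = f i ^+ M * Y i.
  have -> : y ^+ q * w i = g i * (y ^+ q * X i) + h i * y ^+ q * Y i by rewrite /w; ring.
  by rewrite XY fE; ring.
exists M, w; split=> [i|i j].
  apply: HD; first by apply: homog_mul (gH i) (XH i) _; rewrite PoszD; ring.
  by apply: homog_mul (hH i) (YH i) _; rewrite PoszD; ring.
set D := (X in _ * X).
have xD : x ^+ q * D = 0.
  have -> : x ^+ q * D = f i ^+ (k + M) * (x ^+ q * w j) - f j ^+ (k + M) * (x ^+ q * w i) -
      (f i * f j) ^+ M * (x ^+ q * Z i j) by rewrite /D; ring.
  rewrite !xw.
  have -> : x ^+ q * Z i j = f i ^+ k * X j - f j ^+ k * X i.
    have -> : f i ^+ k * X j - f j ^+ k * X i = x ^+ (e + m) * (f i ^+ k * wx j - f j ^+ k * wx i).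
      by rewrite /X; ring.
    by rewrite wxE mulrA -exprD /q; congr (_ ^+ _ * _); lia.
  by rewrite exprMn !exprD; ring.
have yD : y ^+ q * D = 0.
  have -> : y ^+ q * D = f i ^+ (k + M) * (y ^+ q * w j) - f j ^+ (k + M) * (y ^+ q * w i) -
      (f i * f j) ^+ M * (y ^+ q * Z i j) by rewrite /D; ring.
  rewrite !yw.
  have -> : y ^+ q * Z i j = f i ^+ k * Y j - f j ^+ k * Y i.
    have -> : f i ^+ k * Y j - f j ^+ k * Y i = y ^+ (e + m) * (f i ^+ k * wy j - f j ^+ k * wy i).
      by rewrite /Y; ring.
    by rewrite wyE mulrA -exprD /q; congr (_ ^+ _ * _); lia.
  by rewrite exprMn !exprD; ring.
rewrite exprMn fE.
have -> : (g i * x ^+ q + h i * y ^+ q) * f j ^+ M * D =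
  f j ^+ M * (g i * (x ^+ q * D) + h i * (y ^+ q * D)) by ring.
by rewrite xD yD !mulr0 addr0 mulr0.
Qed.

(* Conversely [u / (x y) ^+ k] is spread out to the cocycle with components
   [(g i * h j - g j * h i) * u], where [f i ^+ M = g i * x ^+ k + h i * y ^+ k]. *)
Lemma pair_vanishing_of_coboundary n k u :
  H (n + (k * 2)%:Z) u ->
  (forall M (g h : 'I_s -> R),
    (forall i, H (M%:Z - k%:Z) (g i)) -> (forall i, H (M%:Z - k%:Z) (h i)) ->
    (forall i, f i ^+ M = g i * x ^+ k + h i * y ^+ k) ->
    exists (e : nat) (w : 'I_s -> R), (forall i, H (n + (M + e)%:Z) (w i)) /\
    forall i j, (f i * f j) ^+ e * ((g i * h j - g j * h i) * u) =
      f i ^+ (M + e) * w j - f j ^+ (M + e) * w i) ->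
  exists (e : nat) a b, [/\ H (n + (k + e)%:Z) a, H (n + (k + e)%:Z) b &
    (x * y) ^+ e * u = x ^+ (k + e) * a + y ^+ (k + e) * b].
Proof.
move=> uH cob; have [M [g [h [gH hH fE]]]] := fxy k.
have [e [w [wH wE]]] := cob M g h gH hH fE.
have [m [p [p' [pH p'H xE yE]]]] := xyf (M + e).
(* Chosen so that the [w] terms cancel in [y ^+ k * X i - x ^+ k * Y i = f i ^+ (M + e) * u]; the
   [X i] and [Y i] glue to [a] and [b]. *)
pose X i := h i * u * f i ^+ e - x ^+ k * w i.
pose Y i := - (g i * u * f i ^+ e) - y ^+ k * w i.
have XE i j : f i ^+ (M + e) * X j = f j ^+ (M + e) * X i.
  apply/subr0_eq.
  have -> : f i ^+ (M + e) * X j - f j ^+ (M + e) * X i =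
      (f i * f j) ^+ e * u * (f i ^+ M * h j - f j ^+ M * h i) -
      x ^+ k * (f i ^+ (M + e) * w j - f j ^+ (M + e) * w i).
    by rewrite /X exprMn !exprD; ring.
  by rewrite -wE !fE; ring.
have YE i j : f i ^+ (M + e) * Y j = f j ^+ (M + e) * Y i.
  apply/subr0_eq.
  have -> : f i ^+ (M + e) * Y j - f j ^+ (M + e) * Y i =
      - ((f i * f j) ^+ e * u * (f i ^+ M * g j - f j ^+ M * g i)) -
      y ^+ k * (f i ^+ (M + e) * w j - f j ^+ (M + e) * w i).
    by rewrite /Y exprMn !exprD; ring.
  by rewrite -wE !fE; ring.
have XH i : H (n + (k + (M + e))%:Z) (X i).
  apply: HD.
    apply: homog_mul (HM (hH i) uH) (homog_pow e (fH i)) _.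
    by rewrite !PoszD PoszM; ring.
  by apply/HN/(homog_mul (homog_pow k xH) (wH i)); rewrite !PoszD; ring.
have YH i : H (n + (k + (M + e))%:Z) (Y i).
  apply: HD; apply: HN.
    apply: homog_mul (HM (gH i) uH) (homog_pow e (fH i)) _.
    by rewrite !PoszD PoszM; ring.
  by apply/(homog_mul (homog_pow k yH) (wH i)); rewrite !PoszD; ring.
pose a := \sum_l p l * X l; pose b := \sum_l p' l * Y l.
have aE i : f i ^+ (M + e) * a = x ^+ m * X i.
  rewrite xE mulr_sumr mulr_suml; apply: eq_bigr => l _.
  by rewrite mulrCA XE mulrA.
have bE i : f i ^+ (M + e) * b = y ^+ m * Y i.
  rewrite yE mulr_sumr mulr_suml; apply: eq_bigr => l _.
  by rewrite mulrCA YE mulrA.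
have aH : H (n + (k + m)%:Z) a.
  by apply: homog_sum => l; apply: homog_mul (pH l) (XH l) _; rewrite !PoszD; ring.
have bH : H (n + (k + m)%:Z) b.
  by apply: homog_sum => l; apply: homog_mul (p'H l) (YH l) _; rewrite !PoszD; ring.
(* The desired identity up to torsion: [B] is killed by every [f i ^+ (M + e)], hence by
   [x ^+ m]. *)
pose B := y ^+ (m + k) * a - x ^+ (m + k) * b - (x * y) ^+ m * u.
have fB i : f i ^+ (M + e) * B = 0.
  have -> : f i ^+ (M + e) * B = y ^+ (m + k) * (f i ^+ (M + e) * a) -
      x ^+ (m + k) * (f i ^+ (M + e) * b) - (x * y) ^+ m * u * f i ^+ (M + e) by rewrite /B; ring.
  by rewrite aE bE /X /Y [f i ^+ (M + e)]exprD fE exprMn !exprD; ring.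
have xB : x ^+ m * B = 0.
  by rewrite xE mulr_suml big1 // => l _; rewrite -mulrA fB mulr0.
exists (m * 2)%N, (- (y ^+ m * b)), (x ^+ m * a); split.
- by apply/HN/(homog_mul (homog_pow m yH) bH); rewrite !PoszD PoszM; ring.
- by apply/(homog_mul (homog_pow m xH) aH); rewrite !PoszD PoszM; ring.
apply/esym/subr0_eq; rewrite -(mulr0 (y ^+ m)) -xB /B !exprD !exprM exprMn; ring.
Qed.

Lemma cech_cohomology_pair n : cech_cohomology_neq0 H f 2 n <-> ~ cech_pair_vanishing n.
Proof.
split.
  move=> [k [z [zH zC nz]]] van; apply: nz.
  (* Extending all fractions by one common exponent [E] makes the cocycle identity hold in [R]
     itself. *)
  have [E EP] : exists E, forall S : {set 'I_s}, #|S| = 3%N ->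
      cech_den f S ^+ E * cech_diff f k z S = 0.
    apply: bound_exponents => [S|S e e' ee' SP /SP]; last exact: torsion_mono.
    have [/zC[e]|nS] := pselect (#|S| = 3%N); last by exists 0%N.
    by rewrite mulr0 subr0 expr0 mul1r => eE; exists e.
  pose K := (k + E)%N.
  pose zp (i j : 'I_s) := (f i * f j) ^+ E * z [set i; j]%SET.
  (* Antisymmetrized, so that the cocycle identity holds for all triples of indices and not only for
     increasing ones. *)
  pose Z (i j : 'I_s) := if (i < j)%N then zp i j else if (j < i)%N then - zp j i else 0.
  have Zlt (i j : 'I_s) : (i < j)%N -> Z i j = zp i j by rewrite /Z => ->.
  have Zanti i j : Z j i = - Z i j.
    by rewrite /Z; case: ltngtP => // _; rewrite ?opprK ?oppr0.
  have Zdiag i : Z i i = 0 by rewrite /Z ltnn.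
  have zpH (i j : 'I_s) : (i < j)%N -> H (n + (K * 2)%:Z) (zp i j).
    move=> ij; have /zH zS : #|[set i; j]%SET| = 2%N by rewrite cards2 neq_ltn ij.
    rewrite /zp exprMn; apply: homog_mul (HM (homog_pow E (fH i)) (homog_pow E (fH j))) zS _.
    by rewrite /K !PoszM PoszD; ring.
  have ZH i j : H (n + (K * 2)%:Z) (Z i j).
    by rewrite /Z; case: ltngtP => [/zpH //|/zpH/HN //|_]; apply: H0.
  pose T l i j := f l ^+ K * Z i j - f i ^+ K * Z l j + f j ^+ K * Z l i.
  have T0 (l i j : 'I_s) : (l < i)%N -> (i < j)%N -> T l i j = 0.
    move=> li ij; have lj := ltn_trans li ij.
    have S3 : #|[set l; i; j]%SET| = 3%N.
      by rewrite finset.setUC cardsU1 cards2 !inE negb_or !neq_ltn li ij lj !orbT.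
    have := EP _ S3; rewrite cech_den_triple // cech_diff_triple // => TE.
    by rewrite /T !Zlt // /zp /K -TE !exprD !exprMn; ring.
  have Tsw1 l i j : T i l j = - T l i j by rewrite /T (Zanti l i); ring.
  have Tsw2 l i j : T l j i = - T l i j by rewrite /T (Zanti i j); ring.
  have Tlt (l i j : 'I_s) : (i < j)%N -> T l i j = 0.
    move=> ij; have [li|il|/val_inj->] := ltngtP l i; first exact: T0.
      have [lj|jl|/val_inj->] := ltngtP l j.
      - by rewrite Tsw1 T0 ?oppr0.
      - by rewrite Tsw1 Tsw2 T0 ?oppr0.
      - by rewrite /T Zdiag (Zanti i j); ring.
    by rewrite /T Zdiag; ring.
  have Tall l i j : T l i j = 0.
    have [ij|ji|/val_inj->] := ltngtP i j; first exact: Tlt.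
      by rewrite Tsw2 Tlt ?oppr0.
    by rewrite /T Zdiag; ring.
  have [|M [w [wH wE]]] := strict_cocycle_coboundary van ZH.
    by move=> l i j; apply/subr0_eq; rewrite -[RHS]oppr0 -(Tall l i j) /T; ring.
  exists (K + M)%N, (fun S : {set 'I_s} => \sum_(i in S) w i); split=> [S /eqP/cards1P[i ->]|S /card2_lt[i [j [ij ->]]]].
    by rewrite big_set1 muln1.
  exists M; rewrite cech_diff_pair // !big_set1 cech_den_pair ?neq_ltn ?ij //.
  have := wE i j; rewrite Zlt // /zp /K => DE.
  rewrite -[RHS](mulr0 (- (f i * f j) ^+ k)) -DE ![(f i * f j) ^+ (_ + _)]exprD; ring.
move=> nvan; apply: contrapT => neq0; apply: nvan => k u uH.
apply: (pair_vanishing_of_coboundary uH) => M g h gH hH fE.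
pose zp i j := (g i * h j - g j * h i) * u.
pose z (S : {set 'I_s}) := \sum_(i in S) \sum_(j in S | (i < j)%N) zp i j.
have zE (i j : 'I_s) : (i < j)%N -> z [set i; j]%SET = zp i j.
  move=> ij; have nij : i != j by rewrite neq_ltn ij.
  rewrite /z big_setU1 ?inE //= big_set1.
  rewrite (big_pred1 j) => [|t]; last first.
    rewrite !inE; case: (eqVneq t j) => [->|_]; first by rewrite orbT ij.
    by rewrite orbF; case: eqP => //= ->; rewrite ltnn.
  rewrite big_pred0 ?addr0 // => t; rewrite !inE.
  by case: eqP => [->|_] /=; [rewrite ltnNge ltnW|case: eqP => [->|//]; rewrite ltnn].
have zpH i j : H (n + (M * 2)%:Z) (zp i j).
  apply: homog_mul (HD (HM (gH i) (hH j)) (HN (HM (gH j) (hH i)))) uH _.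
  by rewrite !PoszM; ring.
have [l [w [wH wE]]] : cech_coboundary H f 2 n M z.
  apply: contrapT => nz; apply: neq0; exists M, z; split=> // [S /card2_lt[i [j [ij ->]]]|].
    by rewrite zE.
  move=> S /card3_lt[i [j [l [ij jl ->]]]]; exists 0%N.
  rewrite cech_diff_triple // !zE ?(ltn_trans ij jl) // /zp !fE; ring.
have [E EP] : exists E, forall S : {set 'I_s}, #|S| = 2%N ->
    cech_den f S ^+ E * (cech_den f S ^+ l * z S - cech_den f S ^+ M * cech_diff f l w S) = 0.
  apply: bound_exponents => [S|S e e' ee' SP /SP]; last exact: torsion_mono.
  have [/wE[e eE]|nS] := pselect (#|S| = 2%N); last by exists 0%N.
  by exists e.
pose w' i := f i ^+ (E + M) * w [set i]%SET.
exists (E + l)%N, w'; split=> [i|].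
  have /wH wi : #|[set i]%SET| = 1%N by rewrite cards1.
  by apply: homog_mul (homog_pow _ (fH i)) wi _; rewrite muln1 !PoszD; ring.
have lt (i j : 'I_s) : (i < j)%N -> (f i * f j) ^+ (E + l) * zp i j =
    f i ^+ (M + (E + l)) * w' j - f j ^+ (M + (E + l)) * w' i.
  move=> ij; have /EP : #|[set i; j]%SET| = 2%N by rewrite cards2 neq_ltn ij.
  rewrite cech_diff_pair // cech_den_pair ?neq_ltn ?ij // zE // => e.
  by apply/subr0_eq; rewrite -e /w' !exprD !exprMn; ring.
move=> i j; have [ij|ji|/val_inj->] := ltngtP i j; first exact: lt.
  have -> : (g i * h j - g j * h i) * u = - zp j i by rewrite /zp; ring.
  by rewrite mulrN [f i * f j]mulrC lt //; ring.
by rewrite !subrr mul0r mulr0.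
Qed.

End GradedCech.

(** * The associated graded ring *)

Section AssociatedGradedElements.
Variables (A : comNzRingType) (a : idealr A).
Local Notation pow := (ideal_exp [set` a]).
Local Notation G := (gr a).

Lemma gr_class_eq (p q : rees a) : gr_class p = gr_class q <->
  forall i, pow i.+1 ((rees_val p)`_i - (rees_val q)`_i).
Proof.
split=> [/eqP|E].
  rewrite /gr_class -Quotient.idealrBE => /asboolP + i => /(_ i).
  by rewrite rmorphB coefB.
apply/eqP; rewrite /gr_class -Quotient.idealrBE; apply/asboolP => i.
by rewrite rmorphB coefB.
Qed.

Lemma gr_classD (p q : rees a) : gr_class (p + q) = gr_class p + gr_class q.
Proof. by rewrite /gr_class !piE. Qed.

Lemma gr_classN (p : rees a) : gr_class (- p) = - gr_class p.
Proof. by rewrite /gr_class !piE. Qed.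

Lemma gr_classM (p q : rees a) : gr_class (p * q) = gr_class p * gr_class q.
Proof. by rewrite /gr_class !piE. Qed.

Lemma gr_class0 : gr_class (0 : rees a) = 0.
Proof. by rewrite /gr_class !piE. Qed.

Lemma gr_class1 : gr_class (1 : rees a) = 1.
Proof. by rewrite /gr_class !piE. Qed.

Lemma gr_class_surj (g : G) : exists p : rees a, g = gr_class p.
Proof. by exists (repr g); rewrite /gr_class reprK. Qed.

Lemma gr_homog0 n : gr_homog n (0 : G).
Proof. by exists 0 => [i _ /=|]; rewrite ?coef0 ?gr_class0. Qed.

Lemma gr_homogD n (g h : G) : gr_homog n g -> gr_homog n h -> gr_homog n (g + h).
Proof.
move=> [p pn <-] [q qn <-]; exists (p + q) => [i ni|]; last by rewrite gr_classD.
by rewrite rmorphD coefD pn // qn // addr0.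
Qed.

Lemma gr_homogN n (g : G) : gr_homog n g -> gr_homog n (- g).
Proof.
move=> [p pn <-]; exists (- p) => [i ni|]; last by rewrite gr_classN.
by rewrite rmorphN coefN pn // oppr0.
Qed.

Lemma gr_homogM i j (g h : G) : gr_homog i g -> gr_homog j h -> gr_homog (i + j) (g * h).
Proof.
move=> [p pn <-] [q qn <-]; exists (p * q) => [k nk|]; last by rewrite gr_classM.
rewrite rmorphM coefM big1 // => l _.
have [li|nli] := eqVneq (l : nat)%:Z i; last by rewrite pn ?mul0r.
have [lj|nlj] := eqVneq (k - l)%N%:Z j; last by rewrite qn ?mulr0.
case/eqP: nk; rewrite -li -lj -PoszD subnKC //.
by rewrite -ltnS.
Qed.

Lemma gr_homog1 : gr_homog 0 (1 : G).
Proof.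
exists 1 => [[|i] //= ni|]; last exact: gr_class1.
by rewrite coef1.
Qed.

(* The class in degree [n] of [x] in [a ^ n], with value [0] if [x] is not in
   [a ^ n]. *)
Definition gr_elt n x : G :=
  if pselect (pow n x) is left ax then gr_class (rees_monom ax) else 0.

Lemma gr_eltE n x (ax : pow n x) : gr_elt n x = gr_class (rees_monom ax).
Proof.
rewrite /gr_elt; case: pselect => // ax'; apply/gr_class_eq => i /=.
by rewrite subrr; apply: (ideal_exp_ideal [set` a] i.+1).1.
Qed.

Lemma gr_elt_homog n x : gr_homog n%:Z (gr_elt n x).
Proof.
rewrite /gr_elt; case: pselect => [ax|_]; last exact: gr_homog0.
exists (rees_monom ax) => // i ni /=; rewrite coefZ coefXn.
have [e|_] := eqVneq i n; last by rewrite mulr0.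
by rewrite e eqxx in ni.
Qed.

Lemma gr_elt_eq n x y : pow n x -> pow n y -> gr_elt n x = gr_elt n y <-> pow n.+1 (x - y).
Proof.
move=> ax ay; rewrite (gr_eltE ax) (gr_eltE ay) gr_class_eq; split=> [/(_ n)|xy i].
  by rewrite /= !coefZ coefXn eqxx !mulr1.
rewrite /= !coefZ coefXn; have [->|_] := eqVneq; first by rewrite !mulr1.
by rewrite !mulr0 subr0; apply: (ideal_exp_ideal [set` a] i.+1).1.
Qed.

Lemma gr_eltD n x y : pow n x -> pow n y -> gr_elt n (x + y) = gr_elt n x + gr_elt n y.
Proof.
move=> ax ay; have axy := idealD (ideal_exp_ideal _ _) ax ay.
rewrite (gr_eltE ax) (gr_eltE ay) (gr_eltE axy) -gr_classD; congr gr_class.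
by apply: val_inj; rewrite /= scalerDl.
Qed.

Lemma gr_eltM i j x y : pow i x -> pow j y -> gr_elt (i + j) (x * y) = gr_elt i x * gr_elt j y.
Proof.
move=> ax ay; have axy := ideal_expM ax ay.
rewrite (gr_eltE ax) (gr_eltE ay) (gr_eltE axy) -gr_classM; congr gr_class.
by apply: val_inj; rewrite /= -scalerAl -scalerAr scalerA exprD.
Qed.

Lemma gr_elt0 n : gr_elt n 0 = 0.
Proof.
have a0 : pow n 0 := (ideal_exp_ideal _ _).1.
rewrite (gr_eltE a0) -gr_class0; congr gr_class.
by apply: val_inj; rewrite /= scale0r.
Qed.

Lemma gr_elt1 : gr_elt 0 1 = 1.
Proof.
have a1 : pow 0 1 by [].
rewrite (gr_eltE a1) -gr_class1; congr gr_class.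
by apply: val_inj; rewrite /= expr0 scale1r.
Qed.

Lemma gr_eltX x k : pow 1 x -> gr_elt 1 x ^+ k = gr_elt k (x ^+ k).
Proof.
move=> ax; have xk j : pow j (x ^+ j).
  elim: j => // j IHj; rewrite exprS -[j.+1]add1n; exact: ideal_expM.
elim: k => [|k IHk]; first by rewrite !expr0 gr_elt1.
by rewrite !exprS IHk -gr_eltM.
Qed.

Lemma gr_homog_elt n (g : G) : gr_homog n%:Z g -> exists2 x, pow n x & g = gr_elt n x.
Proof.
move=> [p pn <-]; exists (rees_val p)`_n; first exact: reesP.
rewrite (gr_eltE (reesP p n)); congr gr_class; apply: val_inj; apply/polyP => i /=.
rewrite coefZ coefXn; have [->|ni] := eqVneq; first by rewrite mulr1.
by rewrite mulr0 pn.
Qed.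

Lemma gr_class_sum (p : rees a) :
  gr_class p = \sum_(i < size (rees_val p)) gr_elt i (rees_val p)`_i.
Proof.
have -> : \sum_(i < size (rees_val p)) gr_elt i (rees_val p)`_i =
    gr_class (\sum_(i < size (rees_val p)) rees_monom (reesP p i)).
  elim/big_rec2: _ => [|i q g _ ->]; first by rewrite gr_class0.
  by rewrite gr_classD -gr_eltE.
congr gr_class; apply: val_inj; rewrite /= raddf_sum /= -[LHS]coefK poly_def.
by [].
Qed.

Lemma gr_plus_ideal : is_ideal (@gr_plus A a).
Proof.
split=> [|r _ _ [p p0 <-] [q q0 <-]]; first by exists 0 => /=; rewrite ?coef0 ?gr_class0.
have [r' ->] := gr_class_surj r; exists (r' * p + q); last by rewrite gr_classD gr_classM.
by rewrite /= coefD q0 addr0 coefM big_ord1 subn0 p0 mulr0.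
Qed.

Lemma gr_plus_elt x : [set` a] x -> gr_plus (gr_elt 1 x : G).
Proof.
move=> ax; have ax1 : pow 1 x by rewrite (ideal_exp1 (idealr_is_ideal a)).
rewrite (gr_eltE ax1); exists (rees_monom ax1) => //=.
by rewrite coefZ coefXn mulr0.
Qed.

(** Supplies the family [f] required by [local_cohomology_neq0]: the initial forms of generators of
    [a]. *)
Lemma gr_plus_generators : noetherian A -> exists n (f : 'I_n -> G),
  (forall i, gr_homog 1 (f i)) /\ @gr_plus A a = ideal_gen (range f).
Proof.
move=> noeth; have [s sE] := noeth _ (idealr_is_ideal a).
pose f (i : 'I_(size s)) := gr_elt 1 s`_i; exists (size s), f.
split=> [i|]; first exact: gr_elt_homog.
have GI := ideal_gen_ideal (range f).
apply/seteqP; split; last first.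
  apply: (ideal_gen_min gr_plus_ideal) => _ [i _ <-]; apply: gr_plus_elt.
  by rewrite sE; apply: sub_ideal_gen; apply: mem_nth.
move=> _ [p p0 <-]; rewrite gr_class_sum; apply: (ideal_sum _ GI) => -[[|i] ip] _ /=.
  by rewrite p0 gr_elt0; apply: GI.1.
set x := (rees_val p)`_i.+1; have ax : pow i.+1 x := reesP p i.+1.
have EI := ideal_exp_ideal [set` a].
suff [] : [set x | pow i.+1 x /\ ideal_gen (range f) (gr_elt i.+1 x)] x by [].
have KI : is_ideal [set x | pow i.+1 x /\ ideal_gen (range f) (gr_elt i.+1 x)].
  split=> [|r y z [ay Iy] [az Iz]]; first by split; [apply: (EI _).1|rewrite gr_elt0; apply: GI.1].
  have ary : pow i.+1 (r * y) := idealMl r (EI _) ay.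
  split; first exact: (EI _).2.
  rewrite gr_eltD //; apply: (idealD GI) => //.
  have -> : gr_elt i.+1 (r * y) = gr_elt 0 r * gr_elt i.+1 y by rewrite -gr_eltM.
  exact: (idealMl _ GI).
apply: (ideal_mul_min KI _ ax) => y z sy az; rewrite sE in sy.
have LI : is_ideal [set y | [set` a] y /\ ideal_gen (range f) (gr_elt i.+1 (y * z))].
  split=> [|r t w [at_ It] [aw Iw]].
    by split; [apply: (idealr_is_ideal a).1|rewrite mul0r gr_elt0; apply: GI.1].
  have at1 : pow i.+1 (t * z) by apply: ideal_expSr.
  have aw1 : pow i.+1 (w * z) by apply: ideal_expSr.
  have art : pow i.+1 (r * (t * z)) := idealMl r (EI _) at1.
  split; first exact: (idealr_is_ideal a).2.
  rewrite mulrDl -mulrA gr_eltD //; apply: (idealD GI) => //.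
  have -> : gr_elt i.+1 (r * (t * z)) = gr_elt 0 r * gr_elt i.+1 (t * z) by rewrite -gr_eltM.
  exact: (idealMl _ GI).
have [ay Iyz] : [set y | [set` a] y /\ ideal_gen (range f) (gr_elt i.+1 (y * z))] y.
  move: y sy; apply: (ideal_gen_min LI) => y sy; split; first by rewrite sE; apply: sub_ideal_gen.
  have ay : pow 1 y by rewrite (ideal_exp1 (idealr_is_ideal a)) sE; apply: sub_ideal_gen.
  rewrite -[i.+1]add1n gr_eltM // mulrC; apply: (idealMl _ GI); apply: sub_ideal_gen.
  have ys : (index y s < size s)%N by rewrite index_mem.
  by exists (Ordinal ys) => //; rewrite /f /= nth_index.
split; last exact: Iyz.
exact: ideal_expSr.
Qed.

End AssociatedGradedElements.

Section PowerExpansion.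
Variables (R : comNzRingType) (H : int -> set R).
Hypothesis H0 : forall n, H n 0.
Hypothesis HD : forall n x y, H n x -> H n y -> H n (x + y).
Hypothesis HM : forall i j x y, H i x -> H j y -> H (i + j) (x * y).
Hypothesis H1 : H 0 1.
Variables (s : nat) (f : 'I_s -> R).
Hypothesis fH : forall i, H 1 (f i).

(** Each term of the binomial expansion of [(c l0 * f l0 + v) ^+ (m + k)] contains [v ^+ m], covered
    by induction, or [f l0 ^+ k]. *)
Lemma power_expansion (c : 'I_s -> R) (r : seq 'I_s) k : (forall i, H 0 (c i)) ->
  exists (m : nat) (p : 'I_s -> R), (forall l, H (m%:Z - k%:Z) (p l)) /\
    (\sum_(l <- r) c l * f l) ^+ m = \sum_l p l * f l ^+ k.
Proof.
move=> cH; elim: r => [|l0 r [m [p [pH pE]]]].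
  exists 1%N, (fun=> 0); split=> [l|]; first exact: H0.
  by rewrite big_nil expr1 big1 // => l _; rewrite mul0r.
set v := \sum_(l <- r) c l * f l in pE.
have vH : H 1 v.
  by rewrite /v; elim/big_ind: _ => // [? ?|l _]; [apply: HD|rewrite -[1]add0r; apply: HM].
have bH : H 1 (c l0 * f l0) by rewrite -[1]add0r; apply: HM.
pose B := [set z | exists p : 'I_s -> R, (forall l, H m%:Z (p l)) /\ z = \sum_l p l * f l ^+ k].
suff [p' [p'H p'E]] : B ((\sum_(l <- l0 :: r) c l * f l) ^+ (m + k)).
  by exists (m + k)%N, p'; split=> // l; rewrite PoszD addrK.
have BD z t : B z -> B t -> B (z + t).
  move=> [q [qH ->]] [q' [q'H ->]]; exists (fun l => q l + q' l).
  by split=> [l|]; [apply: HD|rewrite -big_split; apply: eq_bigr => l _; rewrite mulrDl].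
have B0 : B 0.
  by exists (fun=> 0); split=> [l|]; [apply: H0|rewrite big1 // => l _; rewrite mul0r].
rewrite big_cons -/v exprDn; elim/big_ind: _ => // i _.
have BMn z j : B z -> B (z *+ j) by move=> Bz; elim: j => // j IHj; rewrite mulrS; apply: BD.
apply: BMn; have [mi|im] := leqP m i.
  exists (fun l => (c l0 * f l0) ^+ (m + k - i) * v ^+ (i - m) * p l); split=> [l|].
    apply: homog_mul (HM (homog_pow HM H1 _ bH) (homog_pow HM H1 _ vH)) (pH l) _ => //.
    by have := ltn_ord i; lia.
  have -> : v ^+ i = v ^+ (i - m) * v ^+ m by rewrite -exprD subnK.
  rewrite pE mulrA mulr_sumr.
  by apply: eq_bigr => l _; rewrite !mulrA.
exists (fun l => if l == l0 then c l0 ^+ (m + k - i) * f l0 ^+ (m - i) * v ^+ i else 0); split=> [l|].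
  case: eqP => [_|_]; last exact: H0.
  have cX j : H 0 (c l0 ^+ j).
    by elim: j => // j IHj; rewrite exprS -[0]add0r; apply: HM.
  apply: homog_mul (HM (cX _) (homog_pow HM H1 _ (fH l0))) (homog_pow HM H1 _ vH) _ => //.
  by lia.
rewrite (bigD1 l0) //= eqxx big1 ?addr0 => [|l /negbTE->]; last by rewrite mul0r.
have -> : (m + k - i = (m - i) + k)%N by lia.
by rewrite exprMn [f l0 ^+ (_ + _)]exprD; ring.
Qed.

End PowerExpansion.

Lemma ideal_gen_range (R : comNzRingType) s (f : 'I_s -> R) x :
  ideal_gen (range f) x -> exists c : 'I_s -> R, x = \sum_l c l * f l.
Proof.
move: x; apply: ideal_gen_min => [|_ [i _ <-]].
  split=> [|r _ _ [c ->] [d ->]]; first by exists (fun=> 0); rewrite big1 // => l _; rewrite mul0r.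
  exists (fun l => r * c l + d l); rewrite mulr_sumr -big_split.
  by apply: eq_bigr => l _; rewrite mulrDl mulrA.
exists (fun l => (l == i)%:R); rewrite (bigD1 i) //= eqxx mul1r big1 ?addr0 //.
by move=> l /negbTE->; rewrite mul0r.
Qed.

(** * Vanishing of graded local cohomology in terms of the initial forms of [x] and [y] *)

Section CechReduction.
Variables (A : comNzRingType) (a : idealr A) (x y : A) (r0 : nat).
Hypothesis xyred : two_reduction [set` a] x y r0.
Local Notation pow := (ideal_exp [set` a]).
Local Notation G := (gr a).
Local Notation xb := (gr_elt a 1 x).
Local Notation yb := (gr_elt a 1 y).

Let aI : is_ideal [set` a] := idealr_is_ideal a.
Let EI n : is_ideal (pow n) := ideal_exp_ideal _ n.
Let ax : pow 1 x. Proof. by rewrite ideal_exp1 //; case: xyred. Qed.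
Let ay : pow 1 y. Proof. by rewrite ideal_exp1 //; case: xyred. Qed.
Let pown n z : pow 1 z -> pow n (z ^+ n).
Proof. by rewrite ideal_exp1 //; apply: ideal_exp_pow. Qed.

(** The coefficients expressing the initial form of [z] by [f] may have mixed degrees; comparing
    degree 1 leaves only their degree 0 parts, as [power_expansion] demands. *)
Lemma gr_elt_expansion s (f : 'I_s -> G) z k : (forall i, gr_homog 1 (f i)) ->
  @gr_plus A a = ideal_gen (range f) -> [set` a] z ->
  exists (m : nat) (p : 'I_s -> G), (forall l, gr_homog (m%:Z - k%:Z) (p l)) /\
    gr_elt a 1 z ^+ m = \sum_l p l * f l ^+ k.
Proof.
move=> fH genf az; have := gr_plus_elt az; rewrite genf => /ideal_gen_range[c cE].
have az1 : pow 1 z by rewrite ideal_exp1.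
have /choice[F FP] : forall l, exists F, pow 1 F /\ f l = gr_elt a 1 F.
  by move=> l; have [F F1 FE] := gr_homog_elt (fH l); exists F.
have /choice[p pE] := fun l => gr_class_surj (c l).
pose c0 l := (rees_val (p l))`_0.
have sum0 : gr_elt a 1 z = \sum_(l <- enum 'I_s) gr_elt a 0 (c0 l) * f l.
  rewrite big_enum /=.
  have EF : gr_elt a 1 (\sum_l c0 l * F l) = \sum_l gr_elt a 0 (c0 l) * f l.
    pose Q (b : A) (g : G) := pow 1 b /\ gr_elt a 1 b = g.
    suff [] : Q (\sum_l c0 l * F l) (\sum_l gr_elt a 0 (c0 l) * f l) by [].
    elim/big_rec2: _ => [|l g b _ [bg <-]]; first by split; [apply: (EI 1).1|apply: gr_elt0].
    have cF : pow 1 (c0 l * F l) by apply: (idealMl _ (EI 1)); apply: (FP l).1.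
    by split; [apply: (idealD (EI 1))|rewrite gr_eltD // (FP l).2 -gr_eltM //; apply: (FP l).1].
  rewrite -EF; apply/gr_elt_eq => //.
    by apply: (ideal_sum _ (EI 1)) => l _; apply: (idealMl _ (EI 1)); apply: (FP l).1.
  have : gr_class (rees_monom az1) = gr_class (\sum_l p l * rees_monom (FP l).1).
    rewrite -gr_eltE cE.
    elim/big_rec2: _ => [|l q g _ ->]; first by rewrite gr_class0.
    by rewrite gr_classD gr_classM -pE -gr_eltE (FP l).2.
  move=> /gr_class_eq/(_ 1%N) /=; rewrite coefZ coefXn eqxx mulr1.
  rewrite raddf_sum /= coef_sum; congr (pow 2 (_ - _)).
  apply: eq_bigr => l _; rewrite /= coefM !big_ord_recl big_ord0 /= !coefZ !coefXn /=.
  by rewrite mulr1 mulr0 mulr0 !addr0.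
rewrite sum0; apply: power_expansion => //.
- exact: gr_homog0.
- exact: gr_homogD.
- exact: gr_homogM.
- exact: gr_homog1.
- by move=> i; apply: gr_elt_homog.
Qed.

Local Notation van n := (cech_pair_vanishing (@gr_homog A a) xb yb n).

Lemma gr_cech_pair s (f : 'I_s -> G) n : (forall i, gr_homog 1 (f i)) ->
  @gr_plus A a = ideal_gen (range f) ->
  cech_cohomology_neq0 (@gr_homog A a) f 2 n <-> ~ van n.
Proof.
move=> fH genf; apply: cech_cohomology_pair => //.
- exact: gr_homog0.
- exact: gr_homogD.
- exact: gr_homogN.
- exact: gr_homogM.
- exact: gr_homog1.
- exact: gr_elt_homog.
- exact: gr_elt_homog.
- move=> k; have [ax' ay' _] := xyred.
  have [mx [p [pH pE]]] := gr_elt_expansion k fH genf ax'.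
  have [my [q [qH qE]]] := gr_elt_expansion k fH genf ay'.
  exists (mx + my)%N, (fun l => xb ^+ my * p l), (fun l => yb ^+ mx * q l); split.
  + move=> l; apply: (homog_mul (@gr_homogM A a) (homog_pow (@gr_homogM A a) (gr_homog1 a) my _) (pH l)).
      exact: gr_elt_homog.
    by rewrite PoszD; ring.
  + move=> l; apply: (homog_mul (@gr_homogM A a) (homog_pow (@gr_homogM A a) (gr_homog1 a) mx _) (qH l)).
      exact: gr_elt_homog.
    by rewrite PoszD; ring.
  + by rewrite addnC exprD pE mulr_sumr; apply: eq_bigr => l _; rewrite mulrA.
  + by rewrite exprD qE mulr_sumr; apply: eq_bigr => l _; rewrite mulrA.
(* [two_reduction_exp] only yields exponents [q.+1]; exponent 0 takes [g = 1] and [h = 0]. *)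
move=> [|q].
  exists 0%N, (fun=> 1), (fun=> 0); split=> i; [exact: gr_homog1|exact: gr_homog0|].
  by rewrite !expr0; ring.
have /choice[F FP] : forall l, exists F, pow 1 F /\ f l = gr_elt a 1 F.
  by move=> l; have [F F1 FE] := gr_homog_elt (fH l); exists F.
have /choice[gh ghP] : forall i, exists gh : A * A, [/\ pow (r0 + q) gh.1, pow (r0 + q) gh.2 &
    F i ^+ (r0 + q + q).+1 = x ^+ q.+1 * gh.1 + y ^+ q.+1 * gh.2].
  move=> i; have [g [h [ag ah E]]] := two_reduction_exp (i := q) (j := q) xyred (leqnn r0) (pown _ (FP i).1).
  by exists (g, h).
exists (r0 + q + q).+1, (fun i => gr_elt a (r0 + q) (gh i).1), (fun i => gr_elt a (r0 + q) (gh i).2).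
have degE : (r0 + q + q).+1%:Z - q.+1%:Z = (r0 + q)%N%:Z by lia.
split=> i; rewrite ?degE; [exact: gr_elt_homog|exact: gr_elt_homog|].
have [ag ah E] := ghP i.
have a1 := ideal_expM ag (pown q.+1 ax); have a2 := ideal_expM ah (pown q.+1 ay).
rewrite (FP i).2 gr_eltX; last exact: (FP i).1.
rewrite !gr_eltX // -(gr_eltM ag (pown q.+1 ax)) -(gr_eltM ah (pown q.+1 ay)) -gr_eltD //.
by rewrite addnS E [(gh i).1 * _]mulrC [(gh i).2 * _]mulrC.
Qed.

(** Multiplying by [(x * y) ^+ n0] raises [k] to [K >= n0], and for [n >= 0] one has
    [a ^ (n + 2 K) = a ^ n a ^ (2 K)], to which the hypothesis applies. *)
Lemma vanishing_of_power_equality n0 :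
  (forall k, (n0 <= k)%N -> pow (k * 2) `<=` lin2 (x ^+ k) (y ^+ k) (pow k)) ->
  forall n : int, 0 <= n -> van n.
Proof.
move=> powE n n_ge0 k z; case: n n_ge0 => // n _; rewrite -PoszD => /gr_homog_elt[b ab ->].
have axy e : pow (e * 2) ((x * y) ^+ e).
  by rewrite muln2 -addnn exprMn; apply: ideal_expM; apply: pown.
pose K := (k + n0)%N.
have sub : pow (n + K * 2) `<=` lin2 (x ^+ K) (y ^+ K) (pow (n + K)).
  rewrite ideal_expD; have LI := lin2_ideal (x ^+ K) (y ^+ K) (EI (n + K)).
  apply: (ideal_mul_min LI) => s t as_ /(powE _ (leq_addl _ _))[p [q [ap aq ->]]].
  by exists (s * p), (s * q); split; [exact: ideal_expM|exact: ideal_expM|ring].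
have bxy : pow (n + K * 2) ((x * y) ^+ n0 * b).
  have -> : (n + K * 2 = n0 * 2 + (n + k * 2))%N by rewrite /K; lia.
  exact: ideal_expM.
have [s [t [as_ at_ E]]] := sub _ bxy.
exists n0, (gr_elt a (n + K) s), (gr_elt a (n + K) t).
rewrite -PoszD -/K; split; [exact: gr_elt_homog|exact: gr_elt_homog|].
have a1 := ideal_expM (pown K ax) as_; have a2 := ideal_expM (pown K ay) at_.
rewrite exprMn !gr_eltX // -(gr_eltM (pown n0 ax) (pown n0 ay)).
rewrite -gr_eltM //; last exact: (ideal_expM (pown n0 ax) (pown n0 ay)).
rewrite -(gr_eltM (pown K ax) as_) -(gr_eltM (pown K ay) at_) -gr_eltD //.
rewrite -exprMn E; congr gr_elt; rewrite /K; lia.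
Qed.

(** Degrees are written [N - 2], so that natural [N] covers all degrees from -2 on; denominators
    [(x y) ^ (k + 2)] then put numerators in degree [N + 2 k + 2]. *)
Lemma vanishing_lift N k z : van (N%:Z - 2) -> pow (N + k * 2 + 2) z ->
  exists e s t, [/\ pow (N + k + e) s, pow (N + k + e) t &
    pow (N + k * 2 + e * 2 + 3) ((x * y) ^+ e * z - (x ^+ (k + 2 + e) * s + y ^+ (k + 2 + e) * t))].
Proof.
move=> vanN az.
have degE : N%:Z - 2 + ((k + 2) * 2)%N%:Z = (N + k * 2 + 2)%N%:Z by lia.
have [|e [g [h [+ + E]]]] := vanN (k + 2)%N (gr_elt a (N + k * 2 + 2) z).
  by rewrite degE; apply: gr_elt_homog.
have -> : N%:Z - 2 + (k + 2 + e)%N%:Z = (N + k + e)%N%:Z by lia.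
move=> /gr_homog_elt[s as_ gE] /gr_homog_elt[t at_ hE].
exists e, s, t; split=> //.
have a1 := ideal_expM (pown (k + 2 + e) ax) as_.
have a2 := ideal_expM (pown (k + 2 + e) ay) at_.
have a3 := ideal_expM (ideal_expM (pown e ax) (pown e ay)) az.
have d : (k + 2 + e + (N + k + e) = N + k * 2 + e * 2 + 2)%N by lia.
have d' : (e + e + (N + k * 2 + 2) = N + k * 2 + e * 2 + 2)%N by lia.
have -> : (N + k * 2 + e * 2 + 3)%N = (N + k * 2 + e * 2 + 2).+1 by lia.
rewrite d in a1 a2; rewrite d' in a3.
rewrite exprMn; apply/gr_elt_eq => //; first exact: (idealD (EI _)).
move: E; rewrite gE hE exprMn !gr_eltX // -(gr_eltM (pown e ax) (pown e ay)).
rewrite -gr_eltM //; last exact: (ideal_expM (pown e ax) (pown e ay)).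
rewrite -(gr_eltM (pown _ ax) as_) -(gr_eltM (pown _ ay) at_) d d' => ->.
by rewrite gr_eltD.
Qed.

(* The error term of [vanishing_lift] is corrected degree by degree, up to the
   degrees where [a ^ n.+1 = (x, y) a ^ n]. *)
Lemma vanishing_descent N : (forall n, (N <= n)%N -> van (n%:Z - 2)) ->
  forall k z, pow (N + k * 2 + 2) z -> exists e s t,
    [/\ pow (N + k + e) s, pow (N + k + e) t &
        (x * y) ^+ e * z = x ^+ (k + 2 + e) * s + y ^+ (k + 2 + e) * t].
Proof.
(* [j] bounds the degrees left until [N] exceeds [r0]. The error term fits the pair [N + 1, k + e],
   as [N + 2 k + 2 e + 3 = (N + 1) + 2 (k + e) + 2]. *)
move=> vanN k z; move: {2}(r0.+1 - N)%N (leqnn (r0.+1 - N)) => j.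
elim: j N k z vanN => [|j IHj] N k z vanN; last first.
  move=> Nj az; have [e [s [t [as_ at_ aw]]]] := vanishing_lift (vanN _ (leqnn N)) az.
  set w := (X in pow _ X) in aw.
  have [|||e' [s' [t' [as' at' E]]]] := IHj N.+1 (k + e)%N w.
  - by move=> n /ltnW; apply: vanN.
  - by lia.
  - by have -> : (N.+1 + (k + e) * 2 + 2 = N + k * 2 + e * 2 + 3)%N by lia; exact: aw.
  exists (e + e')%N, (y ^+ e' * s + s'), (x ^+ e' * t + t').
  have d1 : (N + k + (e + e') = e' + (N + k + e))%N by lia.
  have d2 : (N.+1 + (k + e) + e' = (N + k + (e + e')).+1)%N by lia.
  rewrite d2 in as' at'.
  have yn := pown e' ay; have xn := pown e' ax.
  split.
  - apply: (idealD (EI _)); last exact: ideal_expS.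
    by rewrite d1; apply: ideal_expM.
  - apply: (idealD (EI _)); last exact: ideal_expS.
    by rewrite d1; apply: ideal_expM.
  have -> : (x * y) ^+ (e + e') * z = (x * y) ^+ e' * w + (x * y) ^+ e' *
      (x ^+ (k + 2 + e) * s + y ^+ (k + 2 + e) * t) by rewrite /w exprD; ring.
  rewrite E; have -> : (k + e + 2 + e' = k + 2 + (e + e'))%N by lia.
  by rewrite !exprD exprMn; ring.
rewrite leqn0 subn_eq0 => rN az.
have [||s [t [as_ at_ zE]]] := two_reduction_exp (N := N.-1) (i := k.+1) (j := k.+1) (z := z) xyred.
- by lia.
- by have -> : (N.-1 + k.+1 + k.+1).+1 = (N + k * 2 + 2)%N by lia.
have d : (N.-1 + k.+1 = N + k + 0)%N by lia.
rewrite d in as_ at_; exists 0%N, s, t; split=> //.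
by rewrite mul1r zE addn0 addn2.
Qed.

End CechReduction.

(** * The equivalences *)

Lemma residue_separated (A : comNzRingType) (m : idealr A) :
  infinite_set [set: {ideal_quot m}] ->
  exists f : nat -> A, forall i j, i != j -> ~ [set` m] (f i - f j).
Proof.
move=> /infiniteP/card_leP[g].
exists (fun i => repr (\val (g (to_setT i)))) => i j /eqP ij /=.
rewrite Quotient.idealrBE !reprK => /eqP/val_inj gij; apply: ij.
by have /(congr1 \val) : to_setT i = to_setT j by apply: (inj (f := g)) gij; rewrite inE.
Qed.

Lemma cohen_macaulay_regular_pair (A : comNzRingType) (m : set A) :
  cohen_macaulay_local m -> krull_dim A 2 ->
  exists u v, [/\ m u, m v & regular_pair u v].
Proof.
move=> [_ _ [d dimd [[s [sm sreg sd]] _]]] dim2.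
have d2 : d = 2%N := max_chain_inj dimd dim2.
move: s sm sreg sd; rewrite d2 => -[|u [|v [|]]] // sm [_ sreg] _.
exists u, v; split; [by apply: sm; rewrite /= mem_head|by apply: sm; rewrite /= !inE eqxx orbT|].
split=> [w uw|w s vw].
  by have := sreg 0%N isT w; rewrite /= ideal_gen_nil; apply.
have /= := sreg 1%N isT w => vreg.
have [|r [t [+ wE]]] := (ideal_gen_cons u [::] w).1 (vreg _).
  by apply/ideal_gen_cons; exists s, 0; rewrite ideal_gen_nil addr0.
by rewrite ideal_gen_nil => t0; exists r; rewrite wE t0 addr0.
Qed.

(** Cancelling [x ^+ j] by exactness gives [y ^+ j * (1 - y * w) = x * r], so [y ^+ j] is a multiple
    of [x]; exactness of [x, y ^+ j] then makes [x] a unit. *)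
Lemma pow_mul_notin_lin2 (R : comNzRingType) (m : set R) (x y : R) j :
  noetherian R -> local_ring m -> m x -> m y ->
  (forall k l, koszul_exact (x ^+ k) (y ^+ l)) ->
  ~ lin2 (x ^+ j.+1) (y ^+ j.+1) setT ((x * y) ^+ j).
Proof.
move=> noeth loc mx my kxy [r [s [_ _ E]]].
have mI := local_ideal loc.
have [|w [wE _]] := kxy j j.+1 (y ^+ j - x * r) s.
  by rewrite mulrBr -exprMn E !exprSr; ring.
have [t tE] := local_unit_sub1 noeth loc (ideal_mulr w mI my).
have [|w' [_ w'E]] := kxy 1%N j (r * t) 1.
  rewrite expr1 mulr1.
  have -> : y ^+ j = y ^+ j * ((1 - y * w) * t) by rewrite tE mulr1.
  have -> : y ^+ j * ((1 - y * w) * t) = (y ^+ j - y ^+ j.+1 * w) * t by rewrite exprSr; ring.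
  by rewrite -wE; ring.
by apply: (local_not1 loc); rewrite w'E expr1; apply: ideal_mulr.
Qed.

Theorem proposition7p6 (A : comNzRingType) (m a : idealr A)
    (cmA : cohen_macaulay_local [set` m])
    (infA : infinite_set [set: {ideal_quot m}])
    (dimA : krull_dim A 2)
    (prim_a : primary_to [set` m] [set` a]) :
  ((exists2 n : int, a_invariant a n & n <= -1) <->
   (exists N : nat, forall n : nat, (N <= n)%N ->
      reduction_number (ideal_exp [set` a] n) 1)) /\
  ((exists N : nat, forall n : nat, (N <= n)%N ->
      reduction_number (ideal_exp [set` a] n) 1) <->
   hilbert_coef [set` a] 2 2 0).
Proof.
have [noeth loc _] := cmA.
have [u [v [mu mv uvreg]]] := cohen_macaulay_regular_pair cmA dimA.
have oI (I : set A) : is_ideal I -> (exists c, ideal_exp [set` m] c `<=` I) -> open_ideal [set` m] I.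
  by split.
have uvopen : open_ideal [set` m] (lin2 u v setT).
  apply: oI; first exact: lin2_ideal (@ideal_setT A).
  by case: uvreg; apply: regular_pair_primary.
have [f fsep] := residue_separated infA.
have [[propera _] rada] := prim_a; have aI := propera.1.
have oa : open_ideal [set` m] [set` a].
  by apply: oI => //; apply: local_exp_sub => // x; rewrite -rada.
have red1 : reduces [set` a] [set` a] 0 by [].
have [x [y [r0 [ax ay xyred]]]] :=
  ex_two_reduction noeth loc mu mv uvreg uvopen fsep propera oa aI (@subset_refl _ _) red1.
have [b [c [n0 Hbc]]] := quadratic_colen_ex noeth loc mu mv uvreg propera oa xyred.
have iiE := reduction_number_iff noeth loc mu mv uvreg uvopen fsep propera oa xyred Hbc.
have iiiE := hilbert_coef_iff noeth loc oa Hbc.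
have powred k := two_reduction_pow k aI xyred.
have powE k (n0k : (n0 <= k)%N) := lin2_exp_eq_iff noeth loc mu mv uvreg propera oa Hbc (powred k) n0k.
have am := proper_sub_local noeth loc propera.
have oxy := two_reduction_open oa xyred.
have kxy k l := koszul_open_pow mu mv uvreg oxy (i := k) (j := l).
pose van n := cech_pair_vanishing (@gr_homog A a) (gr_elt a 1 x) (gr_elt a 1 y) n.
have [s [g [gH genf]]] := gr_plus_generators a noeth.
have iE : (exists2 n : int, a_invariant a n & n <= -1) <-> c = 0.
  split=> [[n [_ nmax] n1]|c0].
    have vanS i : (2 <= i)%N -> van (i%:Z - 2).
      move=> i2; apply: contrapT => /(gr_cech_pair xyred _ gH genf) neq0.
      have : local_cohomology_neq0 (@gr_homog A a) (@gr_plus A a) 2 (i%:Z - 2) by exists s, g.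
      by move/nmax; lia.
    have [N sat] := lin2_pow_saturated noeth loc mu mv uvreg propera oa xyred Hbc.
    (* [powE] at [k] concerns the power [k.+1], [vanishing_descent] the power [k + 2]: both are used
       for the power [N + n0 + 2]. *)
    have Nk : (n0 <= (N + n0).+1)%N by lia.
    apply/(powE _ Nk)/seteqP; split; first exact: (lin2_exp_sub (powred _)).
    move=> z az; have [|e [p [q [ap aq E]]]] := vanishing_descent xyred vanS (k := (N + n0)%N) (z := z).
      by have -> : (2 + (N + n0) * 2 + 2 = (N + n0).+2 * 2)%N by lia.
    apply: (sat _ e) => //; first by lia.
    have d1 : (N + n0 + 2 + e = (N + n0).+2 + e)%N by lia.
    have d2 : (2 + (N + n0) + e = (N + n0).+2 + e)%N by lia.
    by rewrite d1 in E; rewrite d2 in ap aq; exists p, q.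
  have vanpos n : 0 <= n -> van n.
    apply: (vanishing_of_power_equality xyred (n0 := n0.+1)) => -[//|k] n0k.
    by have [_ ->//] := powE k n0k.
  have neg n : local_cohomology_neq0 (@gr_homog A a) (@gr_plus A a) 2 n -> n <= -1.
    move=> [s' [g' [g'H genf' neq0]]]; case: (leP 0 n) => [n0'|]; last by lia.
    by case: ((gr_cech_pair xyred n g'H genf').1 neq0); apply: vanpos.
  have neq n : ~ van n -> local_cohomology_neq0 (@gr_homog A a) (@gr_plus A a) 2 n.
    by move=> nvan; exists s, g; split=> //; apply/(gr_cech_pair xyred _ gH genf).
  (* The a-invariant has to exist as a maximum: a nonzero component is found in degree -1 or,
     failing that, -2. *)
  have [van1|nvan1] := pselect (van (-1)); last by exists (-1) => //; split; [apply: neq|apply: neg].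
  have [van2|nvan2] := pselect (van (-2)); last first.
    exists (-2) => //; split=> [|k kneq0]; first exact: neq.
    have := neg _ kneq0; rewrite le_eqVlt => /orP[/eqP kE|]; last by lia.
    move: kneq0; rewrite kE => -[s' [g' [g'H genf' neq0]]].
    by case: ((gr_cech_pair xyred (-1) g'H genf').1 neq0).
  have vanall i : (0 <= i)%N -> van (i%:Z - 2).
    by case: i => [|[|i]] _ //; apply: vanpos; lia.
  (* Descent from [x * y] with [N = k = 0] puts [(x * y) ^+ e.+1] in [(x ^+ e.+2, y ^+ e.+2)]. *)
  have [|e [p [q [ap aq E]]]] := vanishing_descent xyred vanall (k := 0%N) (z := x * y).
    by apply: (@ideal_expM _ _ 1 1); rewrite ideal_exp1.
  case: (@pow_mul_notin_lin2 _ [set` m] x y e.+1 noeth loc (am _ ax) (am _ ay)).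
    by move=> k l; apply: kxy.
  by exists p, q; split=> //; rewrite exprSr E.
by split; [rewrite iE iiE|rewrite iiE iiiE].
Qed.
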